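(* Let $\nu\in M(K\times B_{E^*})$ be arbitrary. Then there is a function $\mathbf h:K\to B_{E^*}$ such that $$\int_K \mathbf f\,dT^*\nu=\int_K \mathbf h(t)(\mathbf f(t))\,d\pi_1(|\nu|)(t)\quad\text{for every }\mathbf f\in C(K,E).$$ Then we also have $$T^*\nu(A)(x)=\int_A \mathbf h(t)(x)\,d\pi_1(|\nu|)(t)\quad\text{for every Borel }A\subset K\text{ and every }x\in E.$$ A possible choice for $\mathbf h$ is $\mathbf h(t)=r(\nu_t)$ for $t\in K$, where $(\nu_t)_{t\in K}$ is a disintegration kernel of $\nu$.
   Context: $\mathbb F\in\{\mathbb R,\mathbb C\}$ is the scalar field, $K$ is a compact Hausdorff space, $E$ is a Banach space over $\mathbb F$, and $B_{E^*}$ is the closed unit ball of $E^*$ with the weak$^*$ topology. For a compact space $X$, $M(X)$ is the space of $\mathbb F$-valued Radon measures on $X$ with the total variation norm. $C(K,E)$ is the space of continuous functions $K\to E$ with the sup norm. $M(K,E^* )$ is the space of regular $\sigma$-additive $E^*$-valued Borel measures $\mu$ on $K$ of bounded variation; $|\mu|$ is the variation and $\|\mu\|=|\mu|(K)$. For $\mathbf f\in C(K,E)$, $\int\mathbf f\,d\mu$ is the extension by uniform limits of $\int\sum_j\chi_{A_j}x_j\,d\mu=\sum_j\mu(A_j)(x_j)$; this identifies $M(K,E^* )$ isometrically with $C(K,E)^*$. The map $T:C(K,E)\to C(K\times B_{E^*})$ is $T\mathbf f(t,x^* )=x^*(\mathbf f(t))$. Its adjoint is viewed as $T^*:M(K\times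 B_{E^*})\to M(K,E^* )$, so $\int\mathbf f\,dT^*\nu=\int x^*(\mathbf f(t))\,d\nu(t,x^* )$ and $T^*\nu(A)(x)=\int_{A\times B_{E^*}}x^*(x)\,d\nu(t,x^* )$. $\pi_1(|\nu|)$ denotes the image of the variation $|\nu|$ under the projection $K\times B_{E^*}\to K$. For an $\mathbb F$-valued Radon measure $\lambda$ on $B_{E^*}$, $r(\lambda)\in E^*$ is the unique functional with $r(\lambda)(x)=\int x^*(x)\,d\lambda(x^* )$ for all $x\in E$; $\|r(\lambda)\|\le\|\lambda\|$. A disintegration kernel of $\nu\in M(K\times L)$ ($L$ compact Hausdorff, $\sigma=\pi_1(|\nu|)$) is a family $(\nu_t)_{t\in K}$ of $\mathbb F$-valued Radon measures on $L$ such that (i) $\|\nu_t\|=1$ for each $t$; (ii) for each continuous scalar function $f$ on $K\times L$ the function $t\mapsto\int_L f(t,z)\,d\nu_t(z)$ is $\sigma$-measurable and $\int f\,d\nu=\int_K\left(\int_L f(t,z)\,d\nu_t(z)\right)d\sigma(t)$; (iii) for Borel $A\subset K$, $B\subset L$, $t\mapsto\nu_t(B)$ is $\sigma$-measurable and $\nu(A\times B)=\int_A\nu_t(B)\,d\sigma(t)$. If $\nu\ge0$, the $\nu_t$ are taken to be probability measures. Disintegration kernels exist for every $\nu$. *)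

(* Defs.v *)
From HB Require Import structures.
From mathcomp Require Import all_boot all_order all_algebra.
From mathcomp Require Import complex.
From mathcomp Require Import all_classical all_reals all_analysis.

Set Implicit Arguments.
Unset Strict Implicit.
Unset Printing Implicit Defensive.
Import Order.TTheory GRing.Theory Num.Theory.
Import numFieldNormedType.Exports.

Local Open Scope classical_set_scope.
Local Open Scope ring_scope.

(* The scalar field is R or R[i]. *)
Inductive scalar_kind := RealScalars | ComplexScalars.

Definition scalars (R : realType) (k : scalar_kind) : numFieldType :=
  match k with
  | RealScalars => R
  | ComplexScalars => R[i]
  end.

Section Scalars.
Context {R : realType} {k : scalar_kind}.

Definition re_part : scalars R k -> R :=
  match k with
  | RealScalars => fun x : R => x
  | ComplexScalars => fun z : R[i] => complex.Re z
  end.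

Definition im_part : scalars R k -> R :=
  match k with
  | RealScalars => fun _ : R => 0
  | ComplexScalars => fun z : R[i] => complex.Im z
  end.

Definition scalar_mk : R -> R -> scalars R k :=
  match k with
  | RealScalars => fun a _ : R => a
  | ComplexScalars => fun a b : R => Complex a b
  end.

Definition abs (c : scalars R k) : \bar R := (re_part `|c|)%:E.

End Scalars.

Definition borel (X : topologicalType) : set (set X) := <<s @open X >>.

Definition borelType (X : ptopologicalType) := g_sigma_algebraType (@open X).

(* N is the norm of V. The values of m on non-Borel sets are irrelevant. *)
Section VectorMeasures.
Context {R : realType} {X : topologicalType} {V : zmodType}.
Variables (N : V -> \bar R) (m : set X -> V).

Definition countably_additive : Prop :=
  forall B : (set X)^nat, (forall n, borel (B n)) -> trivIset setT B ->
    N (m (\bigcup_n B n) - \sum_(0 <= i < n) m (B i)) @[n --> \oo] --> 0%E.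

(* For Borel A, replacing the disjoint families in A by the partitions of A
   gives the same supremum. *)
Definition variation (A : set X) : \bar R :=
  ereal_sup [set x | exists n (P : 'I_n -> set X),
    [/\ forall i, borel (P i), trivIset setT P, forall i, P i `<=` A
      & x = (\sum_(i < n) N (m (P i)))%E]].

Definition regular_measure : Prop :=
  forall A, borel A -> forall e : R, 0 < e ->
    exists C U, [/\ compact C, open U, C `<=` A, A `<=` U
      & (variation (U `\` C) < e%:E)%E].

Definition radon_measure : Prop :=
  [/\ countably_additive, (variation setT < +oo)%E & regular_measure].

End VectorMeasures.

Section Integrals.
Context {R : realType} {k : scalar_kind}.
Local Notation F := (scalars R k).

(* The list [:: (A_1, x_1); ...; (A_n, x_n)] stands for the simple function
   \sum_j \chi_(A_j) x_j. *)
Definition simple_function (X : topologicalType) (V : normedModType F)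
    (s : seq (set X * V)) (t : X) : V :=
  \sum_(p <- s) (\1_(p.1) t : F) *: p.2.

Definition simple_integral (X : topologicalType) (V : normedModType F)
    (m : set X -> V -> F) (s : seq (set X * V)) : F :=
  \sum_(p <- s) m p.1 p.2.

Definition is_integral (X : topologicalType) (V : normedModType F)
    (m : set X -> V -> F) (f : X -> V) (l : F) : Prop :=
  exists s : nat -> seq (set X * V),
    [/\ forall n p, p \in s n -> borel p.1,
        forall e : F, 0 < e -> \forall n \near \oo,
          forall t, `|f t - simple_function (s n) t| <= e
      & simple_integral m (s n) @[n --> \oo] --> l].

Definition integral_vm (X : topologicalType) (V : normedModType F)
    (m : set X -> V -> F) (f : X -> V) : F :=
  xget 0 [set l | is_integral m f l].

(* A scalar measure acts on scalars by multiplication. *)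
Definition integral_sm (X : topologicalType) (nu : set X -> F) (f : X -> F) : F :=
  @integral_vm X F^o (fun A c => nu A * c) f.

(* Measurability is with respect to the completion of sigma. The library integral
   is defined through suprema over simple functions below the positive and the
   negative part, so that changing a function on a sigma-null set does not change
   it, even if the result is not Borel. *)
Section PositiveMeasure.
Context {X : ptopologicalType}.
Variables (sigma : set (borelType X) -> \bar R) (A : set (borelType X)).
Implicit Type g : borelType X -> F.

Definition completion_measurable g : Prop :=
  exists g' : borelType X -> F,
    [/\ measurable_fun setT (re_part \o g'), measurable_fun setT (im_part \o g')
      & sigma.-negligible [set t | A t /\ g t <> g' t]].

Definition integral_pm g : F :=
  scalar_mk (fine (\int[sigma]_(t in A) (re_part (g t))%:E)%E)
            (fine (\int[sigma]_(t in A) (im_part (g t))%:E)%E).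

Definition integrable_pm g : Prop :=
  completion_measurable g /\ (\int[sigma]_(t in A) abs (g t) < +oo)%E.

End PositiveMeasure.
End Integrals.

Section Dual.
Context {R : realType} {k : scalar_kind}.
Local Notation F := (scalars R k).
Variable E : normedModType F.

Definition dual_space : set (E -> F) :=
  [set phi | linear (phi : E -> F^o) /\ continuous (phi : E -> F^o)].

Definition dual_norm (phi : E -> F) : \bar R :=
  ereal_sup [set abs (phi x) | x in [set x | `|x| <= 1]].

(* Functions E -> F carry the topology of pointwise convergence, which induces
   the weak* topology on the dual ball. *)
Definition dual_ball_set : set {ptws E -> F} :=
  [set phi | dual_space phi /\ (dual_norm phi <= 1)%E].

Definition dual_ball : topologicalType := set_type dual_ball_set.

Definition ball_fun (phi : dual_ball) : E -> F := set_val phi.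

End Dual.

Section Theory.
Context {R : realType} {k : scalar_kind}.
Local Notation F := (scalars R k).

Definition scalar_measure (X : topologicalType) (nu : set X -> F) : Prop :=
  radon_measure abs nu.

Definition positive_scalar_measure (X : topologicalType) (nu : set X -> F) : Prop :=
  forall A, borel A -> 0 <= nu A.

Definition dual_measure (X : topologicalType) (E : normedModType F)
    (m : set X -> (E -> F)) : Prop :=
  (forall A, borel A -> dual_space (m A)) /\ radon_measure (@dual_norm R k E) m.

(* The image of the variation of nu under the first projection. *)
Definition pi1_variation (K : ptopologicalType) (L : topologicalType)
    (nu : set (K * L) -> F) : set (borelType K) -> \bar R :=
  fun A => variation abs nu (fst @^-1` A).

Definition evalT (K : topologicalType) (E : normedModType F) (f : K -> E) :
    K * dual_ball E -> F :=
  fun p => ball_fun p.2 (f p.1).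

(* m represents the functional f |-> \int (T f) dnu on C(K, E). *)
Definition is_adjointT (K : topologicalType) (E : normedModType F)
    (nu : set (K * dual_ball E) -> F) (m : set K -> (E -> F)) : Prop :=
  dual_measure m /\
  forall f : K -> E, continuous f -> integral_vm m f = integral_sm nu (evalT f).

Definition adjointT (K : topologicalType) (E : normedModType F)
    (nu : set (K * dual_ball E) -> F) : set K -> (E -> F) :=
  xget (fun _ _ => 0) [set m : set K -> (E -> F) | is_adjointT nu m].

Definition barycenter (E : normedModType F) (lambda : set (dual_ball E) -> F) :
    E -> F :=
  fun x => integral_sm lambda (fun phi => ball_fun phi x).

Definition disintegration_kernel (K : ptopologicalType) (L : topologicalType)
    (nu : set (K * L) -> F) (nut : K -> set L -> F) : Prop :=
  let sigma := pi1_variation nu in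
  [/\ forall t, scalar_measure (nut t) /\ variation abs (nut t) setT = 1%E,
      forall f : K * L -> F, continuous (f : K * L -> F^o) ->
        completion_measurable sigma setT
          (fun t => integral_sm (nut t) (fun z => f (t, z))) /\
        integral_sm nu f =
          integral_pm sigma setT (fun t => integral_sm (nut t) (fun z => f (t, z))),
      forall (A : set K) (B : set L), borel A -> borel B ->
        completion_measurable sigma setT (fun t => nut t B) /\
        nu (A `*` B) = integral_pm sigma A (fun t => nut t B)
    & positive_scalar_measure nu ->
        forall t, positive_scalar_measure (nut t) /\ nut t setT = 1].

End Theory.

(* Main.v *)
Require Import Defs.
From HB Require Import structures.
From mathcomp Require Import all_boot all_order all_algebra.
From mathcomp Require Import complex.
From mathcomp Require Import all_classical all_reals all_analysis.
From mathcomp Require Import measurable_realfun.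
From mathcomp Require Import ring lra.

Set Implicit Arguments.
Unset Strict Implicit.
Unset Printing Implicit Defensive.
Import Order.TTheory GRing.Theory Num.Theory.
Import numFieldNormedType.Exports.

Local Open Scope classical_set_scope.
Local Open Scope ring_scope.

(* The measure sigma = pi1(|nu|) admits a linear lifting rho: a linear, norm-decreasing choice of one
   function in each class of bounded measurable functions modulo sigma-null sets. It is obtained by
   Zorn's lemma from liftings on sub-sigma-algebras: a single set can be adjoined, a chain without
   countable cofinal subset has a union, and along a sequence one takes a generalized limit of
   lifted conditional expectations, which converge almost everywhere. For x in E the real part of
   T^*nu(.)(x) has a sigma-density g_x with |g_x| <= ||x||; since rho is linear,
   h(t)(x) = rho(g_x)(t) - i rho(g_(ix))(t) is linear in x with |h(t)(x)| <= ||x|| for every t, and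
   the formula for continuous functions follows by approximating them by simple functions.
   The formula for Borel sets follows from the one for continuous functions by regularity of sigma
   and of |T^*nu| and Urysohn's lemma; for h(t) = r(nu_t), one applies the kernel to T f. *)

(** * Bounded measurable functions and densities *)

(** The obstacle is that [E] need not be separable. A single linear relation between the densities
    [g_x] holds outside a null set, but there are uncountably many relations, and discarding one
    null set for each may discard every point. The lifting deals with all of them at once. A
    disintegration kernel would avoid this, but kernels enter only as a hypothesis of the last
    claim. What matters of the lifting is its linearity and its norm bound, which is why conditional
    expectations, linear but not multiplicative, can be used to build it. They are needed along a
    sequence because a union of increasing sigma-algebras is in general no sigma-algebra: a function
    measurable for the generated one may be measurable for no member. Finally, [adjointT] is a
    choice among the measures representing the functional, so its values on Borel sets are
    accessible only through integrals of continuous functions; the explicit [adjoint_measure] shows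
    that such a measure exists, and it is the one whose densities are taken. *)

Section BoundedMeasurable.
Context d (T : measurableType d) (R : realType).
Implicit Types (G H : set (set T)) (f g : T -> R).

(* Only the sigma-algebra generated by [G] matters; [G = measurable] gives all bounded
   measurable functions. *)
Definition bounded_measurable G f :=
  measurable_fun (setT : set (g_sigma_algebraType G))
    (f : g_sigma_algebraType G -> R) /\ exists c : R, forall t, `|f t| <= c.

Lemma bounded_measurable_preimage G f (Y : set R) :
  bounded_measurable G f -> measurable Y -> <<s G >> (f @^-1` Y).
Proof. by case=> mf _ mY; have := mf measurableT Y mY; rewrite setTI. Qed.

Lemma bounded_measurable_sub G H f : <<s G >> `<=` <<s H >> ->
  bounded_measurable G f -> bounded_measurable H f.
Proof. by move=> GH [mf bf]; split=> // _ Y mY; apply: GH; exact: mf. Qed.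

Lemma g_sigma_measurable G : G `<=` measurable -> <<s G >> `<=` @measurable d T.
Proof. by move=> GM; apply: smallest_sub => //; exact: sigma_algebra_measurable. Qed.

Lemma bounded_measurableT G f : G `<=` measurable ->
  bounded_measurable G f -> measurable_fun setT f.
Proof.
move=> GM [mf bf] _ Y mY; apply: (g_sigma_measurable GM).
exact: (mf measurableT Y mY).
Qed.

Lemma bounded_measurable_measurable f c : measurable_fun setT f ->
  (forall t, `|f t| <= c) -> bounded_measurable measurable f.
Proof.
move=> mf bf; split; last by exists c.
by move=> _ Y mY; apply: sub_gen_smallest; exact: mf.
Qed.

Lemma bounded_measurable_cst G (a : R) : bounded_measurable G (cst a).
Proof. by split; [exact: measurable_cst|exists `|a|]. Qed.

Lemma bounded_measurableD G f g : bounded_measurable G f ->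
  bounded_measurable G g -> bounded_measurable G (fun t => f t + g t).
Proof.
move=> [mf [a bf]] [mg [b bg]]; split.
  exact: (@measurable_funD _ (g_sigma_algebraType G) R setT).
by exists (a + b) => t; rewrite (le_trans (ler_normD _ _))// lerD.
Qed.

Lemma bounded_measurableM G f g : bounded_measurable G f ->
  bounded_measurable G g -> bounded_measurable G (fun t => f t * g t).
Proof.
move=> [mf [a bf]] [mg [b bg]]; split.
  exact: (@measurable_funM _ (g_sigma_algebraType G) R setT).
by exists (a * b) => t; rewrite normrM ler_pM.
Qed.

Lemma bounded_measurableZ G (a : R) f :
  bounded_measurable G f -> bounded_measurable G (fun t => a * f t).
Proof. by apply: bounded_measurableM; exact: bounded_measurable_cst. Qed.

Lemma bounded_measurableB G f g : bounded_measurable G f ->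
  bounded_measurable G g -> bounded_measurable G (fun t => f t - g t).
Proof.
move=> bf /(bounded_measurableZ (-1)) /(bounded_measurableD bf).
by under eq_fun do rewrite mulN1r.
Qed.

Lemma bounded_measurable_norm G f :
  bounded_measurable G f -> bounded_measurable G (fun t => `|f t|).
Proof.
move=> [mf [a bf]]; split; last by exists a => t; rewrite normr_id.
exact: (measurableT_comp (@normr_measurable R setT) mf).
Qed.

Lemma bounded_measurable_indic G (A : set T) :
  <<s G >> A -> bounded_measurable G (\1_A : T -> R).
Proof.
move=> GA; split; first exact: (@measurable_indic _ (g_sigma_algebraType G) R setT A).
by exists 1 => t; rewrite indicE; case: (t \in A); rewrite ?normr1// normr0.
Qed.

Lemma bounded_measurable_if G (A : set T) f g : <<s G >> A ->
  bounded_measurable G f -> bounded_measurable G g ->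
  bounded_measurable G (fun t => if t \in A then f t else g t).
Proof.
move=> GA bf bg.
rewrite (_ : (fun _ => _) = (fun t => \1_A t * f t + (1 - \1_A t) * g t)).
  apply: bounded_measurableD; apply: bounded_measurableM => //.
    exact: bounded_measurable_indic.
  apply: bounded_measurableB; last exact: bounded_measurable_indic.
  exact: bounded_measurable_cst.
apply/funext => t; rewrite indicE; case: (t \in A) => /=.
  by rewrite mul1r subrr mul0r addr0.
by rewrite mul0r subr0 add0r mul1r.
Qed.

End BoundedMeasurable.

Section Comparison.
Context d (T : measurableType d) (R : realType).
Variable mu : {measure set T -> \bar R}.
Implicit Types (f g : T -> R).

(** Tested on the set where [g < f]: the hypothesis forces the integral of [|g - f|] over it to
    vanish, so this set is null. *)
Lemma ae_le_of_integral f g :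
  mu.-integrable setT (EFin \o f) -> mu.-integrable setT (EFin \o g) ->
  (forall A, measurable A ->
    \int[mu]_(t in A) f t <= \int[mu]_(t in A) g t)%R ->
  {ae mu, forall t, f t <= g t}.
Proof.
move=> If Ig fg.
have mf : measurable_fun setT f by apply/measurable_EFinP; exact: measurable_int If.
have mg : measurable_fun setT g by apply/measurable_EFinP; exact: measurable_int Ig.
have mgf := measurable_funB mg mf.
pose A := (g \- f) @^-1` `]-oo, 0[%classic.
have mA : measurable A by rewrite -[A]setTI; exact: mgf.
have IfA : mu.-integrable A (EFin \o f) by exact: integrableS If.
have IgA : mu.-integrable A (EFin \o g) by exact: integrableS Ig.
have int0 : (\int[mu]_(t in A) `|((g \- f) t)%:E| = 0)%E.
  apply/eqP; rewrite eq_le integral_ge0 ?andbT//.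
  have -> : (\int[mu]_(t in A) `|((g \- f) t)%:E|)%E =
            (\int[mu]_(t in A) ((f t)%:E - (g t)%:E))%E.
    apply: eq_integral => t; rewrite inE /A /= in_itv/= => gf.
    by rewrite ltr0_norm// opprB.
  rewrite integralB_EFin//.
  have := fg _ mA; rewrite /Rintegral.
  rewrite -{2}(fineK (integrable_fin_num mA IfA)).
  rewrite -{2}(fineK (integrable_fin_num mA IgA)).
  by rewrite -EFinB lee_fin subr_le0.
have /(ae_eq_integral_abs _ mA) H : measurable_fun A (EFin \o (g \- f)).
  by apply/measurable_EFinP; exact: measurable_funTS.
have /H := int0; apply: filterS => t /= At.
rewrite -subr_ge0 leNgt; apply/negP => gf0.
have : A t by rewrite /A /= in_itv.
by move=> /At /= -[] gf; move: gf0; rewrite gf ltxx.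
Qed.

End Comparison.

Section FiniteMeasureIntegral.
Context d (T : measurableType d) (R : realType).
Variable mu : {finite_measure set T -> \bar R}.
Implicit Types (f g : T -> R) (G : set (set T)).

Lemma bounded_integrable f c (A : set T) : measurable A ->
  measurable_fun setT f -> (forall t, `|f t| <= c) ->
  mu.-integrable A (EFin \o f).
Proof.
move=> mA mf bf; apply: measurable_bounded_integrable => //.
- by rewrite ltey_eq fin_num_measure.
- exact: measurable_funTS.
- by exists c; split; rewrite ?num_real// => M cM t _; exact: (le_trans (bf t) (ltW cM)).
Qed.

Lemma bounded_measurable_integrable G f (A : set T) :
  G `<=` measurable -> bounded_measurable G f -> measurable A ->
  mu.-integrable A (EFin \o f).
Proof.
move=> GM bf mA; have mf := bounded_measurableT GM bf.
by case: bf => _ [c bf]; exact: (bounded_integrable mA mf bf).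
Qed.

End FiniteMeasureIntegral.

Section IntegralMono.
Context d (T : measurableType d) (R : realType).
Variable mu : {measure set T -> \bar R}.
Import HBNNSimple.

(* No measurability is assumed: the integral is a supremum over simple functions, each of
   which can be cut off on the null set. *)
Lemma ge0_integral_le_off_null (D N : set T) (f g : T -> \bar R) :
  measurable N -> mu N = 0%E -> (forall t, D t -> (0 <= f t)%E) ->
  (forall t, D t -> (0 <= g t)%E) -> (forall t, D t -> ~ N t -> (f t <= g t)%E) ->
  (\int[mu]_(t in D) f t <= \int[mu]_(t in D) g t)%E.
Proof.
move=> mN N0 f0 g0 fg; rewrite ge0_integralE// (ge0_integralE _ g0).
apply: ge_ereal_sup => _ [h hf <-].
have mNC := measurableC mN.
apply: (@le_trans _ _ (sintegral mu (proj_nnsfun h mNC))).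
  rewrite -!integralT_nnsfun le_eqVlt; apply/orP; left; apply/eqP; apply: ae_eq_integral => //.
  - by apply/measurable_EFinP.
  - by apply/measurable_EFinP.
  - exists N; split => // t /= Ht; apply: contrapT => Nt; apply: Ht => _.
    by rewrite mindicE mem_set// mulr1.
apply: ereal_sup_ubound; exists (proj_nnsfun h mNC) => // t.
rewrite /= mindicE; have [/set_mem Nt|Nt] := boolP (t \in ~` N); last first.
  rewrite mulr0 /patch; case: ifPn => // /set_mem; exact: g0.
rewrite mulr1; apply: le_trans (hf t) _; rewrite /patch.
by case: ifPn => // /set_mem Dt; exact: fg.
Qed.

Lemma integral_eq_off_null (D N : set T) (f g : T -> \bar R) :
  measurable N -> mu N = 0%E -> (forall t, D t -> ~ N t -> f t = g t) ->
  (\int[mu]_(t in D) f t = \int[mu]_(t in D) g t)%E.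
Proof.
move=> mN N0 fg; rewrite integralE [RHS]integralE; congr (_ - _)%E; apply/eqP;
  rewrite eq_le; apply/andP; split; apply: (ge0_integral_le_off_null mN N0) => t Dt //=;
  by move=> Nt; rewrite unlock fg.
Qed.

End IntegralMono.

(** * Bounded densities of dominated set functions *)

Section Density.
Context d (T : measurableType d) (R : realType).
Variable mu : {finite_measure set T -> \bar R}.
Variables (q : set T -> R) (c : R).
Hypothesis q_le : forall A, measurable A -> `|q A| <= c * fine (mu A).
Hypothesis qU : forall A B, measurable A -> measurable B -> A `&` B = set0 ->
  q (A `|` B) = q A + q B.
Hypothesis c_ge0 : 0 <= c.

(** The proofs are carried as arguments so that the term alone determines the charge structure
    declared on it below. *)
Definition additive_charge (_ : forall A, measurable A -> `|q A| <= c * fine (mu A))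
    (_ : forall A B, measurable A -> measurable B -> A `&` B = set0 ->
      q (A `|` B) = q A + q B) (_ : 0 <= c) : set T -> \bar R :=
  fun A => (q A)%:E.

Local Notation nu := (additive_charge q_le qU c_ge0).

Let q0 : q set0 = 0.
Proof.
by apply/eqP; rewrite -normr_le0; have := q_le measurable0; rewrite measure0 mulr0.
Qed.

Let nu0 : nu set0 = 0%E.
Proof. by rewrite /additive_charge q0. Qed.

Let nu_fin (A : set T) : measurable A -> nu A \is a fin_num.
Proof. by []. Qed.

Let nu_sum (B : (set T)^nat) n : (forall n, measurable (B n)) -> trivIset setT B ->
  \sum_(0 <= i < n) q (B i) = q (\big[setU/set0]_(i < n) B i).
Proof.
move=> mB tB; elim: n => [|n IH]; first by rewrite big_nil big_ord0 q0.
rewrite big_nat_recr//= IH big_ord_recr/= qU//; first exact: bigsetU_measurable.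
apply/seteqP; split=> // t []; rewrite -bigcup_mkord => -[i /= iN Gi] Gn.
by have := tB i n I I (ex_intro _ t (conj Gi Gn)) => e; rewrite e ltnn in iN.
Qed.

(** Finite additivity suffices thanks to the domination: the remainder of the series is [q] of the
    tail of the union, at most [c] times its measure, which tends to zero. *)
Let nu_sigma_additive : semi_sigma_additive nu.
Proof.
move=> B mB tB mUB; rewrite /additive_charge.
rewrite (_ : (fun n => _) = EFin \o (fun n => \sum_(0 <= i < n) q (B i))); last first.
  by apply/funext => n /=; rewrite sumEFin.
apply: cvg_EFin; first exact: nearW.
apply/cvgrPdist_le => e e0.
(* [c] may be zero, so the tolerance is divided by [c + 1]. *)
have c1 : 0 < c + 1 by rewrite ltr_wpDl.
have : (\sum_(0 <= i < n) mu (B i))%E @[n --> \oo] --> (fine (mu (\bigcup_n B n)))%:E.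
  by rewrite fineK ?fin_num_measure//; exact: measure_semi_sigma_additive.
move=> /fine_cvgP[_ /cvgrPdist_le/(_ _ (divr_gt0 e0 c1))[n0 _ H]].
exists n0 => // n /H/= h.
have mU : measurable (\big[setU/set0]_(i < n) B i) by exact: bigsetU_measurable.
have mD : measurable (\bigcup_n B n `\` \big[setU/set0]_(i < n) B i) by exact: measurableD.
have UD : \big[setU/set0]_(i < n) B i `<=` \bigcup_n B n.
  by rewrite -bigcup_mkord => t [i _ Bi]; exists i.
rewrite nu_sum// -[X in q X - _](setDUK UD) qU ?setDIK// addrAC subrr add0r.
apply: le_trans (q_le mD) _.
rewrite measureD//; last by rewrite -ge0_fin_numE ?fin_num_measure.
rewrite setIidr// fineB ?fin_num_measure//.
rewrite -[leRHS](divfK (lt0r_neq0 c1)) mulrC.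
apply: ler_pM => //; first by rewrite subr_ge0 fine_le ?fin_num_measure// le_measure ?inE.
  apply: le_trans h; apply: le_trans _ (ler_norm _).
  by rewrite big_mkord measure_bigsetU.
by rewrite lerDl.
Qed.

HB.instance Definition _ := isCharge.Build _ _ _ nu nu0 nu_fin nu_sigma_additive.

(** The Radon-Nikodym density lies between [-c] and [c] a.e. by comparison of integrals; clipping it
    to this interval gives the bound at every point and changes no integral. *)
Lemma dominated_density : exists g : T -> R, [/\ measurable_fun setT g,
  forall t, `|g t| <= c & forall A, measurable A -> q A = \int[mu]_(t in A) g t].
Proof.
have dom : nu `<< mu.
  apply/null_content_dominatesP => A mA A0.
  rewrite /= /additive_charge; congr EFin.
  by apply/eqP; rewrite -normr_le0; have := q_le mA; rewrite A0 mulr0.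
pose g0 t := fine (Radon_Nikodym nu mu t).
have Ig0 : mu.-integrable setT (EFin \o g0).
  apply: eq_integrable (Radon_Nikodym_integrable dom) => // t _ /=.
  by rewrite fineK// Radon_Nikodym_fin_num.
have g0E A : measurable A -> \int[mu]_(t in A) g0 t = q A.
  move=> mA; rewrite /Rintegral -[q A]/(fine (nu A)) (Radon_Nikodym_integral dom mA).
  by congr fine; apply: eq_integral => t _; rewrite fineK// Radon_Nikodym_fin_num.
have mg0 : measurable_fun setT g0 by apply/measurable_EFinP; exact: measurable_int Ig0.
pose g t := Num.max (- c) (Num.min c (g0 t)).
have Icst (a : R) : mu.-integrable setT (EFin \o cst a).
  exact: finite_measure_integrable_cst.
have q_le' A : measurable A -> - (c * fine (mu A)) <= q A <= c * fine (mu A).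
  by move=> mA; rewrite -ler_norml; exact: q_le.
have [N1 [mN1 N10 le1]] : {ae mu, forall t, g0 t <= c}.
  apply: (ae_le_of_integral Ig0 (Icst c)) => A mA.
  by rewrite g0E// Rintegral_cst//; have /andP[] := q_le' A mA.
have [N2 [mN2 N20 le2]] : {ae mu, forall t, - c <= g0 t}.
  apply: (ae_le_of_integral (Icst (- c)) Ig0) => A mA.
  by rewrite g0E// Rintegral_cst// mulNr; have /andP[] := q_le' A mA.
exists g; split.
- by apply: measurable_maxr => //; apply: measurable_minr.
- move=> t; rewrite /g ler_norml le_max lexx /= ge_max ge_min lexx /= andbT.
  by rewrite (le_trans _ c_ge0)// oppr_le0.
- move=> A mA; rewrite -g0E//; congr fine.
  apply: (@integral_eq_off_null _ _ _ _ A (N1 `|` N2)).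
  + exact: measurableU.
  + by rewrite measureU0.
  + move=> t _ Nt; congr EFin; rewrite /g.
    have h1 : g0 t <= c by apply: contrapT => h; apply: Nt; left; exact: le1.
    have h2 : - c <= g0 t by apply: contrapT => h; apply: Nt; right; exact: le2.
    by rewrite (min_idPr h1) (max_idPr h2).
Qed.

End Density.

(** * Sub-sigma-algebras and conditional expectations *)

Section SubMeasure.
Context d (T : measurableType d) (R : realType).
Variable mu : {finite_measure set T -> \bar R}.
Variables (G : set (set T)) (GM : G `<=` measurable).

Let TG := g_sigma_algebraType G.

Let gm : forall A : set TG, measurable A -> @measurable d T A.
Proof. by move=> A; exact: (g_sigma_measurable GM). Qed.

(* The unused proof argument lets the measure structure be found by unification. *)
Definition sub_measure (_ : G `<=` measurable) : set TG -> \bar R := mu.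

Let sub_measure0 : sub_measure GM set0 = 0%E.
Proof. exact: measure0. Qed.

Let sub_measure_ge0 (A : set TG) : (0 <= sub_measure GM A)%E.
Proof. exact: measure_ge0. Qed.

Let sub_measure_sigma_additive : semi_sigma_additive (sub_measure GM).
Proof.
move=> F mF tF mUF; apply: measure_semi_sigma_additive => //.
  by move=> i; exact: gm.
exact: gm.
Qed.

HB.instance Definition _ := isMeasure.Build _ _ _ (sub_measure GM)
  sub_measure0 sub_measure_ge0 sub_measure_sigma_additive.

Let sub_measure_fin : fin_num_fun (sub_measure GM).
Proof. by move=> A mA; apply: fin_num_measure; exact: gm. Qed.

HB.instance Definition _ := @Measure_isFinite.Build _ _ _ (sub_measure GM)
  sub_measure_fin.

Lemma sub_measure_ae (P : T -> Prop) :
  {ae sub_measure GM, forall t : TG, P t} -> {ae mu, forall t, P t}.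
Proof. by move=> [N [mN N0 NP]]; exists N; split => //; exact: gm. Qed.

Lemma integral_sub_measure (f : TG -> \bar R) (A : set TG) :
  (sub_measure GM).-integrable setT f -> measurable A ->
  mu.-integrable setT (f : T -> \bar R) ->
  (\int[sub_measure GM]_(t in A) f t = \int[mu]_(t in A) (f : T -> \bar R) t)%E.
Proof.
move=> If mA If'.
(* The restricted measure is the image of [mu] under the identity into the coarser space, so this is
   a change of variables. *)
have mid : measurable_fun setT (id : T -> TG).
  by move=> _ Y mY; rewrite setTI; exact: gm.
apply: (integral_pushforward mid) => //; first exact: measurable_int If.
by apply: integrableS If' => //; exact: gm.
Qed.

End SubMeasure.

Section ConditionalExpectation.
Context d (T : measurableType d) (R : realType).
Variable mu : {finite_measure set T -> \bar R}.
Implicit Types (f g : T -> R) (G : set (set T)).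

Lemma Rintegral_sub_measure G (GM : G `<=` measurable)
    (g : g_sigma_algebraType G -> R) (A : set (g_sigma_algebraType G)) :
  bounded_measurable G g -> measurable A ->
  @Rintegral _ (g_sigma_algebraType G) R (sub_measure mu GM) A g =
  \int[mu]_(t in A) (g : T -> R) t.
Proof.
move=> bg GA; congr fine; apply: integral_sub_measure => //.
  by case: bg => mg [c bg]; apply: (bounded_integrable _ _ mg bg).
exact: (bounded_measurable_integrable _ GM bg).
Qed.

(** Test sets from [<<s G>>] suffice because both functions are measurable for it: the comparison
    takes place under the restricted measure, and its null sets are null for [mu]. *)
Lemma bounded_measurable_ae_le G f g : G `<=` measurable ->
  bounded_measurable G f -> bounded_measurable G g ->
  (forall A, <<s G >> A ->
    \int[mu]_(t in A) f t <= \int[mu]_(t in A) g t)%R ->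
  {ae mu, forall t, f t <= g t}.
Proof.
move=> GM bf bg fg; apply: (@sub_measure_ae _ _ _ mu _ GM).
apply: ae_le_of_integral.
- by case: bf => mf [c bf]; apply: (bounded_integrable _ _ mf bf).
- by case: bg => mg [c bg]; apply: (bounded_integrable _ _ mg bg).
- by move=> A mA; rewrite !Rintegral_sub_measure//; exact: fg.
Qed.

Lemma bounded_measurable_ae_eq G f g : G `<=` measurable ->
  bounded_measurable G f -> bounded_measurable G g ->
  (forall A, <<s G >> A ->
    \int[mu]_(t in A) f t = \int[mu]_(t in A) g t)%R ->
  {ae mu, forall t, f t = g t}.
Proof.
move=> GM bf bg fg.
have h1 : {ae mu, forall t, f t <= g t}.
  by apply: (bounded_measurable_ae_le GM) => // A /fg ->.
have h2 : {ae mu, forall t, g t <= f t}.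
  by apply: (bounded_measurable_ae_le GM) => // A /fg ->.
by apply: filterS2 h1 h2 => t fgt gft; apply/eqP; rewrite eq_le fgt.
Qed.

Definition is_cond_exp G f g := bounded_measurable G g /\
  forall A, <<s G >> A -> \int[mu]_(t in A) g t = \int[mu]_(t in A) f t.

(** The conditional expectation is the density, for the restricted measure, of the set function that
    integrates [f]; the bound on [f] provides the domination. *)
Lemma cond_exp_exists G f (c : R) : G `<=` measurable ->
  measurable_fun setT f -> (forall t, `|f t| <= c) ->
  exists2 g, is_cond_exp G f g & forall t, `|g t| <= c.
Proof.
move=> GM mf bf; have c0 : 0 <= c by exact: le_trans (bf point).
have If A : measurable A -> mu.-integrable A (EFin \o f).
  by move=> mA; exact: (bounded_integrable mu mA mf bf).
have [A /(g_sigma_measurable GM) mA|A B /(g_sigma_measurable GM) mA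
    /(g_sigma_measurable GM) mB AB||g [mg gc gint]] :=
    @dominated_density _ (g_sigma_algebraType G) R (sub_measure mu GM)
    (fun A => \int[mu]_(t in (A : set T)) f t) c.
- apply: le_trans (le_normr_Rintegral mA (If _ mA)) _.
  rewrite -(Rintegral_cst mu mA); apply: le_Rintegral => //.
    exact: integrable_norm (If _ mA).
  exact: finite_measure_integrable_cst.
- by rewrite Rintegral_setU//; [apply: If; exact: measurableU|by apply/disj_set2P].
- exact: c0.
have bg : bounded_measurable G g by split => //; exists c.
exists g => //; split => // A GA.
by rewrite -(Rintegral_sub_measure GM bg GA) -gint.
Qed.

End ConditionalExpectation.

(** * Almost everywhere convergence of conditional expectations *)

Section MaximalInequality.
Context d (T : measurableType d) (R : realType).
Variable mu : {finite_measure set T -> \bar R}.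
Variable G : nat -> set (set T).
Hypothesis GM : forall n, G n `<=` measurable.
Hypothesis G_nd : forall m n, (m <= n)%N -> <<s G m >> `<=` <<s G n >>.

(** Doob's maximal inequality. [seqDU F] splits the union according to the first [n] with
    [l < v n t]. The piece of index [n] lies in [<<s G n>>], so [u] and [v n] have the same integral
    over it, and there [v n] exceeds [l]. *)
Lemma maximal_inequality (u : T -> R) (v : nat -> T -> R) (c l : R) :
  measurable_fun setT u -> (forall t, 0 <= u t <= c) ->
  (forall n, is_cond_exp mu (G n) u (v n)) -> 0 < l ->
  (l%:E * mu (\bigcup_n [set t | (l < v n t)%R]) <= \int[mu]_t (u t)%:E)%E.
Proof.
move=> mun u0 vE l0.
have bu t : `|u t| <= c by have /andP[h1 h2] := u0 t; rewrite ger0_norm.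
pose F n := [set t | l < v n t].
have GF n : <<s G n >> (F n).
  have -> : F n = v n @^-1` `]l, +oo[%classic.
    by apply/seteqP; split=> t /=; rewrite in_itv/= andbT.
  by apply: (bounded_measurable_preimage (vE n).1).
have GD n : <<s G n >> (seqDU F n).
  apply: (@measurableD _ (g_sigma_algebraType (G n))); first exact: GF.
  apply: (@bigsetU_measurable _ (g_sigma_algebraType (G n))) => i _.
  by apply: (G_nd (ltnW (ltn_ord i))); exact: GF.
have mD n : measurable (seqDU F n) := g_sigma_measurable (@GM n) (GD n).
have mU : measurable (\bigcup_n seqDU F n) by exact: bigcup_measurable.
rewrite -[X in mu X]/(\bigcup_n F n) seqDU_bigcup_eq.
apply: (@le_trans _ _ (\int[mu]_(t in \bigcup_n seqDU F n) (u t)%:E)%E); last first.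
  apply: ge0_subset_integral => //; first exact/measurable_EFinP.
  by move=> t _; rewrite lee_fin; case/andP: (u0 t).
rewrite ge0_integral_bigcup//; last 2 first.
- by apply/measurable_EFinP; exact: measurable_funTS.
- by move=> t _; rewrite lee_fin; case/andP: (u0 t).
rewrite measure_bigcup//.
rewrite -nneseriesZl//.
under eq_eseriesl do rewrite in_setT.
apply: lee_nneseries => [n _|n _]; first by rewrite mule_ge0// lee_fin ltW.
have Iv := bounded_measurable_integrable mu (@GM n) (vE n).1 (mD n).
have Iu : mu.-integrable (seqDU F n) (EFin \o u).
  exact: (bounded_integrable _ (mD n) mun bu).
rewrite -(fineK (integrable_fin_num (mD n) Iu)).
have /esym := (vE n).2 _ (GD n); rewrite /Rintegral => ->.
rewrite (fineK (integrable_fin_num (mD n) Iv)).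
rewrite -integral_cst//; apply: le_integral => //.
  exact: finite_measure_integrable_cst.
by move=> t; rewrite inE => -[Ft _]; rewrite /= lee_fin ltW.
Qed.

End MaximalInequality.

Section L1Norm.
Context d (T : measurableType d) (R : realType).
Variable mu : {finite_measure set T -> \bar R}.
Implicit Types f g : T -> R.

Local Notation L1 f := (\int[mu]_t `|f t|).
Local Notation bm := (bounded_measurable (@measurable d T)).

Lemma L1_triangle f g : bm f -> bm g -> 
  \int[mu]_t `|f t + g t| <= L1 f + L1 g.
Proof.
move=> bf bg.
have If := bounded_measurable_integrable mu (@subset_refl _ _) (bounded_measurable_norm bf) measurableT.
have Ig := bounded_measurable_integrable mu (@subset_refl _ _) (bounded_measurable_norm bg) measurableT.
have Ifg := bounded_measurable_integrable mu (@subset_refl _ _)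
  (bounded_measurable_norm (bounded_measurableD bf bg)) measurableT.
rewrite -RintegralD//; apply: le_Rintegral => //.
  by have := integrableD measurableT If Ig; apply: eq_integrable.
by move=> t _; exact: ler_normD.
Qed.

Lemma L1Z (a : R) f : bm f -> \int[mu]_t `|a * f t| = `|a| * L1 f.
Proof.
move=> bf.
have If := bounded_measurable_integrable mu (@subset_refl _ _) (bounded_measurable_norm bf) measurableT.
by rewrite -RintegralZl//; apply: eq_Rintegral => t _; rewrite normrM.
Qed.

End L1Norm.

Section Density.
Context d (T : measurableType d) (R : realType).
Variable mu : {finite_measure set T -> \bar R}.
Variable G : nat -> set (set T).
Hypothesis GM : forall n, G n `<=` measurable.
Hypothesis G_nd : forall m n, (m <= n)%N -> <<s G m >> `<=` <<s G n >>.
Implicit Types f g : T -> R.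

Local Notation bm := (bounded_measurable (@measurable d T)).
Local Notation L1 f := (\int[mu]_t `|f t|).

Let approximable f := forall e : R, 0 < e -> exists n g,
  bounded_measurable (G n) g /\ \int[mu]_t `|f t - g t| < e.

Let GmT n f : bounded_measurable (G n) f -> bm f.
Proof.
apply: bounded_measurable_sub; apply: subset_trans (g_sigma_measurable (@GM n)) _.
exact: sub_gen_smallest.
Qed.

Let approximableD f g : bm f -> bm g -> approximable f -> approximable g ->
  approximable (fun t => f t + g t).
Proof.
move=> bf bg af ag e e0; have e2 : 0 < e / 2 by rewrite divr_gt0.
have [m [f' [bf' ff']]] := af _ e2.
have [n [g' [bg' gg']]] := ag _ e2.
have bf'T := GmT bf'; have bg'T := GmT bg'.
exists (maxn m n), (fun t => f' t + g' t); split.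
  apply: bounded_measurableD.
    by apply: bounded_measurable_sub bf'; apply: G_nd; exact: leq_maxl.
  by apply: bounded_measurable_sub bg'; apply: G_nd; exact: leq_maxr.
rewrite (splitr e); apply: le_lt_trans (ltrD ff' gg').
under eq_Rintegral do rewrite opprD addrACA.
by apply: L1_triangle; exact: bounded_measurableB.
Qed.

Let approximableZ a f : bm f -> approximable f -> approximable (fun t => a * f t).
Proof.
move=> bf af e e0.
have e2 : 0 < e / (`|a| + 1) by rewrite divr_gt0// ltr_wpDl.
have [m [f' [bf' ff']]] := af _ e2.
exists m, (fun t => a * f' t); split; first exact: bounded_measurableZ.
under eq_Rintegral do rewrite -mulrBr.
rewrite (L1Z mu a (bounded_measurableB bf (GmT bf'))).
have a1 : 0 < `|a| + 1 by rewrite ltr_wpDl.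
move: ff'; rewrite ltr_pdivlMr// => ff'; apply: le_lt_trans ff'.
rewrite mulrC ler_wpM2l// ?lerDl//.
by apply: Rintegral_ge0.
Qed.

Let approximable_lim f : bm f ->
  (forall e : R, 0 < e -> exists g, [/\ bm g, approximable g & \int[mu]_t `|f t - g t| < e]) ->
  approximable f.
Proof.
move=> bf H e e0; have e2 : 0 < e / 2 by rewrite divr_gt0.
have [g [bg ag fg]] := H _ e2.
have [m [g' [bg' gg']]] := ag _ e2.
have bg'T := GmT bg'.
exists m, g'; split => //.
rewrite (splitr e); apply: le_lt_trans (ltrD fg gg').
rewrite (_ : \int[mu]_t `|f t - g' t| = \int[mu]_t `|(f t - g t) + (g t - g' t)|); last first.
  by apply: eq_Rintegral => t _; rewrite addrA subrK.
by apply: L1_triangle; exact: bounded_measurableB.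
Qed.

Let bm_indic (A : set T) : measurable A -> bm (\1_A : T -> R).
Proof. by move=> mA; apply: bounded_measurable_indic; exact: sub_gen_smallest. Qed.

Let L1_indic (A : set T) : measurable A -> L1 (\1_A : T -> R) = fine (mu A).
Proof.
move=> mA; rewrite /Rintegral.
under eq_integral do rewrite ger0_norm ?indicE//.
by rewrite integral_indic// setIT.
Qed.

(** A pi-lambda argument: the union of the increasing sigma-algebras is closed under intersection,
    and [H] is a Dynkin class because approximability passes to linear combinations and to L1
    limits. *)
Let approximable_indic (A : set T) :
  <<s \bigcup_n <<s G n >> >> A -> approximable (\1_A : T -> R).
Proof.
pose H : set (set T) := [set A | measurable A /\ approximable (\1_A : T -> R)].
suff : <<s \bigcup_n <<s G n >> >> `<=` H by move=> /[apply] -[].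
rewrite -setI_closed_g_dynkin_g_sigma_algebra; last first.
  move=> B C [m _ GB] [n _ GC]; exists (maxn m n) => //.
  apply: (@measurableI _ (g_sigma_algebraType (G (maxn m n)))).
    by apply: G_nd GB; exact: leq_maxl.
  by apply: G_nd GC; exact: leq_maxr.
have HT : H setT.
  split => // e e0; exists 0%N, (\1_setT); split.
    apply: bounded_measurable_indic.
    exact: (@measurableT _ (g_sigma_algebraType (G 0%N))).
  under eq_Rintegral do rewrite subrr normr0.
  by rewrite Rintegral_cst// mul0r.
have indicC' (B : set T) : \1_(~` B) = (fun t => \1_setT t + (-1) * \1_B t) :> (T -> R).
  apply/funext => t; rewrite !indicE in_setC in_setT.
  by case: (t \in B); rewrite /= ?mulr1 ?subrr// mulr0 addr0.
apply: smallest_sub; last first.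
  move=> {}A [n _ GA]; split; first exact: (g_sigma_measurable (@GM n) GA).
  move=> e e0; exists n, (\1_A); split; first exact: bounded_measurable_indic.
  under eq_Rintegral do rewrite subrr normr0.
  by rewrite Rintegral_cst// mul0r.
split => //.
  move=> {}A [mA aA]; split; first exact: measurableC.
  rewrite indicC'; apply: approximableD => //; [exact: bm_indic| | |].
  - by apply: bounded_measurableZ; exact: bm_indic.
  - exact: HT.2.
  - by apply: approximableZ => //; exact: bm_indic.
move=> F tF HF; have mF n : measurable (F n) := (HF n).1.
have mU : measurable (\bigcup_n F n) by exact: bigcup_measurable.
split => //.
have asum n : approximable (\1_(\big[setU/set0]_(i < n) F i) : T -> R).
  elim: n => [|n IH].
    move=> e e0; exists 0%N, (cst 0); split; first exact: bounded_measurable_cst.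
    rewrite big_ord0 indic0; under eq_Rintegral do rewrite subrr normr0.
    by rewrite Rintegral_cst// mul0r.
  rewrite big_ord_recr/=.
  rewrite (_ : \1__ = (fun t => \1_(\big[setU/set0]_(i < n) F i) t + \1_(F n) t) :> (T -> R)).
    apply: approximableD => //; [|exact: bm_indic|exact: (HF n).2].
    by apply: bm_indic; exact: bigsetU_measurable.
  apply/funext => t; rewrite !indicE in_setU.
  have [tU|] := boolP (t \in \big[setU/set0]_(i < n) F i); last by rewrite add0r.
  suff /negPf -> : t \notin F n by rewrite orbF addr0.
  apply/negP; rewrite inE => tFn; move: tU; rewrite inE -bigcup_mkord => -[i /= iN tFi].
  by have := tF i n I I (ex_intro _ t (conj tFi tFn)) => E; rewrite E ltnn in iN.
have mB n : measurable (\big[setU/set0]_(i < n) F i) by exact: bigsetU_measurable.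
apply: approximable_lim; first exact: bm_indic.
move=> e e0.
(* The L1 distance between the indicators of the union and of a partial union is the measure of the
   remainder, so continuity of [mu] from below gives L1 convergence. *)
have : mu (\big[setU/set0]_(i < n.+1) F i) @[n --> \oo] --> mu (\bigcup_n F n).
  rewrite -bigcup_bigsetU_bigcup; apply: nondecreasing_cvg_mu => //.
    exact: bigcup_measurable.
  by move=> m n mn; apply/subsetPset; exact: subset_bigsetU.
rewrite -(@fineK _ (mu (\bigcup_n F n))) ?fin_num_measure// => /fine_cvg.
move=> /cvgrPdist_lt /(_ _ e0)[n _ /(_ n (leqnn n))] /= cvn.
exists (\1_(\big[setU/set0]_(i < n.+1) F i)); split => //; first exact: bm_indic.
have sub : \big[setU/set0]_(i < n.+1) F i `<=` \bigcup_n F n.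
  by rewrite -bigcup_mkord => t [i _ Fi]; exists i.
rewrite (_ : \int[mu]_t _ =
    L1 (\1_(\bigcup_n F n `\` \big[setU/set0]_(i < n.+1) F i) : T -> R)); last first.
  apply: eq_Rintegral => t _; rewrite !indicE in_setD.
  case: (boolP (t \in \big[setU/set0]_(i < n.+1) F i)) => tB.
    have -> : t \in \bigcup_n F n by move: tB; rewrite !inE; exact: sub.
    by rewrite /= subrr.
  by rewrite subr0 /= andbT.
rewrite L1_indic; last exact: measurableD.
rewrite measureD// ?ltey_eq ?fin_num_measure//.
rewrite setIidr// fineB ?fin_num_measure//.
by apply: le_lt_trans cvn; exact: ler_norm.
Qed.

Let approximable_sum n (a : nat -> R) (A : nat -> set T) :
  (forall i, <<s \bigcup_n <<s G n >> >> (A i)) ->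
  approximable (fun t => \sum_(i < n) a i * \1_(A i) t).
Proof.
move=> GA; elim: n => [|n IH].
  move=> e e0; exists 0%N, (cst 0); split; first exact: bounded_measurable_cst.
  under eq_Rintegral do rewrite big_ord0 subrr normr0.
  by rewrite Rintegral_cst// mul0r.
have mA i : measurable (A i).
  apply: g_sigma_measurable (GA i).
  by move=> B [m _ GB]; exact: (g_sigma_measurable (@GM m) GB).
have ba i : bm (fun t => a i * \1_(A i) t).
  by apply: bounded_measurableZ; exact: bm_indic.
rewrite (_ : (fun _ => _) =
    (fun t => (\sum_(i < n) a i * \1_(A i) t) + a n * \1_(A n) t)); last first.
  by apply/funext => t; rewrite big_ord_recr.
apply: approximableD => //; last first.
  by apply: approximableZ; [exact: bm_indic|exact: approximable_indic].
elim: n {IH} => [|n IH].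
  by under eq_fun do rewrite big_ord0; exact: bounded_measurable_cst.
by under eq_fun do rewrite big_ord_recr; exact: bounded_measurableD.
Qed.

Import HBSimple.

(** Simple functions are dense in L1 and are finite combinations of indicators. Convergence of
    conditional expectations is thereby reduced to functions measurable at a finite level, which are
    their own conditional expectations from that level on. *)
Lemma union_dense f : bounded_measurable (\bigcup_n <<s G n >>) f ->
  forall e : R, 0 < e -> exists n g,
    bounded_measurable (G n) g /\ \int[mu]_t `|f t - g t| < e.
Proof.
move=> bf; pose G' := \bigcup_n <<s G n >>.
have GM' : G' `<=` measurable.
  by move=> A [n _ GA]; exact: (g_sigma_measurable (@GM n) GA).
have GT (h : T -> R) : bounded_measurable G' h -> bm h.
  apply: bounded_measurable_sub; apply: smallest_sub => //.
  by apply: subset_trans GM' _; exact: sub_gen_smallest.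
change (approximable f); apply: approximable_lim; first exact: GT.
move=> e e0.
have If : (sub_measure mu GM').-integrable setT (EFin \o f).
  by case: bf => mf [c bf]; apply: (bounded_integrable _ _ mf bf).
have [g [Ig _ /fine_cvg]] := approximation_sfun_integrable measurableT If.
move=> /cvgrPdist_lt /(_ _ e0)[n _ /(_ n (leqnn n))] /= fgn.
have bg : bounded_measurable G' (g n).
  split; first exact: measurable_funPT.
  have [c [_ /(_ (c + 1))]] := simple_bounded (g n).
  by rewrite ltrDl ltr01 => /(_ erefl) gc; exists (c + 1) => t; exact: gc.
exists (g n); split; first exact: GT.
  have gE := funext (fimfunEord (g n)).
  rewrite [X in approximable X]gE.
  pose s : seq R := finmap.enum_fset (fset_set (range (g n))).
  have H i : <<s G' >> (g n @^-1` [set s`_i]).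
    by apply: (bounded_measurable_preimage bg).
  exact: (@approximable_sum (size s) (fun i => s`_i) _ H).
apply: le_lt_trans fgn; rewrite sub0r normrN.
apply: le_trans (ler_norm _).
have bfg := bounded_measurable_norm (bounded_measurableB bf bg).
by rewrite -(Rintegral_sub_measure mu GM' bfg measurableT).
Qed.

End Density.

Section MartingaleConvergence.
Context d (T : measurableType d) (R : realType).
Variable mu : {finite_measure set T -> \bar R}.
Variable G : nat -> set (set T).
Hypothesis GM : forall n, G n `<=` measurable.
Hypothesis G_nd : forall m n, (m <= n)%N -> <<s G m >> `<=` <<s G n >>.
Arguments GM : clear implicits.
Arguments G_nd : clear implicits.
Variables (f : T -> R) (P : nat -> T -> R).
Hypothesis bf : bounded_measurable (\bigcup_n <<s G n >>) f.
Hypothesis PE : forall n, is_cond_exp mu (G n) f (P n).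

Let GnT n (g : T -> R) : bounded_measurable (G n) g -> bounded_measurable measurable g.
Proof.
apply: bounded_measurable_sub; apply: subset_trans (g_sigma_measurable (GM n)) _.
exact: sub_gen_smallest.
Qed.

Let bfT : bounded_measurable measurable f.
Proof.
apply: bounded_measurable_sub bf; apply: smallest_sub => //.
move=> A [n _ GA]; apply: sub_gen_smallest; exact: (g_sigma_measurable (GM n) GA).
Qed.

Let integrable_bm g (A : set T) : bounded_measurable measurable g ->
  measurable A -> mu.-integrable A (EFin \o g).
Proof. exact: bounded_measurable_integrable. Qed.

Let RintB g h (A : set T) : bounded_measurable measurable g ->
  bounded_measurable measurable h -> measurable A ->
  \int[mu]_(t in A) (g t - h t) = \int[mu]_(t in A) g t - \int[mu]_(t in A) h t.
Proof. by move=> bg bh mA; apply: RintegralB => //; exact: integrable_bm. Qed.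

(** With [g] measurable at level [m] and [u] the distance of [f] and [g], the error of [P n] splits
    into [P n - g], bounded by the conditional expectation of [u], and [g - f]. The maximal
    inequality controls the former for all [n] at once, Chebyshev's inequality the latter. *)
Lemma cond_exp_almost_uniform (e : R) : 0 < e -> exists W : set T,
  [/\ measurable W, (mu W <= e%:E)%E &
    exists m, forall t, ~ W t -> forall n, (m <= n)%N -> `|P n t - f t| <= e].
Proof.
move=> e0; pose a := e / 2.
have a0 : 0 < a by rewrite divr_gt0.
(* An L1 error below [a * a] leaves measure at most [a] for each of the sets where a threshold [a]
   is exceeded. *)
have [m [g [bg fg]]] := union_dense mu GM G_nd bf (mulr_gt0 a0 a0).
have bgT := GnT bg.
pose u t := `|f t - g t|.
have bu : bounded_measurable measurable u.
  exact/bounded_measurable_norm/bounded_measurableB.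
have mun : measurable_fun setT u by apply: (bounded_measurableT _ bu).
have [c uc] := bu.2.
have uc' t : `|u t| <= c by [].
have /choice[v vE] : forall n, exists w, is_cond_exp mu (G (m + n)%N) u w.
  by move=> n; have [w] := cond_exp_exists mu (GM (m + n)%N) mun uc'; exists w.
pose W1 := \bigcup_n [set t | a < v n t].
pose W2 := [set t | a <= u t].
have mW1 : measurable W1.
  apply: bigcup_measurable => n _.
  have -> : [set t | a < v n t] = v n @^-1` `]a, +oo[%classic.
    by apply/seteqP; split=> t /=; rewrite in_itv/= andbT.
  apply: (g_sigma_measurable (GM (m + n)%N)).
  by apply: (bounded_measurable_preimage (vE n).1).
have mW2 : measurable W2.
  have -> : W2 = u @^-1` `[a, +oo[%classic.
    by apply/seteqP; split=> t /=; rewrite in_itv/= andbT.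
  by rewrite -[X in measurable X]setTI; exact: mun.
have Iu : (\int[mu]_t (u t)%:E < (a * a)%:E)%E.
  rewrite -(fineK (integrable_fin_num measurableT (integrable_bm bu measurableT))).
  by rewrite lte_fin.
have a0' : (0 < a%:E)%E by rewrite lte_fin.
have W1a : (mu W1 <= a%:E)%E.
  rewrite -(@lee_pmul2l _ a%:E)// -EFinM.
  apply: le_trans (ltW Iu).
  apply: (@maximal_inequality _ _ _ mu (fun n => G (m + n)%N) _ _ u v c a) => //.
  - by move=> i j ij; apply: G_nd; rewrite leq_add2l.
  - by move=> t; rewrite normr_ge0/=; exact: le_trans (ler_norm _) (uc t).
have W2a : (mu W2 <= a%:E)%E.
  rewrite -(@lee_pmul2l _ a%:E)// -EFinM.
  apply: le_trans (ltW Iu).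
  have := @le_integral_abse _ _ _ mu setT measurableT (EFin \o u) a _ a0.
  rewrite setTI.
  have -> : (\int[mu]_t `|(EFin \o u) t| = \int[mu]_t (u t)%:E)%E.
    by apply: eq_integral => t _; rewrite /= normr_id.
  have -> : [set x | (a%:E <= `|(EFin \o u) x|)%E] = W2.
    by apply/seteqP; split=> t /=; rewrite lee_fin normr_id.
  by apply; apply/measurable_EFinP.
(* [g] is measurable at level [m + n], so over sets of that level [P (m + n) - g] integrates like
   [f - g], hence to at most the integral of [u]; the same holds with the opposite sign. *)
have Pg : {ae mu, forall t, forall n, `|P (m + n)%N t - g t| <= v n t}.
  apply: ae_foralln => n; have GMn := GM (m + n)%N.
  have bg' : bounded_measurable (G (m + n)%N) g.
    by apply: bounded_measurable_sub bg; apply: G_nd; exact: leq_addr.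
  have [bP PI] := PE (m + n)%N.
  have bfg := bounded_measurableB bfT bgT.
  have bgf := bounded_measurableB bgT bfT.
  have h1 : {ae mu, forall t, P (m + n)%N t - g t <= v n t}.
    apply: (bounded_measurable_ae_le GMn) => //.
    - exact: bounded_measurableB.
    - exact: (vE n).1.
    - move=> A GA; have mA := g_sigma_measurable GMn GA.
      rewrite (vE n).2// RintB//; last exact: GnT bP.
      rewrite PI// -RintB//; apply: le_Rintegral => //.
      + exact: integrable_bm.
      + exact: integrable_bm.
      + by move=> t _; exact: ler_norm.
  have h2 : {ae mu, forall t, g t - P (m + n)%N t <= v n t}.
    apply: (bounded_measurable_ae_le GMn) => //.
    - exact: bounded_measurableB.
    - exact: (vE n).1.
    - move=> A GA; have mA := g_sigma_measurable GMn GA.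
      rewrite (vE n).2// RintB//; last exact: GnT bP.
      rewrite PI// -RintB//; apply: le_Rintegral => //.
      + exact: integrable_bm.
      + exact: integrable_bm.
      + by move=> t _; rewrite /u distrC; exact: ler_norm.
  apply: filterS2 h1 h2 => t h1 h2.
  by rewrite ler_norml h1 andbT lerNl opprB.
have [N [mN N0 NP]] := Pg.
exists (W1 `|` W2 `|` N); split.
- by apply: measurableU => //; exact: measurableU.
- have h12 : (mu (W1 `|` W2) <= a%:E + a%:E)%E.
    by apply: le_trans (measureU2 _ _ _) _ => //; exact: leeD.
  apply: le_trans (measureU2 _ _ _) _ => //; first exact: measurableU.
  apply: (@le_trans _ _ ((a%:E + a%:E) + 0)%E); last by rewrite adde0 -EFinD -splitr.
  by apply: leeD => //; rewrite le_eqVlt; apply/orP; left; apply/eqP; exact: N0.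
- exists m => t /not_orP[/not_orP[nW1 nW2] nN] n mn.
  have {}NP : forall n, `|P (m + n)%N t - g t| <= v n t.
    by apply: contrapT => H; apply: nN; exact: NP.
  have v1 : v (n - m)%N t <= a.
    by rewrite leNgt; apply/negP => va; apply: nW1; exists (n - m)%N.
  have u1 : u t <= a.
    by rewrite leNgt; apply/negP => ua; apply: nW2; exact: ltW.
  rewrite (splitr e) (_ : P n t - f t = (P n t - g t) + (g t - f t)); last first.
    by rewrite addrA subrK.
  apply: le_trans (ler_normD _ _) _; apply: lerD; last by rewrite distrC.
  by have := NP (n - m)%N; rewrite subnKC// => /le_trans; apply.
Qed.

(** [V j] is null because it lies in sets [W k] of arbitrarily small measure. A point outside every
    [V j] avoids [W k] for arbitrarily large [k], and each such [k] bounds the error by [k.+1%:R^-1]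
    from some index on. *)
Lemma cond_exp_cvg : {ae mu, forall t, P n t @[n --> \oo] --> f t}.
Proof.
have /choice[W WE] : forall k : nat, exists W : set T,
  [/\ measurable W, (mu W <= (k.+1%:R^-1)%:E)%E &
    exists m, forall t, ~ W t -> forall n, (m <= n)%N -> `|P n t - f t| <= k.+1%:R^-1].
  by move=> k; exact: cond_exp_almost_uniform.
pose V j := \bigcap_(k in [set k | (j <= k)%N]) W k.
have mW k : measurable (W k) by case: (WE k).
have mV j : measurable (V j) by exact: bigcap_measurableType.
have V0 j : mu (V j) = 0%E.
  apply/eqP; rewrite eq_le measure_ge0 andbT.
  apply/lee_addgt0Pr => e e0; rewrite add0e.
  have [k /= ke] : exists k : nat, k.+1%:R^-1 < e.
    have [N _ /(_ N (leqnn N)) H] := near_infty_natSinv_lt (PosNum e0).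
    by exists N.
  have kj : (maxn j k).+1%:R^-1 <= e.
    apply: le_trans (ltW ke); rewrite lef_pV2 ?posrE//.
    by rewrite ler_nat ltnS leq_maxr.
  apply: (@le_trans _ _ (mu (W (maxn j k)))).
    by apply: le_measure; rewrite ?inE// => t /(_ (maxn j k)); apply; exact: leq_maxl.
  have [_ h _] := WE (maxn j k); apply: le_trans h _.
  by rewrite lee_fin.
apply: (@negligibleS _ _ _ mu (\bigcup_j V j)); last first.
  apply: negligible_bigcup => j; apply/negligibleP; first exact: mV.
  exact: V0.
move=> t /= ncv; apply: contrapT => nV; apply: ncv.
apply/cvgrPdist_le => e e0.
have [j /= ke] : exists k : nat, k.+1%:R^-1 < e.
  have [N _ /(_ N (leqnn N)) H] := near_infty_natSinv_lt (PosNum e0).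
  by exists N.
have : ~ V j t by move=> Vj; apply: nV; exists j.
move=> /existsNP[k /not_implyP[/= jk nWk]].
have [_ _ [m H]] := WE k.
exists m => // n /= mn; rewrite distrC; apply: le_trans (H _ nWk _ mn) _.
apply: le_trans (ltW ke); rewrite lef_pV2 ?posrE//.
by rewrite ler_nat ltnS.
Qed.

End MartingaleConvergence.

(** * Linear liftings *)

Section GeneralizedLimit.
Variable R : realType.

(** The limit along an ultrafilter finer than the filter of neighbourhoods of infinity; compactness
    of the segment from [-c] to [c] makes bounded sequences converge along it. *)
Lemma generalized_limit : exists L : (nat -> R) -> R,
  [/\ forall (a : R) u v, (exists c : R, forall n, `|u n| <= c) ->
        (exists c : R, forall n, `|v n| <= c) ->
        L (fun n => a * u n + v n) = a * L u + L v,
      forall (c : R) u, (forall n, `|u n| <= c) -> `|L u| <= c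
    & forall u l, u @ \oo --> l -> L u = l].
Proof.
have [U [UU oU]] := ultraFilterLemma (eventually_filter).
have PU : ProperFilter U by exact: ultra_proper.
have cv (u : nat -> R) (c : R) : (forall n, `|u n| <= c) -> u @ U --> lim (u @ U).
  move=> uc; apply/cvg_ex.
  have FA : (u @ U) `[- c, c]%classic.
    by apply: (@filterE _ U) => n /=; rewrite in_itv/= -ler_norml; exact: uc.
  have [p [_ cp]] := @segment_compact R (- c) c (u @ U) _ FA.
  exists p => V Vp; have [//|UV] := in_ultra_setVsetC (u @^-1` V) UU.
  by have [x [/=]] := cp _ _ (UV : (u @ U) (~` V)) Vp.
exists (fun u => lim (u @ U)); split.
- move=> a u v [c uc] [c' vc]; apply/cvg_lim => //.
  apply: cvgD; last exact: cv vc.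
  by apply: cvgM; [exact: cvg_cst|exact: cv uc].
- move=> c u uc; have cu : cvg (u @ U) by apply/cvg_ex; eexists; exact: cv uc.
  have uc' n : - c <= u n <= c by rewrite -ler_norml; exact: uc.
  by rewrite ler_norml; apply/andP; split; [apply: limr_ge|apply: limr_le] => //;
    apply: filterE => n; case/andP: (uc' n).
- move=> u l ul; apply/cvg_lim => //.
  by apply: cvg_trans ul => A /= /oU.
Qed.

End GeneralizedLimit.

(** * Adjoining one set to a sigma-algebra *)

Section TraceExtension.
Context d (T : measurableType d) (R : realType).
Variables (G : set (set T)) (E D : set T).
Hypothesis ED : exists2 B, <<s G >> B & E `&` D = B `&` D.

Let trace (A : set T) : <<s E |` G >> A -> exists2 B, <<s G >> B & A `&` D = B `&` D.
Proof.
suff : <<s E |` G >> `<=` [set A | exists2 B, <<s G >> B & A `&` D = B `&` D] by exact.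
apply: smallest_sub; last first.
  move=> B [->//|GB]; exists B => //; exact: sub_gen_smallest.
split.
- by exists set0 => //; exact: (@measurable0 _ (g_sigma_algebraType G)).
- move=> B [C GC BC]; exists (~` C).
    exact: (@measurableC _ (g_sigma_algebraType G)).
  rewrite setTD; apply/seteqP; split=> t [nB Dt]; split=> // Ct; apply: nB.
    by have : (C `&` D) t by []; rewrite -BC => -[].
  by have : (B `&` D) t by []; rewrite BC => -[].
- move=> F HF; have /choice[C HC] : forall n, exists C, <<s G >> C /\ F n `&` D = C `&` D.
    by move=> n; have [C] := HF n; exists C.
  exists (\bigcup_n C n).
    apply: (@bigcupT_measurable _ (g_sigma_algebraType G)) => n.
    by case: (HC n).
  by rewrite !setI_bigcupl; apply: eq_bigcupr => n _; case: (HC n).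
Qed.

(** [f] is rebuilt from its rational level sets: on [D] the set where [f] exceeds [q n] coincides
    with some [A n] of [<<s G>>], and [f t] is the supremum of the [q n] with [t] in [A n]. Clipping
    between [-c] and [c] keeps the supremum bounded off [D] as well. *)
Lemma bounded_measurable_trace (f : T -> R) : bounded_measurable (E |` G) f ->
  exists2 p, bounded_measurable G p & forall t, D t -> p t = f t.
Proof.
move=> bf; have [c fc] := bf.2.
have c0 : 0 <= c by exact: le_trans (fc point).
(* An enumeration of the rationals; the default [0] is itself rational and adds no new threshold. *)
pose q n : R := if @unpickle rat n is Some r then ratr r else 0.
have /choice[A HA] : forall n, exists A, <<s G >> A /\
    (f @^-1` `]q n, +oo[) `&` D = A `&` D.
  move=> n; have [|A GA AE] := @trace (f @^-1` `]q n, +oo[).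
    exact: bounded_measurable_preimage.
  by exists A.
pose h n t := if t \in A n then Num.max (- c) (Num.min (q n) c) else - c.
have cc : - c <= c by rewrite (le_trans _ c0)// oppr_le0.
have hc n t : - c <= h n t <= c.
  rewrite /h; case: ifP => _; last by rewrite lexx.
  by rewrite le_max lexx/= ge_max cc ge_min lexx orbT.
have hub t : has_ubound (range (h ^~ t)).
  by exists c => _ [n _ <-]; case/andP: (hc n t).
pose p t := sups (h ^~ t) 0.
have pE t : p t = sup (range (h ^~ t)).
  rewrite /p /sups/=; congr sup; apply/seteqP; split=> x.
    by move=> [n _ <-]; exists n.
  by move=> [n _ <-]; exists n.
have hp n t : h n t <= p t by rewrite pE; apply: ub_le_sup => //; exists n.
have pc t : p t <= c.
  rewrite pE; apply: ge_sup; first by exists (h 0%N t), 0%N.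
  by move=> _ [n _ <-]; case/andP: (hc n t).
exists p.
  split.
    apply: (@measurable_fun_sups _ (g_sigma_algebraType G)) => [t _|n]; first exact: hub.
    have GA := (HA n).1.
    have [] := bounded_measurable_if GA
      (bounded_measurable_cst G (Num.max (- c) (Num.min (q n) c)))
      (bounded_measurable_cst G (- c)).
    by [].
  exists c => t; rewrite ler_norml pc andbT.
  by apply: le_trans (hp 0%N t); case/andP: (hc 0%N t).
move=> t Dt; apply/eqP; rewrite eq_le; apply/andP; split.
  rewrite pE; apply: ge_sup; first by exists (h 0%N t), 0%N.
  move=> _ [n _ <-].
  have /andP[f1 f2] : - c <= f t <= c by rewrite -ler_norml.
  rewrite /h; case: ifPn => // tA; rewrite ge_max f1/= ge_min.
  have : (A n `&` D) t by split => //; exact: set_mem.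
  by rewrite -(HA n).2 /= in_itv/= andbT => -[/ltW -> _].
apply/ler_addgt0Pr => e e0.
have [r] := @rat_in_itvoo R (f t - e) (f t) (ltac:(by rewrite ltrBlDr ltrDl)).
rewrite in_itv/= => /andP[r1 r2].
have qr : q (pickle r) = ratr r by rewrite /q pickleK.
have /andP[f1 f2] : - c <= f t <= c by rewrite -ler_norml.
have At : t \in A (pickle r).
  rewrite inE; suff : (A (pickle r) `&` D) t by case.
  by rewrite -(HA (pickle r)).2; split => //=; rewrite in_itv/= andbT qr.
rewrite -lerBlDr; apply: le_trans (ltW r1) (le_trans _ (hp (pickle r) t)).
by rewrite /h At qr le_max le_min lexx/= (ltW (lt_le_trans r2 f2)) orbT.
Qed.

End TraceExtension.

Section Lifting.
Context d (T : measurableType d) (R : realType).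
Variable mu : {finite_measure set T -> \bar R}.
Implicit Types (G : set (set T)) (f g : T -> R) (rho : (T -> R) -> T -> R).

(** The last clause turns an a.e. bound into a bound at every point. For [c = 0], applied to a
    difference, it makes [rho f] depend on the a.e. class of [f] only. *)
Definition is_lifting G rho :=
  [/\ forall f, bounded_measurable G f -> {ae mu, forall t, rho f t = f t},
      forall (a : R) f g, bounded_measurable G f -> bounded_measurable G g ->
        forall t, rho (fun t => a * f t + g t) t = a * rho f t + rho g t
    & forall (c : R) f, 0 <= c -> bounded_measurable G f ->
        {ae mu, forall t, `|f t| <= c} -> forall t, `|rho f t| <= c].

Lemma bounded_measurable_lin G (a : R) f g : bounded_measurable G f ->
  bounded_measurable G g -> bounded_measurable G (fun t => a * f t + g t).
Proof. by move=> bf bg; apply: bounded_measurableD => //; exact: bounded_measurableZ. Qed.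

Lemma lifting_ae_eq G rho f g : is_lifting G rho ->
  bounded_measurable G f -> bounded_measurable G g ->
  {ae mu, forall t, f t = g t} -> forall t, rho f t = rho g t.
Proof.
move=> [_ lin bnd] bf bg fg t; apply/eqP; rewrite -subr_eq0 -normr_le0.
rewrite addrC -mulN1r -lin//; apply: bnd => //; first exact: bounded_measurable_lin.
by apply: filterS fg => s ->; rewrite mulN1r addNr normr0.
Qed.

(** [f] is replaced by a [G]-measurable [u] that agrees with it a.e. on [D], and [rho] is applied to
    [u]. The choice of [u] must be linear and preserve a.e. bounds, so [p1], arbitrary far from [D],
    is kept only on the measurable hull of [D]. Off the hull [p2] is taken rather than zero, so that
    a [G]-measurable [f] gives [u = f] a.e. and [rho] is extended. *)
Lemma half_extension G E (D : set T) rho : G `<=` measurable -> measurable D ->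
  is_lifting G rho ->
  (forall f, bounded_measurable (E |` G) f -> exists2 p, bounded_measurable G p
    & forall t, D t -> p t = f t) ->
  (forall f, bounded_measurable (E |` G) f -> exists2 p, bounded_measurable G p
    & forall t, ~ D t -> p t = f t) ->
  exists rho' : (T -> R) -> T -> R,
  [/\ forall f, bounded_measurable (E |` G) f -> {ae mu, forall t, D t -> rho' f t = f t},
      forall (a : R) f g, bounded_measurable (E |` G) f -> bounded_measurable (E |` G) g ->
        forall t, rho' (fun t => a * f t + g t) t = a * rho' f t + rho' g t,
      forall (c : R) f, 0 <= c -> bounded_measurable (E |` G) f ->
        {ae mu, forall t, `|f t| <= c} -> forall t, `|rho' f t| <= c
    & forall f, bounded_measurable G f -> forall t, rho' f t = rho f t].
Proof.
move=> GM mD lrho tr1 tr2; have [rho1 rho2 rho3] := lrho.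
have mD1 : measurable_fun setT (\1_D : T -> R) by exact: measurable_indic.
have bD1 t : `|\1_D t : R| <= 1.
  by rewrite indicE; case: (t \in D); rewrite ?normr1 ?normr0.
have [w [bw wI] w1] := cond_exp_exists mu GM mD1 bD1.
(* [H] is the smallest set of the sigma-algebra of [G] that contains [D] up to a null set. *)
pose H := w @^-1` `]0, +oo[%classic.
have GH : <<s G >> H by apply: (bounded_measurable_preimage bw).
have mT A : <<s G >> A -> measurable A by exact: (g_sigma_measurable GM).
have indicD A : measurable A -> \int[mu]_(t in A) (\1_D t : R) = fine (mu (D `&` A)).
  by move=> mA; rewrite /Rintegral integral_indic.
have IwA A : <<s G >> A -> mu.-integrable A (EFin \o w).
  by move=> GA; exact: (bounded_measurable_integrable mu GM bw (mT _ GA)).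
(* Off [H] one has [w <= 0], while the integral of [w] over the complement of [H] is the measure of
   [D] minus [H]. *)
have DH : {ae mu, forall t, D t -> H t}.
  exists (D `\` H); split.
  - by apply: measurableD => //; exact: mT.
  - have GHC : <<s G >> (~` H) by exact: (@measurableC _ (g_sigma_algebraType G)).
    apply/eqP; rewrite eq_le measure_ge0 andbT setDE.
    rewrite -(fineK (fin_num_measure mu _ _)); last exact/measurableI/mT.
    rewrite lee_fin -indicD; last exact: mT.
    rewrite -wI//; have := @le_Rintegral _ _ _ mu (~` H) w (cst 0) (mT _ GHC).
    rewrite (Rintegral_cst mu (mT _ GHC)) mul0r; apply.
    + exact: IwA.
    + by apply: finite_measure_integrable_cst; exact: mT.
    + by move=> t /=; rewrite /H/= in_itv/= andbT => /negP; rewrite -leNgt.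
  - by move=> t /= /not_implyP.
(* If [B] contains [D] up to a null set, then [w] has integral zero over every set of [<<s G>>]
   inside [H] minus [B], although it is positive there; hence this difference is null. *)
have HD B : <<s G >> B -> {ae mu, forall t, D t -> B t} ->
    {ae mu, forall t, H t -> B t}.
  move=> GB DB; pose N := H `\` B.
  have GN : <<s G >> N by exact: (@measurableD _ (g_sigma_algebraType G)).
  have DN A : measurable A -> mu (D `&` (A `&` N)) = 0%E.
    move=> mA; apply: measure_negligible.
      by apply: measurableI => //; apply: measurableI => //; exact: mT.
    by apply: negligibleS DB => t [Dt [_ [_ nB]]] /(_ Dt).
  pose wN t := if t \in N then w t else 0.
  have bwN : bounded_measurable G wN.
    exact: (bounded_measurable_if GN bw (bounded_measurable_cst G 0)).
  have : {ae mu, forall t, wN t <= 0}.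
    apply: (bounded_measurable_ae_le GM bwN (bounded_measurable_cst G 0)) => A GA.
    rewrite Rintegral_cst ?mul0r; last exact: mT.
    have -> : \int[mu]_(t in A) wN t = \int[mu]_(t in A `&` N) w t.
      by rewrite Rintegral_mkcondr; apply: eq_Rintegral.
    have GAN : <<s G >> (A `&` N) by exact: (@measurableI _ (g_sigma_algebraType G)).
    by rewrite wI// indicD ?DN//; exact: mT.
  apply: filterS => t + Ht; apply: contraPP => nB.
  rewrite /wN ifT; last by rewrite inE.
  by move: Ht; rewrite /H/= in_itv/= andbT => w0; apply/negP; rewrite -ltNge.
(* By minimality of [H], a bound on [f] passes to [p1] a.e. on [H], and [p2] is [f] a.e. off
   [H]; in particular [u] is unique a.e. *)
pose glue f u := exists p1 p2, [/\ bounded_measurable G p1, bounded_measurable G p2,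
  forall t, D t -> p1 t = f t, forall t, ~ D t -> p2 t = f t
  & u = fun t => if t \in H then p1 t else p2 t].
have glue_bm f u : glue f u -> bounded_measurable G u.
  by move=> [p1 [p2 [b1 b2 _ _ ->]]]; exact: bounded_measurable_if.
have glue_lin a f g u v : glue f u -> glue g v ->
    glue (fun t => a * f t + g t) (fun t => a * u t + v t).
  move=> [p1 [p2 [b1 b2 e1 e2 ->]]] [q1 [q2 [c1 c2 g1 g2 ->]]].
  exists (fun t => a * p1 t + q1 t), (fun t => a * p2 t + q2 t); split.
  - exact: bounded_measurable_lin.
  - exact: bounded_measurable_lin.
  - by move=> t Dt; rewrite e1// g1.
  - by move=> t Dt; rewrite e2// g2.
  - by apply/funext => t; case: ifP.
have glue_le (c : R) f u : glue f u -> {ae mu, forall t, `|f t| <= c} ->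
    {ae mu, forall t, `|u t| <= c}.
  move=> [p1 [p2 [b1 b2 e1 e2 ->]]] fc.
  have GB : <<s G >> [set t | `|p1 t| <= c].
    have -> : [set t | `|p1 t| <= c] = (fun t => `|p1 t|) @^-1` `]-oo, c]%classic.
      by apply/seteqP; split=> t /=; rewrite in_itv.
    exact: (bounded_measurable_preimage (bounded_measurable_norm b1)).
  have DB : {ae mu, forall t, D t -> `|p1 t| <= c}.
    by apply: filterS fc => t ft Dt; rewrite e1.
  apply: filterS3 (HD _ GB DB) fc DH => t HB ft DHt.
  case: ifPn => [/set_mem /HB//|]; rewrite notin_setE => nH.
  by rewrite e2// => /DHt.
have glue_ae f u v : glue f u -> glue f v -> {ae mu, forall t, u t = v t}.
  move=> fu fv; have := glue_lin (-1) _ _ _ _ fu fv => /glue_le /(_ _).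
  have : {ae mu, forall t, `|- 1 * f t + f t| <= 0}.
    by apply: aeW => t; rewrite mulN1r addNr normr0.
  move=> /[swap] /[apply]; apply: filterS => t.
  by rewrite normr_le0 mulN1r addrC subr_eq0 => /eqP.
have gl f : bounded_measurable (E |` G) f -> exists u, glue f u.
  move=> bf; have [p1 b1 e1] := tr1 _ bf; have [p2 b2 e2] := tr2 _ bf.
  by exists (fun t => if t \in H then p1 t else p2 t), p1, p2.
pose sel f := xget (cst 0) [set u | glue f u].
have selP f : bounded_measurable (E |` G) f -> glue f (sel f).
  by move=> /gl; rewrite /sel => -[u fu]; case: xgetP => // /(_ u).
have Gsub f : bounded_measurable G f -> bounded_measurable (E |` G) f.
  apply: bounded_measurable_sub; apply: smallest_sub => // A GA.
  by apply: sub_gen_smallest; right.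
exists (fun f => rho (sel f)); split.
- move=> f bf; have fs := selP _ bf.
  apply: filterS2 (rho1 _ (glue_bm _ _ fs)) DH => t -> DHt Dt.
  have [p1 [p2 [_ _ e1 _ ->]]] := fs.
  by rewrite ifT ?e1//; apply/mem_set/DHt.
- move=> a f g bf bg t.
  have sf := selP _ bf; have sg := selP _ bg.
  rewrite -rho2//; [|exact: glue_bm sf|exact: glue_bm sg].
  have sfg := selP _ (bounded_measurable_lin a bf bg).
  apply: (lifting_ae_eq lrho).
  + exact: glue_bm sfg.
  + by apply: bounded_measurable_lin; [exact: glue_bm sf|exact: glue_bm sg].
  + by apply: glue_ae sfg _; exact: glue_lin.
- move=> c f c0 bf fc; apply: rho3 => //; first exact: glue_bm (selP _ bf).
  exact: glue_le (selP _ bf) fc.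
- move=> f bf t; apply: (lifting_ae_eq lrho) => //.
    exact: glue_bm (selP _ (Gsub _ bf)).
  apply: glue_ae (selP _ (Gsub _ bf)) _.
  by exists f, f; split => //; apply/funext => s; case: ifP.
Qed.

End Lifting.

Section LiftingExtension.
Context d (T : measurableType d) (R : realType).
Variable mu : {finite_measure set T -> \bar R}.
Implicit Types (G : set (set T)) (f g : T -> R) (rho : (T -> R) -> T -> R).

(** The half extensions for [E] and for its complement are each correct a.e. on their own half;
    patching them along [E] preserves linearity and bounds, which are pointwise, and both extend
    [rho]. *)
Lemma lifting_adjoin G E rho : G `<=` measurable -> measurable E ->
  is_lifting mu G rho -> exists2 rho', is_lifting mu (E |` G) rho' &
    forall f, bounded_measurable G f -> forall t, rho' f t = rho f t.
Proof.
move=> GM mE lrho.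
have GT : <<s G >> setT by exact: (@measurableT _ (g_sigma_algebraType G)).
have G0 : <<s G >> set0 by exact: (@measurable0 _ (g_sigma_algebraType G)).
(* On [E] the set [E] has the trace of the whole space, on its complement that of the empty set;
   both are in [<<s G>>]. *)
have trE f : bounded_measurable (E |` G) f -> exists2 p, bounded_measurable G p
    & forall t, E t -> p t = f t.
  by apply: bounded_measurable_trace; exists setT => //; rewrite setIid setTI.
have trC f : bounded_measurable (E |` G) f -> exists2 p, bounded_measurable G p
    & forall t, ~ E t -> p t = f t.
  apply: (@bounded_measurable_trace _ _ _ G E (~` E)).
  by exists set0 => //; rewrite setICr set0I.
have [r1 [ae1 lin1 bnd1 cmp1]] := half_extension GM mE lrho trE trC.
have trCC f : bounded_measurable (E |` G) f -> exists2 p, bounded_measurable G p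
    & forall t, ~ ~ E t -> p t = f t.
  by move=> /trE[p bp pf]; exists p => // t /contrapT; exact: pf.
have [r2 [ae2 lin2 bnd2 cmp2]] := half_extension GM (measurableC mE) lrho trC trCC.
exists (fun f t => if t \in E then r1 f t else r2 f t); last first.
  by move=> f bf t; case: ifP => _; [exact: cmp1|exact: cmp2].
split.
- move=> f bf; apply: filterS2 (ae1 _ bf) (ae2 _ bf) => t h1 h2.
  by case: ifPn => [/set_mem|]; [exact: h1|rewrite notin_setE; exact: h2].
- by move=> a f g bf bg t; case: ifP => _; [exact: lin1|exact: lin2].
- by move=> c f c0 bf fc t; case: ifP => _; [exact: bnd1|exact: bnd2].
Qed.

(** The truncation [f'] equals [f] a.e., so it has the same integrals, and it is bounded everywhere;
    comparing integrals with constants then bounds any version [g]. *)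
Lemma cond_exp_ae_bound G f g (c : R) : G `<=` measurable ->
  bounded_measurable measurable f -> is_cond_exp mu G f g ->
  {ae mu, forall t, `|f t| <= c} -> 0 <= c -> {ae mu, forall t, `|g t| <= c}.
Proof.
move=> GM bf [bg gI] fc c0.
have If A : measurable A -> mu.-integrable A (EFin \o f).
  exact: (bounded_measurable_integrable mu (@subset_refl _ _) bf).
have Ic A (a : R) : measurable A -> mu.-integrable A (EFin \o cst a).
  exact: finite_measure_integrable_cst.
pose f' t := Num.max (- c) (Num.min c (f t)).
have mf : measurable_fun setT f by exact: bounded_measurableT bf.
have mf' : measurable_fun setT f'.
  by apply: measurable_maxr => //; apply: measurable_minr.
have bf' t : - c <= f' t <= c.
  rewrite /f' le_max lexx /= ge_max ge_min lexx /= andbT.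
  by rewrite (le_trans _ c0)// oppr_le0.
have ff' : {ae mu, forall t, f t = f' t}.
  apply: filterS fc => t; rewrite ler_norml => /andP[h1 h2].
  by rewrite /f' (min_idPr h2) (max_idPr h1).
have If' A : measurable A -> mu.-integrable A (EFin \o f').
  move=> mA; apply: (@bounded_integrable _ _ _ mu f' c) => // t.
  by rewrite ler_norml.
have gI' A : <<s G >> A -> \int[mu]_(t in A) g t = \int[mu]_(t in A) f' t.
  move=> GA; have mA := g_sigma_measurable GM GA.
  rewrite gI//; congr fine; apply: ae_eq_integral => //.
  - by apply/measurable_EFinP; exact: measurable_funTS.
  - by apply/measurable_EFinP; exact: measurable_funTS.
  - by apply: filterS ff' => t -> _.
have h1 : {ae mu, forall t, g t <= c}.
  apply: (bounded_measurable_ae_le GM bg (bounded_measurable_cst G c)) => A GA.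
  have mA := g_sigma_measurable GM GA; rewrite gI'//.
  apply: le_Rintegral => //; [exact: If'|exact: Ic|].
  by move=> t _; case/andP: (bf' t).
have h2 : {ae mu, forall t, - c <= g t}.
  apply: (bounded_measurable_ae_le GM (bounded_measurable_cst G (- c)) bg) => A GA.
  have mA := g_sigma_measurable GM GA; rewrite gI'//.
  apply: le_Rintegral => //; [exact: Ic|exact: If'|].
  by move=> t _; case/andP: (bf' t).
by apply: filterS2 h1 h2 => t h1 h2; rewrite ler_norml h1 h2.
Qed.

Lemma lifting_limit (G : nat -> set (set T)) (rho : nat -> (T -> R) -> T -> R) :
  (forall n, G n `<=` measurable) ->
  (forall m n, (m <= n)%N -> <<s G m >> `<=` <<s G n >>) ->
  (forall n, is_lifting mu (G n) (rho n)) ->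
  (forall m n, (m <= n)%N -> forall f, bounded_measurable (G m) f ->
    forall t, rho n f t = rho m f t) ->
  exists2 rho', is_lifting mu (\bigcup_n <<s G n >>) rho' &
    forall n f, bounded_measurable (G n) f -> forall t, rho' f t = rho n f t.
Proof.
move=> GM G_nd lrho comp.
have [L [Llin Lbnd Lcvg]] := generalized_limit R.
pose H := \bigcup_n <<s G n >>.
have HM : H `<=` measurable by move=> A [n _]; exact: (g_sigma_measurable (GM n)).
have HT f : bounded_measurable H f -> bounded_measurable measurable f.
  apply: bounded_measurable_sub; apply: subset_trans (g_sigma_measurable HM) _.
  exact: sub_gen_smallest.
have GH n f : bounded_measurable (G n) f -> bounded_measurable H f.
  by apply: bounded_measurable_sub => A GA; apply: sub_gen_smallest; exists n.
have ce n f : bounded_measurable H f -> exists2 g, is_cond_exp mu (G n) f g &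
    forall c, 0 <= c -> {ae mu, forall t, `|f t| <= c} -> {ae mu, forall t, `|g t| <= c}.
  move=> bf; have [c fc] := bf.2.
  have mf := bounded_measurableT (@subset_refl _ _) (HT _ bf).
  have [g ge _] := cond_exp_exists mu (GM n) mf fc.
  exists g => // a a0 fa; apply: (cond_exp_ae_bound (GM n) _ ge) => //; exact: HT.
pose P n f := xget (cst 0) [set g | is_cond_exp mu (G n) f g].
have PE n f : bounded_measurable H f -> is_cond_exp mu (G n) f (P n f).
  by move=> /(ce n)[g gE _]; rewrite /P; case: xgetP => // /(_ g).
have Pbnd n f c : bounded_measurable H f -> 0 <= c ->
    {ae mu, forall t, `|f t| <= c} -> {ae mu, forall t, `|P n f t| <= c}.
  move=> bf c0 fc; apply: (cond_exp_ae_bound (GM n) _ (PE n _ bf)) => //; exact: HT.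
have bnd f c : bounded_measurable H f -> 0 <= c -> {ae mu, forall t, `|f t| <= c} ->
    forall t n, `|rho n (P n f) t| <= c.
  move=> bf c0 fc t n; have [_ _ r3] := lrho n; apply: r3 => //.
    exact: (PE n _ bf).1.
  exact: Pbnd.
have bndex f : bounded_measurable H f -> forall t, exists c : R,
    forall n, `|rho n (P n f) t| <= c.
  move=> bf t; have [c fc] := bf.2; exists c; apply: bnd => //; last exact: aeW.
  exact: le_trans (fc t).
(* [P n f] tends to [f] a.e., so that the generalized limit has to be chosen on a null set only. *)
exists (fun f t => L (fun n => rho n (P n f) t)); first split.
- move=> f bf.
  have h1 : {ae mu, forall t, forall n, rho n (P n f) t = P n f t}.
    apply: ae_foralln => n; have [r1 _ _] := lrho n; apply: r1.
    exact: (PE n _ bf).1.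
  have h2 := cond_exp_cvg GM G_nd bf (fun n => PE n _ bf).
  apply: filterS2 h1 h2 => t h1 h2; apply: Lcvg.
  by rewrite (_ : (fun n => _) = (fun n => P n f t)) //; apply/funext.
(* [P n] is a choice of versions, hence linear only a.e.; [rho n] does not see the null sets. *)
- move=> a f g bf bg t; rewrite -Llin; [|exact: bndex|exact: bndex].
  congr L; apply/funext => n; have [_ r2 _] := lrho n.
  have [bPf If] := PE n _ bf; have [bPg Ig] := PE n _ bg.
  have bfg := bounded_measurable_lin a bf bg.
  have [bPfg Ifg] := PE n _ bfg.
  rewrite -r2//; apply: (lifting_ae_eq (lrho n)) => //.
    exact: bounded_measurable_lin.
  apply: (bounded_measurable_ae_eq (GM n)) => //.
    exact: bounded_measurable_lin.
  move=> A GA; have mA := g_sigma_measurable (GM n) GA; rewrite Ifg//.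
  have I1 := bounded_measurable_integrable mu HM bf mA.
  have I2 := bounded_measurable_integrable mu HM bg mA.
  have I3 := bounded_measurable_integrable mu (GM n) bPf mA.
  have I4 := bounded_measurable_integrable mu (GM n) bPg mA.
  rewrite !RintegralD ?RintegralZl// ?If ?Ig//.
  + exact: integrableZl I3.
  + exact: integrableZl I1.
- move=> c f c0 bf fc t; apply: Lbnd; exact: bnd.
- move=> m f bf t; apply: Lcvg.
  have bH := GH _ _ bf.
  (* From index [m] on, [f] is its own conditional expectation a.e., so the sequence is constant
     there. *)
  apply: cvg_near_cst; exists m => // n /= mn.
  have bn : bounded_measurable (G n) f by exact: bounded_measurable_sub (G_nd _ _ mn) bf.
  rewrite -(comp _ _ mn)//.
  apply: (lifting_ae_eq (lrho n)) => //; first exact: (PE n _ bH).1.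
  have [bP PI] := PE n _ bH.
  by apply: (bounded_measurable_ae_eq (GM n)).
Qed.

End LiftingExtension.

(** * Zorn's lemma for partial liftings *)

Section LiftingExistence.
Context d (T : measurableType d) (R : realType).
Variable mu : {finite_measure set T -> \bar R}.

Let partial_lifting := {p : set (set T) * ((T -> R) -> T -> R) |
  p.1 `<=` measurable /\ is_lifting mu p.1 p.2}.

Let alg (x : partial_lifting) : set (set T) := (sval x).1.
Let lift (x : partial_lifting) : (T -> R) -> T -> R := (sval x).2.

Let algM (x : partial_lifting) : alg x `<=` measurable.
Proof. by case: (svalP x). Qed.

Let liftP (x : partial_lifting) : is_lifting mu (alg x) (lift x).
Proof. by case: (svalP x). Qed.

(** Only a preorder: different families generate the same sigma-algebra, and a lifting is
    unconstrained on functions outside its domain. Hence the version of Zorn's lemma for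
    preorders. *)
Let le_lift (x y : partial_lifting) : bool :=
  `[< <<s alg x >> `<=` <<s alg y >> /\
      forall f, bounded_measurable (alg x) f -> forall t, lift y f t = lift x f t >].

Let le_lift_refl x : le_lift x x. Proof. by apply/asboolP; split. Qed.

Let le_lift_trans x y z : le_lift x y -> le_lift y z -> le_lift x z.
Proof.
move=> /asboolP[xy xy'] /asboolP[yz yz']; apply/asboolP; split.
  exact: subset_trans yz.
move=> f bf t; rewrite yz' ?xy'//; exact: bounded_measurable_sub bf.
Qed.

Let mk_upper (A : set partial_lifting) (H : set (set T)) rho :
  H `<=` measurable -> is_lifting mu H rho ->
  (forall x, A x -> <<s alg x >> `<=` <<s H >>) ->
  (forall x, A x -> forall f, bounded_measurable (alg x) f -> forall t, rho f t = lift x f t) ->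
  exists y, forall x, A x -> le_lift x y.
Proof.
move=> HM lrho sub comp.
exists (exist _ (H, rho) (conj HM lrho)) => x Ax; apply/asboolP; split.
  exact: sub.
exact: comp.
Qed.

Let chain_cofinal (A : set partial_lifting) (s : nat -> partial_lifting) :
  total_on A (fun x y => le_lift x y) -> (forall n, A (s n)) ->
  (forall x, A x -> exists n, le_lift x (s n)) ->
  exists y, forall x, A x -> le_lift x y.
Proof.
move=> totA As cof.
(* [s] need not be monotone; [e n] is the running maximum of its first members. *)
pose fix e n := if n is m.+1 then
  (if le_lift (e m) (s m.+1) then s m.+1 else e m) else s 0%N.
have Ad n : A (e n) by elim: n => [|n IH] /=; [exact: As|case: ifP].
have sd n : le_lift (s n) (e n).
  case: n => [|n] /=; first exact: le_lift_refl.
  case: ifPn => [_|nle]; first exact: le_lift_refl.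
  by have [] := totA _ _ (Ad n) (As n.+1) => // H; rewrite H in nle.
have dS n : le_lift (e n) (e n.+1) by rewrite /=; case: ifP.
have dle m n : (m <= n)%N -> le_lift (e m) (e n).
  move=> /subnK <-; elim: (n - m)%N => [|k IH]; first exact: le_lift_refl.
  by rewrite addSn; exact: le_lift_trans (dS _).
have dsub m n : (m <= n)%N -> <<s alg (e m) >> `<=` <<s alg (e n) >>.
  by move=> /dle/asboolP[].
have dcmp m n : (m <= n)%N -> forall f, bounded_measurable (alg (e m)) f ->
    forall t, lift (e n) f t = lift (e m) f t.
  by move=> /dle/asboolP[].
have [rho lrho comp] := lifting_limit (fun n => @algM (e n)) dsub
  (fun n => liftP (e n)) dcmp.
have xd x : A x -> exists n, le_lift x (e n).
  by move=> /cof[n xs]; exists n; exact: le_lift_trans (sd n).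
apply: (@mk_upper A _ rho _ lrho).
- by move=> B [n _]; exact: (g_sigma_measurable (@algM (e n))).
- move=> x /xd[n /asboolP[xdn _]] B /xdn GB.
  by apply: sub_gen_smallest; exists n.
- move=> x /xd[n /asboolP[xdn cmp]] f bf t.
  rewrite -cmp//; apply: comp; exact: bounded_measurable_sub bf.
Qed.

(* The union of the sigma-algebras of such a chain is a sigma-algebra, and each function
   measurable for it is measurable for one member of the chain. *)
Let chain_not_cofinal (A : set partial_lifting) :
  total_on A (fun x y => le_lift x y) -> A !=set0 ->
  (forall s : nat -> partial_lifting, (forall n, A (s n)) ->
    exists2 x, A x & forall n, le_lift (s n) x) ->
  exists y, forall x, A x -> le_lift x y.
Proof.
move=> totA [x0 Ax0] ub.
pose H := \bigcup_(x in A) <<s alg x >>.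
have HM : H `<=` measurable by move=> B [x _]; exact: (g_sigma_measurable (@algM x)).
have HE B : <<s H >> B -> exists2 x, A x & <<s alg x >> B.
  suff : <<s H >> `<=` [set B | exists2 x, A x & <<s alg x >> B] by exact.
  apply: smallest_sub; last by move=> {}B [x Ax xB]; exists x.
  split.
  - by exists x0 => //; exact: (@measurable0 _ (g_sigma_algebraType (alg x0))).
  - move=> {}B [x Ax xB]; exists x => //; rewrite setTD.
    exact: (@measurableC _ (g_sigma_algebraType (alg x))).
  - move=> F HF; have /choice[s sE] : forall n, exists x, A x /\ <<s alg x >> (F n).
      by move=> n; have [x Ax xF] := HF n; exists x.
    have [x Ax sx] := ub s (fun n => (sE n).1); exists x => //.
    apply: (@bigcupT_measurable _ (g_sigma_algebraType (alg x))) => n.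
    by have /asboolP[+ _] := sx n; apply; exact: (sE n).2.
have Hbm (f : T -> R) : bounded_measurable H f -> exists2 x, A x & bounded_measurable (alg x) f.
  move=> bf.
  pose q n : R := if @unpickle rat n is Some r then ratr r else 0.
  have /choice[s sE] : forall n, exists x, A x /\ <<s alg x >> (f @^-1` `]q n, +oo[).
    move=> n; have [|x Ax xF] := HE (f @^-1` `]q n, +oo[).
      exact: bounded_measurable_preimage.
    by exists x.
  have [x Ax sx] := ub s (fun n => (sE n).1); exists x => //.
  split; last exact: bf.2.
  move=> mT; apply: (measurability _ (RGenOInfty.measurableE R)) => //.
  move=> _ [_ [a ->] <-]; rewrite setTI.
  have -> : f @^-1` `]a, +oo[ = \bigcup_(n in [set n | a <= q n]) (f @^-1` `]q n, +oo[).
    apply/seteqP; split=> t /=; rewrite in_itv/= andbT.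
      move=> /rat_in_itvoo[r]; rewrite in_itv/= => /andP[r1 r2].
      have qr : q (pickle r) = ratr r by rewrite /q pickleK.
      by exists (pickle r); rewrite /= qr ?ltW// in_itv/= andbT.
    by move=> [n /= an]; rewrite in_itv/= andbT; exact: le_lt_trans.
  apply: bigcup_measurable => n _.
  by have /asboolP[+ _] := sx n; apply; exact: (sE n).2.
(* The lift of [f] is read off in a member of the chain for which [f] is measurable; any two such
   members agree on [f]. *)
have /choice[sel selP] : forall f : T -> R, exists x, bounded_measurable H f ->
    A x /\ bounded_measurable (alg x) f.
  move=> f; have [/Hbm[x Ax bx]|nb] := pselect (bounded_measurable H f); first by exists x.
  by exists x0 => /nb.
have selE (f : T -> R) x : A x -> bounded_measurable (alg x) f -> bounded_measurable H f ->
    forall t, lift (sel f) f t = lift x f t.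
  move=> Ax bx /selP[As bs] t.
  by have [/asboolP[_ ->]|/asboolP[_ ->]] := totA _ _ As Ax.
have xH x (f : T -> R) : A x -> bounded_measurable (alg x) f -> bounded_measurable H f.
  by move=> Ax; apply: bounded_measurable_sub => B GB; apply: sub_gen_smallest; exists x.
have common (f g : T -> R) : bounded_measurable H f -> bounded_measurable H g ->
    exists2 x, A x & bounded_measurable (alg x) f /\ bounded_measurable (alg x) g.
  move=> /Hbm[x Ax bx] /Hbm[y Ay bY].
  have [/asboolP[xy _]|/asboolP[yx _]] := totA _ _ Ax Ay.
    by exists y => //; split => //; exact: bounded_measurable_sub bx.
  by exists x => //; split => //; exact: bounded_measurable_sub bY.
apply: (@mk_upper A H (fun f => lift (sel f) f) HM).
- split.
  + move=> f bf; have [r1 _ _] := liftP (sel f); apply: r1; exact: (selP _ bf).2.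
  + move=> a f g bf bg t; have [x Ax [bxf bxg]] := common _ _ bf bg.
    have [_ r2 _] := liftP x.
    rewrite (selE f x)// (selE g x)// (selE _ x)//; first exact: r2.
      exact: bounded_measurable_lin.
    exact: bounded_measurable_lin.
  + move=> c f c0 bf fc; have [_ _ r3] := liftP (sel f); apply: r3 => //.
    exact: (selP _ bf).2.
- by move=> x Ax B GB; apply: sub_gen_smallest; exists x.
- by move=> x Ax f bf t; apply: selE => //; exact: xH bf.
Qed.

Lemma lifting_exists : exists rho, is_lifting mu measurable rho.
Proof.
(* On a null space every bound holds a.e., so the identity on constants, where Zorn's lemma starts,
   would violate the bound clause; the zero map serves there. *)
have [mu0|mu0] := pselect (mu setT = 0%E).
  exists (fun _ _ => 0); split.
  - by move=> f _; exact: measure0_ae.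
  - by move=> a f g _ _ t; rewrite mulr0 addr0.
  - by move=> c f c0 _ _ t; rewrite normr0.
have cst0 (f : T -> R) : bounded_measurable set0 f -> forall s t, f s = f t.
  move=> bf s t.
  have : <<s set0 >> `<=` [set A : set T | A = set0 \/ A = setT].
    apply: smallest_sub => //; split; first by left.
      by move=> A [|] ->; rewrite ?setD0 ?setDv; [right|left].
    move=> F HF; have [[n Fn]|nF] := pselect (exists n, F n = setT).
      by right; apply/seteqP; split => // u _; exists n => //; rewrite Fn.
    left; apply/seteqP; split => // u [n _].
    by case: (HF n) => [->//|Fn]; exfalso; apply: nF; exists n.
  move=> /(_ (f @^-1` [set f s])) [].
  - exact: (bounded_measurable_preimage bf).
  - by move=> /seteqP[/(_ s)] /= /(_ erefl).
  - by move=> /seteqP[_ /(_ t I)] /= ->.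
have lift0 : is_lifting mu set0 (fun f => f).
  split => //; first by move=> f _; exact: aeW.
  move=> c f c0 bf fc t; apply: contrapT => nfc; apply: mu0.
  apply: measure_negligible => //; apply: negligibleS fc => s _ /=.
  by rewrite (cst0 _ bf s t).
pose x0 : partial_lifting := exist _ (set0, fun f => f) (conj (@sub0set _ _) lift0).
have [A totA|x xmax] := ZL_preorder x0 le_lift_refl (fun r s t => @le_lift_trans r s t).
  have [[s [As cof]]|ncof] := pselect (exists s : nat -> partial_lifting,
      (forall n, A (s n)) /\ forall x, A x -> exists n, le_lift x (s n)).
    exact: chain_cofinal totA As cof.
  have [A0|/set0P] := eqVneq A set0.
    by exists x0 => y; rewrite A0.
  move=> An0; apply: (chain_not_cofinal totA An0) => s As.
  apply: contrapT => nub; apply: ncof; exists s; split => // x Ax.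
  apply: contrapT => nle; apply: nub; exists x => // n.
  have [//|xs] := totA _ _ (As n) Ax.
  by exfalso; apply: nle; exists n.
exists (lift x).
(* Adjoining [E] gives a larger partial lifting, which maximality puts below [x] again. *)
have xall E : measurable E -> <<s alg x >> E.
  move=> mE; have [rho' lrho' comp] := lifting_adjoin (@algM x) mE (liftP x).
  have EM : E |` alg x `<=` measurable by move=> B [->//|]; exact: algM.
  have := xmax (exist _ (E |` alg x, rho') (conj EM lrho')).
  have /[swap]/[apply] : le_lift x (exist _ (E |` alg x, rho') (conj EM lrho')).
    apply/asboolP; split => //; apply: smallest_sub => // B xB.
    by apply: sub_gen_smallest; right.
  by move=> /asboolP[+ _]; apply; apply: sub_gen_smallest; left.
have sub (f : T -> R) : bounded_measurable measurable f -> bounded_measurable (alg x) f.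
  apply: bounded_measurable_sub; apply: smallest_sub => //.
have [r1 r2 r3] := liftP x.
split.
- by move=> f /sub; exact: r1.
- by move=> a f g /sub bf /sub bg; exact: r2.
- by move=> c f c0 /sub; exact: r3.
Qed.

End LiftingExistence.

(** * Real and complex scalars *)

Section ScalarParts.
Context {R : realType} {k : scalar_kind}.
Local Notation F := (scalars R k).
Implicit Types (c d : F) (a b : R).

Definition real_scalar (a : R) : F := scalar_mk a 0.

(* For real scalars [scalar_mk] drops the imaginary part, so that [scalar_i] is [0]. *)
Definition scalar_i : F := scalar_mk 0 1.

Lemma re_partD c d : re_part (c + d) = re_part c + re_part d.
Proof. by rewrite /re_part; case: k c d => //= -[a b] [a' b']. Qed.

Lemma im_partD c d : im_part (c + d) = im_part c + im_part d.
Proof. by rewrite /im_part; case: k c d => //= [c d|[a b] [a' b']//]; rewrite addr0. Qed.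

Lemma re_part0 : re_part (0 : F) = 0.
Proof. by rewrite /re_part; case: k. Qed.

Lemma im_part0 : im_part (0 : F) = 0.
Proof. by rewrite /im_part; case: k. Qed.

Lemma re_partN c : re_part (- c) = - re_part c.
Proof. by rewrite /re_part; case: k c => //= -[]. Qed.

Lemma im_partN c : im_part (- c) = - im_part c.
Proof. by rewrite /im_part; case: k c => //= [c|[]//]; rewrite oppr0. Qed.

Lemma re_partB c d : re_part (c - d) = re_part c - re_part d.
Proof. by rewrite re_partD re_partN. Qed.

Lemma im_partB c d : im_part (c - d) = im_part c - im_part d.
Proof. by rewrite im_partD im_partN. Qed.

Lemma re_partM c d : re_part (c * d) = re_part c * re_part d - im_part c * im_part d.
Proof.
by rewrite /re_part /im_part; case: k c d => /= [c d|[a b] [a' b']//]; rewrite mul0r subr0.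
Qed.

Lemma im_partM c d : im_part (c * d) = re_part c * im_part d + im_part c * re_part d.
Proof.
by rewrite /re_part /im_part; case: k c d => /= [c d|[a b] [a' b']//]; rewrite mul0r mulr0 addr0.
Qed.

Lemma re_part_mk a b : re_part (scalar_mk a b : F) = a.
Proof. by rewrite /re_part /scalar_mk; case: k. Qed.

Lemma im_part_mk a b : im_part (scalar_mk a b : F) =
  if k is ComplexScalars then b else 0.
Proof. by rewrite /im_part /scalar_mk; case: k. Qed.

(** The factor [im_part scalar_i] is [1] for complex and [0] for real scalars, so one formula serves
    both. *)
Lemma im_part_mkE a b : im_part (scalar_mk a b : F) = im_part scalar_i * b.
Proof. by rewrite !im_part_mk; case: k; rewrite ?mul1r ?mul0r. Qed.

Lemma im_part_mk_dist a b c :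
  `|im_part (scalar_mk a b : F) - im_part c| <= `|b - im_part c|.
Proof.
rewrite im_part_mk; move: c; rewrite /im_part; case: k => //= _.
by rewrite subrr normr0.
Qed.

Lemma scalar_mkK c : scalar_mk (re_part c) (im_part c) = c.
Proof. by rewrite /re_part /im_part /scalar_mk; case: k c => //= -[]. Qed.

Lemma scalar_mkD a b a' b' :
  scalar_mk a b + scalar_mk a' b' = scalar_mk (a + a') (b + b') :> F.
Proof. by rewrite /scalar_mk; case: k. Qed.

Lemma scalar_eq c d : re_part c = re_part d -> im_part c = im_part d -> c = d.
Proof. by move=> e1 e2; rewrite -[c]scalar_mkK e1 e2 scalar_mkK. Qed.

Lemma re_real_scalar a : re_part (real_scalar a) = a.
Proof. exact: re_part_mk. Qed.

Lemma im_real_scalar a : im_part (real_scalar a) = 0.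
Proof. by rewrite im_part_mk; case: k. Qed.

Lemma real_scalarD a b : real_scalar (a + b) = real_scalar a + real_scalar b.
Proof. by rewrite /real_scalar scalar_mkD addr0. Qed.

Lemma real_scalarB a b : real_scalar (a - b) = real_scalar a - real_scalar b.
Proof.
by apply: scalar_eq; rewrite ?re_partB ?im_partB ?re_real_scalar// !im_real_scalar subr0.
Qed.

Lemma real_scalarM a b : real_scalar (a * b) = real_scalar a * real_scalar b.
Proof.
apply: scalar_eq; rewrite ?re_partM ?im_partM !re_real_scalar !im_real_scalar.
  by rewrite mulr0 subr0.
by rewrite mulr0 mul0r addr0.
Qed.

Lemma real_scalar0 : real_scalar 0 = 0.
Proof. by rewrite /real_scalar /scalar_mk; case: k. Qed.

Lemma real_scalar1 : real_scalar 1 = 1.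
Proof. by rewrite /real_scalar /scalar_mk; case: k. Qed.

Lemma ler_real_scalar a b : (real_scalar a <= real_scalar b) = (a <= b).
Proof. by rewrite /real_scalar /scalar_mk; case: k => //=; rewrite lecE /= eqxx. Qed.

Lemma ltr_real_scalar a b : (real_scalar a < real_scalar b) = (a < b).
Proof. by rewrite /real_scalar /scalar_mk; case: k => //=; rewrite ltcE /= eqxx. Qed.

Lemma ge0_real_scalar c : 0 <= c -> c = real_scalar (re_part c).
Proof.
rewrite /real_scalar /scalar_mk /re_part; case: k c => //= -[a b].
by move=> /ger0_Im/= ->.
Qed.

Lemma scalarE c : c = real_scalar (re_part c) + scalar_i * real_scalar (im_part c).
Proof.
rewrite /real_scalar /scalar_mk /re_part /im_part /scalar_i; case: k c => /= [c|[a b]].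
  by rewrite mulr0 addr0.
exact: complexE.
Qed.

End ScalarParts.

Section RealNorm.
Context {R : realType} {k : scalar_kind}.
Local Notation F := (scalars R k).

(** The norm of [V] has values in [F]; its real value permits real estimates that do not depend on
    the kind of scalars. *)
Definition nrm {V : normedModType F} (x : V) : R := re_part (`|x| : F).

Section NormedModule.
Context {V : normedModType F}.
Implicit Types x y : V.

Lemma nrmE x : `|x| = real_scalar (nrm x) :> F.
Proof. exact/ge0_real_scalar. Qed.

Lemma ler_nrm x (a : R) : (`|x| <= real_scalar a :> F) = (nrm x <= a).
Proof. by rewrite nrmE ler_real_scalar. Qed.

Lemma nrm_ge0 x : 0 <= nrm x.
Proof. by rewrite -(@ler_real_scalar R k) real_scalar0 -nrmE. Qed.

Lemma nrmD x y : nrm (x + y) <= nrm x + nrm y.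
Proof. by rewrite -ler_nrm real_scalarD -!nrmE ler_normD. Qed.

Lemma nrmN x : nrm (- x) = nrm x.
Proof. by rewrite /nrm normrN. Qed.

Lemma nrm0 : nrm (0 : V) = 0.
Proof. by rewrite /nrm normr0 re_part0. Qed.

Lemma nrmB x y : nrm (x - y) = nrm (y - x).
Proof. by rewrite -nrmN opprB. Qed.

Lemma nrm_le0 x : nrm x <= 0 -> x = 0.
Proof. by rewrite -ler_nrm real_scalar0 normr_le0 => /eqP. Qed.

Lemma nrm_sum (I : Type) (s : seq I) (P : pred I) (f : I -> V) :
  nrm (\sum_(i <- s | P i) f i) <= \sum_(i <- s | P i) nrm (f i).
Proof.
elim/big_ind2 : _ => //; first by rewrite nrm0.
by move=> x a y b xa yb; apply: le_trans (nrmD _ _) (lerD xa yb).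
Qed.

End NormedModule.

Lemma nrmM (c d : F) : nrm (c * d : F^o) = nrm (c : F^o) * nrm (d : F^o).
Proof.
have : (`|c * d| = `|c| * `|d| :> F) by exact: normrM.
rewrite (nrmE (c * d : F^o)) (nrmE (c : F^o)) (nrmE (d : F^o)) -real_scalarM.
by move=> /(congr1 re_part); rewrite !re_real_scalar.
Qed.

Lemma nrmZ (V : normedModType F) (c : F) (x : V) : nrm (c *: x) = nrm (c : F^o) * nrm x.
Proof.
have := normrZ c x; rewrite (nrmE (c *: x)) (nrmE (c : F^o)) (nrmE x) -real_scalarM.
by move=> /(congr1 re_part); rewrite !re_real_scalar.
Qed.

Lemma abs_nrm (c : F) : abs c = (nrm (c : F^o))%:E.
Proof. by []. Qed.

Lemma sqr_nrm (c : F) : nrm (c : F^o) ^+ 2 = re_part c ^+ 2 + im_part c ^+ 2.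
Proof.
rewrite /nrm /re_part /im_part; case: k c => /= [c|c].
  by rewrite real_normK ?num_real// expr0n addr0.
by case: c => a b /=; rewrite sqr_sqrtr// addr_ge0// sqr_ge0.
Qed.

Lemma re_part_nrm (c : F) : `|re_part c| <= nrm (c : F^o).
Proof.
rewrite -(@ler_pXn2r _ 2)// ?nnegrE ?nrm_ge0// sqr_nrm real_normK ?num_real//.
by rewrite lerDl sqr_ge0.
Qed.

Lemma im_part_nrm (c : F) : `|im_part c| <= nrm (c : F^o).
Proof.
rewrite -(@ler_pXn2r _ 2)// ?nnegrE ?nrm_ge0// sqr_nrm real_normK ?num_real//.
by rewrite lerDr sqr_ge0.
Qed.

Lemma nrm_le_parts (c : F) : nrm (c : F^o) <= `|re_part c| + `|im_part c|.
Proof.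
rewrite -(@ler_pXn2r _ 2)// ?nnegrE ?nrm_ge0// ?addr_ge0//.
rewrite sqr_nrm sqrrD !real_normK ?num_real// -addrA lerD2l lerDr.
by rewrite mulrn_wge0// mulr_ge0.
Qed.

Lemma nrm_real_scalar (a : R) : nrm (real_scalar a : F^o) = `|a|.
Proof.
have := re_part_nrm (real_scalar a); rewrite re_real_scalar => h.
apply/eqP; rewrite eq_le h andbT.
by apply: le_trans (nrm_le_parts _) _; rewrite re_real_scalar im_real_scalar normr0 addr0.
Qed.

Lemma cvg_nrm (u : nat -> F) (l : F) : (u @ \oo --> l) <->
  (forall e : R, 0 < e -> exists n0, forall n, (n0 <= n)%N -> nrm (l - u n : F^o) <= e).
Proof.
split=> [ul e e0|H].
  have e0' : 0 < (real_scalar e : F) by rewrite -real_scalar0 ltr_real_scalar.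
  have /cvgrPdist_le/(_ _ e0')[n0 _ Hn] := ul.
  by exists n0 => n /Hn /=; rewrite -(@ler_nrm F^o).
apply/cvgrPdist_le => e e0.
have e1 := ge0_real_scalar (ltW e0).
have e2 : 0 < re_part e by rewrite -(@ltr_real_scalar R k) -e1 real_scalar0.
have [n0 Hn] := H _ e2; exists n0 => // n /= /Hn.
by rewrite -ler_nrm -e1.
Qed.

End RealNorm.

(** * Integrals of vector-valued functions *)

Section Borel.
Context {X : topologicalType}.
Implicit Types A B : set X.

Lemma borel_sigma_algebra : sigma_algebra setT (@borel X).
Proof. exact: smallest_sigma_algebra. Qed.

Lemma borel0 : borel (set0 : set X).
Proof. by case: borel_sigma_algebra. Qed.

Lemma borelC A : borel A -> borel (~` A).
Proof. by case: borel_sigma_algebra => _ H _ /H; rewrite setTD. Qed.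

Lemma borelT : borel (setT : set X).
Proof. by rewrite -setC0; apply: borelC; exact: borel0. Qed.

Lemma borel_bigcup (F : (set X)^nat) : (forall n, borel (F n)) -> borel (\bigcup_n F n).
Proof. by move=> bF; case: borel_sigma_algebra => _ _; apply. Qed.

Lemma borelU A B : borel A -> borel B -> borel (A `|` B).
Proof.
by move=> bA bB; rewrite -bigcup2E; apply: borel_bigcup => -[|[|n]]//=; exact: borel0.
Qed.

Lemma borelI A B : borel A -> borel B -> borel (A `&` B).
Proof.
by move=> bA bB; rewrite -[A `&` B]setCK setCI; apply: borelC; apply: borelU; exact: borelC.
Qed.

Lemma borelD A B : borel A -> borel B -> borel (A `\` B).
Proof. by move=> bA bB; rewrite setDE; apply: borelI => //; exact: borelC. Qed.

Lemma borel_open A : open A -> borel A.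
Proof. exact: sub_gen_smallest. Qed.

Lemma borel_closed A : closed A -> borel A.
Proof. by move=> cA; rewrite -[A]setCK; apply: borelC; apply: borel_open; exact: closed_openC. Qed.

End Borel.

Section SimpleIntegral.
Context {R : realType} {k : scalar_kind}.
Local Notation F := (scalars R k).
Context {X : topologicalType} {V : normedModType F}.
Implicit Types (m : set X -> V -> F) (W : set X -> R) (s : seq (set X * V)).

(* The last condition is the estimate of a measure by its variation, tested on disjoint families. *)
Definition bounded_additive m W :=
  [/\ forall A x y, borel A -> m A (x + y) = m A x + m A y,
      forall A (c : F) x, borel A -> m A (c *: x) = c * m A x,
      forall A B x, borel A -> borel B -> A `&` B = set0 ->
        m (A `|` B) x = m A x + m B x
    & forall D n (P : 'I_n -> set X) (y : 'I_n -> V) (c : R), borel D ->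
        (forall i, borel (P i)) -> trivIset setT P -> (forall i, P i `<=` D) ->
        0 <= c -> (forall i, nrm (y i) <= c) ->
        nrm (\sum_(i < n) m (P i) (y i) : F^o) <= c * W D].

Definition borel_simple s := forall p, p \in s -> borel p.1.

Lemma borel_simple_cons p s : borel_simple (p :: s) <-> borel p.1 /\ borel_simple s.
Proof.
split=> [H|[bp bs] q]; last by rewrite inE => /predU1P[->|/bs].
by split=> [|q qs]; apply: H; rewrite inE ?eqxx// qs orbT.
Qed.

Lemma borel_simple_cat s s' : borel_simple s -> borel_simple s' -> borel_simple (s ++ s').
Proof. by move=> bs bs' p; rewrite mem_cat => /orP[/bs|/bs']. Qed.

Lemma simple_function_cat s s' t :
  simple_function (s ++ s') t = simple_function s t + simple_function s' t.
Proof. exact: big_cat. Qed.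

Lemma simple_function_cons p s t :
  simple_function (p :: s) t = (\1_(p.1) t : F) *: p.2 + simple_function s t.
Proof. exact: big_cons. Qed.

Lemma simple_integral_cat m s s' :
  simple_integral m (s ++ s') = simple_integral m s + simple_integral m s'.
Proof. exact: big_cat. Qed.

Lemma simple_integral_cons m p s :
  simple_integral m (p :: s) = m p.1 p.2 + simple_integral m s.
Proof. exact: big_cons. Qed.

Definition scale_simple (c : F) s := [seq (p.1, c *: p.2) | p <- s].

Definition restrict_simple (D : set X) s := [seq (p.1 `&` D, p.2) | p <- s].

Lemma scale_simpleP c s : borel_simple s -> borel_simple (scale_simple c s).
Proof. by move=> bs p /mapP[q /bs bq ->]. Qed.

Lemma restrict_simpleP D s : borel D -> borel_simple s -> borel_simple (restrict_simple D s).
Proof. by move=> bD bs p /mapP[q /bs bq ->]; exact: borelI. Qed.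

Lemma simple_function_scale c s t :
  simple_function (scale_simple c s) t = c *: simple_function s t.
Proof.
rewrite /simple_function /scale_simple big_map scaler_sumr.
by apply: eq_bigr => p _; rewrite scalerA mulrC -scalerA.
Qed.

Lemma simple_function_restrict D s t :
  simple_function (restrict_simple D s) t = (\1_D t : F) *: simple_function s t.
Proof.
rewrite /simple_function /restrict_simple big_map scaler_sumr.
by apply: eq_bigr => p _ /=; rewrite indicI scalerA mulrC.
Qed.

Section Bound.
Variables (m : set X -> V -> F) (W : set X -> R).
Hypothesis mW : bounded_additive m W.

Let maddx A x y : borel A -> m A (x + y) = m A x + m A y.
Proof. by case: mW => + _ _ _; apply. Qed.

Let mscale A (c : F) x : borel A -> m A (c *: x) = c * m A x.
Proof. by case: mW => _ + _ _; apply. Qed.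

Let maddA A B x : borel A -> borel B -> A `&` B = set0 ->
  m (A `|` B) x = m A x + m B x.
Proof. by case: mW => _ _ + _; apply. Qed.

Lemma bounded_additive0 x : m set0 x = 0.
Proof.
have := @maddA set0 set0 x borel0 borel0 (set0I _).
by rewrite setU0 => /eqP; rewrite -subr_eq0 opprD addrA subrr add0r oppr_eq0 => /eqP.
Qed.

Lemma bounded_additiver0 A : borel A -> m A 0 = 0.
Proof. by move=> bA; have := @mscale A 0 0 bA; rewrite scale0r mul0r. Qed.

Let splitA Q A x : borel Q -> borel A -> m Q x = m (Q `&` A) x + m (Q `\` A) x.
Proof.
move=> bQ bA; rewrite -maddA ?setUIDK//; [exact: borelI|exact: borelD|].
by rewrite setIDA setDE -setIA -setIA setICA !setIA; apply/seteqP; split => // t [[[]]].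
Qed.

Lemma simple_integral_scale c s : borel_simple s ->
  simple_integral m (scale_simple c s) = c * simple_integral m s.
Proof.
move=> bs; rewrite /simple_integral big_map mulr_sumr !big_seq.
by apply: eq_bigr => p /bs bp; rewrite mscale.
Qed.

Let disjoint_pair (p q : set X * V) := `[< p.1 `&` q.1 = set0 >].

Lemma simple_refine s (Q : set X) (v : V) : borel_simple s -> borel Q ->
  exists r, [/\ forall p, p \in r -> [/\ borel p.1, p.1 `<=` Q &
      forall t, p.1 t -> p.2 = v + simple_function s t],
    pairwise disjoint_pair r &
    m Q v + \sum_(p <- s) m (Q `&` p.1) p.2 = simple_integral m r].
Proof.
elim: s Q v => [|[A x] s IH] Q v bs bQ.
  exists [:: (Q, v)]; split => //.
    move=> p; rewrite inE => /eqP ->; split => // t _.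
    by rewrite /simple_function big_nil addr0.
  by rewrite /simple_integral big_nil addr0 big_seq1.
have [/= bA bs'] := (borel_simple_cons _ _).1 bs.
have bQA := borelI bQ bA; have bQD := borelD bQ bA.
have [r1 [r1P r1d r1E]] := IH (Q `&` A) (v + x) bs' bQA.
have [r2 [r2P r2d r2E]] := IH (Q `\` A) v bs' bQD.
exists (r1 ++ r2); split.
- move=> p; rewrite mem_cat => /orP[/r1P|/r2P] [bp pQ pE]; split => //.
  + by move=> t /pQ[].
  + move=> t pt; rewrite (pE _ pt) simple_function_cons /=.
    by rewrite indicE mem_set ?scale1r ?addrA//; case: (pQ _ pt).
  + by move=> t /pQ[].
  + move=> t pt; rewrite (pE _ pt) simple_function_cons /=.
    by rewrite indicE memNset ?scale0r ?add0r//; case: (pQ _ pt).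
- rewrite pairwise_cat r1d r2d !andbT; apply/allrelP => p q /r1P[_ p1 _] /r2P[_ q1 _].
  apply/asboolP; apply/seteqP; split=> // t [/p1[_ At] /q1[_ nAt]].
  exact: nAt.
- rewrite simple_integral_cat -r1E -r2E big_cons /= maddx//.
  rewrite (splitA v bQ bA).
  have -> : \sum_(p <- s) m (Q `&` p.1) p.2 = \sum_(p <- s) m (Q `&` A `&` p.1) p.2 +
      \sum_(p <- s) m ((Q `\` A) `&` p.1) p.2.
    rewrite -big_split/= !big_seq; apply: eq_bigr => p /bs' bp.
    rewrite (splitA p.2 (borelI bQ bp) bA) setIAC; congr (_ + m _ _).
    by rewrite setDE setIAC.
  by rewrite addrACA addrA addrACA !addrA.
Qed.

Let disjoint_bound r D (c : R) : borel D -> 0 <= c ->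
  (forall p, p \in r -> [/\ borel p.1, p.1 `<=` D & forall t, p.1 t -> nrm p.2 <= c]) ->
  pairwise disjoint_pair r -> nrm (simple_integral m r : F^o) <= c * W D.
Proof.
move=> bD c0 rP rd.
pose P (i : 'I_(size r)) := (nth (set0, 0) r i).1.
(* The bound on the values is known only at points of a piece; on an empty piece the value is reset
   to zero, which does not change the sum since [m set0] vanishes. *)
pose y (i : 'I_(size r)) : V := if pselect (P i !=set0) then (nth (set0, 0) r i).2 else 0.
have mem (i : 'I_(size r)) : nth (set0, 0) r i \in r by exact: mem_nth.
have -> : simple_integral m r = \sum_(i < size r) m (P i) (y i).
  rewrite /simple_integral (big_nth (set0, 0)) big_mkord; apply: eq_bigr => i _.
  rewrite /y; case: pselect => //= nP; have -> : P i = set0.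
    by apply: contrapT => /eqP/set0P.
  by rewrite -/(P i) (_ : P i = set0) ?bounded_additive0//; apply: contrapT => /eqP/set0P.
case: mW => _ _ _; apply => //.
- by move=> i; case: (rP _ (mem i)).
- apply/trivIsetP => i j _ _ ij.
  wlog lij : i j ij / (i < j)%N.
    move=> H; have := ij; rewrite -val_eqE neq_ltn => /orP[|] h; first exact: H.
    by rewrite setIC; apply: H => //; rewrite eq_sym.
  by have /(pairwiseP (set0, 0))/(_ i j (ltn_ord i) (ltn_ord j) lij)/asboolP := rd.
- by move=> i; case: (rP _ (mem i)).
- move=> i; rewrite /y; case: pselect => [[t Pt]|_]/=; last by rewrite nrm0.
  by case: (rP _ (mem i)) => _ _; apply; exact: Pt.
Qed.

(** Refining [s] inside [D] and off [D] reduces this to disjoint pieces. Applied to a difference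
    with [c = 0], the estimate also shows that the integral depends on the simple function and not
    on the list representing it. *)
Lemma simple_integral_bound s D (c : R) : borel_simple s -> borel D -> 0 <= c ->
  (forall t, D t -> nrm (simple_function s t) <= c) ->
  (forall t, ~ D t -> simple_function s t = 0) ->
  nrm (simple_integral m s : F^o) <= c * W D.
Proof.
move=> bs bD c0 sD sDc.
have [r1 [r1P r1d r1E]] := simple_refine (0 : V) bs bD.
have [r2 [r2P r2d r2E]] := simple_refine (0 : V) bs (borelC bD).
have r20 : simple_integral m r2 = 0.
  rewrite /simple_integral big_seq big1// => p /r2P[bp pD pE].
  have [[t pt]|/set0P/negP/negPn/eqP->] := pselect (p.1 !=set0); last exact: bounded_additive0.
  by rewrite (pE _ pt) add0r sDc ?bounded_additiver0//; exact: pD.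
have -> : simple_integral m s = simple_integral m r1.
  rewrite -[RHS]addr0 -r20 -r1E -r2E !bounded_additiver0// ?add0r; last exact: borelC.
  rewrite -big_split /= /simple_integral !big_seq; apply: eq_bigr => p /bs bp.
  by rewrite (splitA p.2 bp bD) setDE ![_ `&` p.1]setIC.
apply: disjoint_bound => // p /r1P[bp pD pE]; split => // t pt.
by rewrite (pE _ pt) add0r sD//; exact: pD.
Qed.

End Bound.
End SimpleIntegral.

Section Regulated.
Context {R : realType} {k : scalar_kind}.
Local Notation F := (scalars R k).
Context {X : topologicalType}.

Definition regulated {V : normedModType F} (f : X -> V) := forall e : R, 0 < e ->
  exists2 s, borel_simple s & forall t, nrm (f t - simple_function s t) <= e.

Section RegulatedModule.
Context {V : normedModType F}.
Implicit Types f g : X -> V.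

Lemma regulated_simple (s : seq (set X * V)) :
  borel_simple s -> regulated (simple_function s).
Proof. by move=> bs e e0; exists s => // t; rewrite subrr nrm0 ltW. Qed.

Lemma regulated_bounded f : regulated f -> exists c : R, forall t, nrm (f t) <= c.
Proof.
move=> /(_ 1 ltr01)[s _ fs]; exists (1 + \sum_(p <- s) nrm p.2) => t.
rewrite -[f t](subrK (simple_function s t)).
apply: le_trans (nrmD _ _) (lerD (fs t) _).
apply: le_trans (nrm_sum _ _ _) _; apply: ler_sum => p _.
rewrite nrmZ indicE; case: (t \in p.1) => /=.
  by rewrite -real_scalar1 nrm_real_scalar normr1 mul1r.
by rewrite nrm0 mul0r nrm_ge0.
Qed.

Lemma regulated_lin (c : F) f g : regulated f -> regulated g ->
  regulated (fun t => c *: f t + g t).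
Proof.
move=> rf rg e e0; have c1 : 0 < nrm (c : F^o) + 1 by rewrite ltr_wpDl// nrm_ge0.
have [s bs fs] := rf _ (divr_gt0 e0 (mulr_gt0 (ltr0Sn R 1) c1)).
have [s' bs' gs] := rg _ (divr_gt0 e0 (ltr0Sn R 1)).
exists (scale_simple c s ++ s').
  by apply: borel_simple_cat => //; exact: scale_simpleP.
move=> t; rewrite simple_function_cat simple_function_scale opprD addrACA -scalerBr.
apply: le_trans (nrmD _ _) _; rewrite (splitr e); apply: lerD => //.
rewrite nrmZ; apply: le_trans (ler_wpM2l (nrm_ge0 _) (fs t)) _.
have -> : nrm (c : F^o) * (e / (2 * (nrm (c : F^o) + 1))) =
    e / 2 * (nrm (c : F^o) / (nrm (c : F^o) + 1)) by field; rewrite gt_eqF.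
apply: ler_piMr; first by rewrite divr_ge0// ltW.
by rewrite ler_pdivrMr// mul1r lerDl.
Qed.

Lemma regulated_restrict (D : set X) f : borel D -> regulated f ->
  regulated (fun t => (\1_D t : F) *: f t).
Proof.
move=> bD rf e e0; have [s bs fs] := rf _ e0.
exists (restrict_simple D s); first exact: restrict_simpleP.
move=> t; rewrite simple_function_restrict -scalerBr nrmZ indicE.
case: (t \in D) => /=; last by rewrite nrm0 mul0r ltW.
by rewrite -real_scalar1 nrm_real_scalar normr1 mul1r.
Qed.

(** The approximating simple function takes at [t] the value attached to the first set of the list
    that contains [t]. *)
Lemma regulated_cover f :
  (forall e : R, 0 < e -> exists s : seq (set X * V), [/\ borel_simple s,
     forall p, p \in s -> forall t, p.1 t -> nrm (f t - p.2) <= e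
     & forall t, exists2 p, p \in s & p.1 t]) -> regulated f.
Proof.
move=> H e e0; have [s [bs sf sT]] := H _ e0.
suff [s' bs' [H1 H2]] : exists2 s', borel_simple s' & 
    (forall t, (exists2 p, p \in s & p.1 t) -> nrm (f t - simple_function s' t) <= e) /\
    (forall t, ~ (exists2 p, p \in s & p.1 t) -> simple_function s' t = 0).
  by exists s' => // t; exact: H1.
elim: s bs sf {sT} => [|[A y] s IH] bs sf.
  by exists [::] => //; split => t; [case|rewrite /simple_function big_nil].
have [/= bA bs1] := (borel_simple_cons _ _).1 bs.
have [|s' bs' [H1 H2]] := IH bs1 _.
  by move=> p ps; apply: sf; rewrite inE ps orbT.
exists ((A, y) :: restrict_simple (~` A) s').
  by apply/borel_simple_cons; split => //; apply: restrict_simpleP => //; exact: borelC.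
have sfE t : simple_function ((A, y) :: restrict_simple (~` A) s') t =
    if t \in A then y else simple_function s' t.
  rewrite simple_function_cons simple_function_restrict /= !indicE in_setC.
  by case: (t \in A); rewrite /= scale1r scale0r ?addr0 ?add0r.
split=> t; rewrite sfE.
- move=> [p]; rewrite inE; case: ifPn => [tA _ _|tA].
    by apply: (sf (A, y)); rewrite ?inE ?eqxx//; exact: set_mem.
  move=> /predU1P[->/= At|ps pt]; first by rewrite notin_setE in tA.
  by apply: H1; exists p.
- move=> nt; case: ifPn => tA; first last.
    apply: H2 => -[p ps pt]; apply: nt; exists p => //.
    by rewrite inE ps orbT.
  by exfalso; apply: nt; exists (A, y); rewrite ?inE ?eqxx//; exact: set_mem.
Qed.

End RegulatedModule.

Lemma regulated_real (g : X -> R) (c : R) : (forall a, borel [set t | g t < a]) ->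
  (forall t, `|g t| <= c) -> regulated (fun t => real_scalar (g t) : F^o).
Proof.
move=> bg gc; apply: regulated_cover => e e0.
have c0 t : 0 <= g t + c by rewrite -lerBlDr sub0r; have := gc t; rewrite ler_norml => /andP[].
(* Slices of width [e] counted from [-c]; since [g t + c] is at most [c + c], the index of the slice
   of [t] is at most the truncation of [(c + c) / e]. *)
exists [seq ([set t | g t < - c + i.+1%:R * e] `\` [set t | g t < - c + i%:R * e],
   real_scalar (- c + i%:R * e) : F^o) | i <- iota 0 (Num.truncn ((c + c) / e)).+1]; split.
- by move=> p /mapP[i _ ->]; exact: borelD.
- move=> p /mapP[i _ ->] t /= [h1 /negP]; rewrite -leNgt => h2.
  rewrite -real_scalarB nrm_real_scalar ger0_norm ?subr_ge0// lerBlDr addrC -addrA.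
  by apply: le_trans (ltW h1) _; rewrite -[i.+1]addn1 natrD mulrDl mul1r.
- move=> t; pose i := Num.truncn ((g t + c) / e).
  have /truncn_itv/andP[] : 0 <= (g t + c) / e by rewrite divr_ge0// ltW.
  rewrite -/i => h1 h2.
  exists ([set t | g t < - c + i.+1%:R * e] `\` [set t | g t < - c + i%:R * e],
   real_scalar (- c + i%:R * e) : F^o).
    apply: map_f; rewrite mem_iota/= add0n ltnS truncn_le_nat.
    apply: le_lt_trans (truncnS_gt _); rewrite ler_pM2r ?invr_gt0// lerD2r.
    exact: le_trans (ler_norm _) (gc t).
  split => /=; first by move: h2; rewrite ltr_pdivrMr// => h2; lra.
  by apply/negP; move: h1; rewrite -leNgt ler_pdivlMr// => h1; lra.
Qed.

Lemma regulated_scalar (f : X -> F) (c : R) :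
  (forall a, borel [set t | re_part (f t) < a]) ->
  (forall a, borel [set t | im_part (f t) < a]) ->
  (forall t, nrm (f t : F^o) <= c) -> regulated (f : X -> F^o).
Proof.
move=> bre bim fc.
have r1 : regulated (fun t => real_scalar (re_part (f t)) : F^o).
  by apply: (@regulated_real _ c) => // t; exact: le_trans (re_part_nrm _) (fc t).
have r2 : regulated (fun t => real_scalar (im_part (f t)) : F^o).
  by apply: (@regulated_real _ c) => // t; exact: le_trans (im_part_nrm _) (fc t).
have := regulated_lin scalar_i r2 r1.
by under [X in regulated X]funext do rewrite addrC -[_ *: _]/(_ * _) -scalarE.
Qed.

End Regulated.

Section RegulatedCompact.
Context {R : realType} {k : scalar_kind}.
Local Notation F := (scalars R k).
Context {X : ptopologicalType} {V : normedModType F}.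

Lemma continuous_nrm_open (f : X -> V) (y : V) (e : R) : continuous f ->
  open [set t | nrm (f t - y) < e].
Proof.
move=> cf; have -> : [set t | nrm (f t - y) < e] = f @^-1` (ball y (real_scalar e : F)).
  apply/seteqP; split=> t /=; rewrite -ball_normE /= distrC nrmE ltr_real_scalar//.
apply: open_comp; last exact: ball_open.
by move=> t _; exact: cf.
Qed.

Lemma continuous_regulated (f : X -> V) : compact [set: X] -> continuous f ->
  regulated f.
Proof.
move=> cX cf; apply: regulated_cover => e e0.
move: cX; rewrite compact_cover => /(_ _ setT (fun x => [set t | nrm (f t - f x) < e])).
case=> [x _||D _ DX]; first exact: continuous_nrm_open.
  by move=> x _; exists x => //=; rewrite subrr nrm0.
exists [seq ([set t | nrm (f t - f x) < e], f x) | x <- finmap.enum_fset D]; split.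
- by move=> p /mapP[x _ ->]; apply: borel_open; exact: continuous_nrm_open.
- by move=> p /mapP[x _ ->] t /= /ltW.
- move=> t; have [x /= xD xt] := DX t I.
  by exists ([set t | nrm (f t - f x) < e], f x) => //; exact: map_f.
Qed.

End RegulatedCompact.

Section Integral.
Context {R : realType} {k : scalar_kind}.
Local Notation F := (scalars R k).
Context {X : topologicalType} {V : normedModType F}.
Variables (m : set X -> V -> F) (W : set X -> R).
Hypothesis mW : bounded_additive m W.
Implicit Types f g : X -> V.

Lemma bounded_additive_ge0 D : borel D -> 0 <= W D.
Proof.
move=> bD; case: mW => _ _ _ /(_ D 0%N (fun=> set0) (fun=> 0) 1 bD).
rewrite big_ord0 mul1r (@nrm0 _ _ F^o); by apply => // -[].
Qed.

Lemma simple_integral_close s s' (e : R) : borel_simple s -> borel_simple s' -> 0 <= e ->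
  (forall t, nrm (simple_function s t - simple_function s' t) <= e) ->
  nrm (simple_integral m s - simple_integral m s' : F^o) <= e * W setT.
Proof.
move=> bs bs' e0 H.
have -> : simple_integral m s - simple_integral m s' =
    simple_integral m (s ++ scale_simple (-1) s').
  by rewrite simple_integral_cat (simple_integral_scale mW)// mulN1r.
apply: (simple_integral_bound mW) => //.
- by apply: borel_simple_cat => //; exact: scale_simpleP.
- exact: borelT.
- by move=> t _; rewrite simple_function_cat simple_function_scale scaleN1r.
- by move=> t /(_ I).
Qed.

Lemma simple_integral_close2 f s s' (e e' : R) : borel_simple s -> borel_simple s' ->
  (forall t, nrm (f t - simple_function s t) <= e) ->
  (forall t, nrm (f t - simple_function s' t) <= e') -> 0 <= e + e' ->
  nrm (simple_integral m s - simple_integral m s' : F^o) <= (e + e') * W setT.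
Proof.
move=> bs bs' H H' ee; apply: simple_integral_close => // t.
rewrite -[simple_function s t](addrNK (f t)) -addrA.
by apply: le_trans (nrmD _ _) _; rewrite nrmB lerD.
Qed.

(** A single simple approximation locates every possible value of the integral, with an explicit
    error; in particular the value is unique. *)
Lemma is_integral_close f l s (e : R) : is_integral m f l -> borel_simple s -> 0 <= e ->
  (forall t, nrm (f t - simple_function s t) <= e) ->
  nrm (l - simple_integral m s : F^o) <= e * W setT.
Proof.
move=> [u [bu fu ul]] bs e0 fs; apply/ler_addgt0Pr => a a0.
have W0 := bounded_additive_ge0 borelT.
have W1 : 0 < W setT + 1 by rewrite ltr_wpDl.
pose b := a / 2 / (W setT + 1).
have b0 : 0 < b by rewrite !divr_gt0.
have b0' : 0 < (real_scalar b : F) by rewrite -real_scalar0 ltr_real_scalar.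
have [n1 _ H1] := fu _ b0'.
have a2 : 0 < a / 2 by rewrite divr_gt0.
have [n2 H2] := (cvg_nrm _ _).1 ul _ a2.
pose n := maxn n1 n2.
have fun_ t : nrm (f t - simple_function (u n) t) <= b.
  by rewrite -ler_nrm; apply: (H1 n); rewrite /= leq_maxl.
have h2 := H2 n (leq_maxr _ _).
have h3 := simple_integral_close2 (bu n) bs fun_ fs (addr_ge0 (ltW b0) e0).
rewrite -[l](addrNK (simple_integral m (u n))) -addrA.
apply: le_trans (nrmD _ _) (le_trans (lerD h2 h3) _).
rewrite mulrDl addrA [leRHS]addrC lerD2r [leRHS](splitr a) lerD2l.
by rewrite /b mulrAC ler_pdivrMr// ler_pM2l// lerDl.
Qed.

Lemma is_integral_exists f : regulated f -> exists l, is_integral m f l.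
Proof.
move=> rf.
have /choice[u uE] : forall n : nat, exists s, borel_simple s /\
    forall t, nrm (f t - simple_function s t) <= n.+1%:R^-1.
  by move=> n; have [|s bs fs] := rf n.+1%:R^-1; [rewrite invr_gt0|exists s].
have W0 := bounded_additive_ge0 borelT.
pose v n := simple_integral m (u n).
have vc a b n : (n <= a)%N -> (n <= b)%N ->
    nrm (v a - v b : F^o) <= (n.+1%:R^-1 + n.+1%:R^-1) * W setT.
  move=> na nb; apply: (@simple_integral_close2 f) => //.
  - exact: (uE a).1.
  - exact: (uE b).1.
  - move=> t; apply: le_trans ((uE a).2 t) _.
    by rewrite lef_pV2 ?posrE// ler_nat ltnS.
  - move=> t; apply: le_trans ((uE b).2 t) _.
    by rewrite lef_pV2 ?posrE// ler_nat ltnS.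
have small (e : R) : 0 < e -> exists n : nat, (n.+1%:R^-1 + n.+1%:R^-1) * W setT < e.
  move=> e0; have W1 : 0 < W setT + 1 by rewrite ltr_wpDl.
  have e1 : 0 < e / 2 / (W setT + 1) by rewrite !divr_gt0.
  have [N _ /(_ N (leqnn N)) H] := near_infty_natSinv_lt (PosNum e1).
  exists N; apply: le_lt_trans (_ : _ <= (N.+1%:R^-1 + N.+1%:R^-1) * (W setT + 1)) _.
    by rewrite ler_wpM2l ?addr_ge0// lerDl.
  have e2 : e / (W setT + 1) = e / 2 / (W setT + 1) + e / 2 / (W setT + 1).
    by rewrite -mulrDl -splitr.
  by rewrite -ltr_pdivlMr// e2 ltrD.
(* Completeness is used in [R], for the real and the imaginary part separately. *)
have cauchy_real (g : F -> R) : (forall a b, `|g a - g b| <= nrm (a - b : F^o)) ->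
    exists l : R, (fun n => g (v n)) @ \oo --> l.
  move=> gL; suff : cvg ((fun n => g (v n)) @ \oo) by move=> /cvg_ex.
  apply/cauchy_cvgP/cauchy_exP => e /small[N Ne]; exists (g (v N)), N => // n /= Nn.
  by rewrite /ball_ /=; apply: le_lt_trans (gL _ _) (le_lt_trans (vc _ _ _ (leqnn N) Nn) Ne).
have [a ua] := cauchy_real re_part (fun a b => ltac:(by rewrite -re_partB; exact: re_part_nrm)).
have [b ub] := cauchy_real im_part (fun a b => ltac:(by rewrite -im_partB; exact: im_part_nrm)).
exists (scalar_mk a b), u; split.
- by move=> n p; exact: (uE n).1.
- move=> e e0; have e1 := ge0_real_scalar (ltW e0).
  have e2 : 0 < re_part e by rewrite -(@ltr_real_scalar R k) -e1 real_scalar0.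
  have [N _ H] := near_infty_natSinv_lt (PosNum e2).
  exists N => // n /= Nn t; rewrite e1 ler_nrm; apply: le_trans ((uE n).2 t) _.
  exact/ltW/(H n Nn).
- apply/cvg_nrm => e e0; have e2 : 0 < e / 2 by rewrite divr_gt0.
  have /cvgrPdist_le/(_ _ e2)[n1 _ H1] := ua.
  have /cvgrPdist_le/(_ _ e2)[n2 _ H2] := ub.
  exists (maxn n1 n2) => n; rewrite geq_max => /andP[/H1/= h1 /H2/= h2].
  apply: le_trans (nrm_le_parts _) _; rewrite (splitr e) re_partB im_partB re_part_mk.
  by rewrite lerD//; apply: le_trans (im_part_mk_dist _ _ _) h2.
Qed.

Lemma integral_vmP f : regulated f -> is_integral m f (integral_vm m f).
Proof.
move=> /is_integral_exists[l fl]; rewrite /integral_vm.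
by case: xgetP => [l' _ //|/(_ l)].
Qed.

Lemma integral_vm_close f s (e : R) : regulated f -> borel_simple s -> 0 <= e ->
  (forall t, nrm (f t - simple_function s t) <= e) ->
  nrm (integral_vm m f - simple_integral m s : F^o) <= e * W setT.
Proof. by move=> /integral_vmP; exact: is_integral_close. Qed.

(** An error [C * e] is as good as [e], which is arbitrary; this leaves the caller free to let [C]
    be the mass of another measure. *)
Lemma integral_vm_eq f l (C : R) :
  (forall e : R, 0 < e -> exists s, [/\ borel_simple s,
    forall t, nrm (f t - simple_function s t) <= e &
    nrm (l - simple_integral m s : F^o) <= C * e]) ->
  integral_vm m f = l.
Proof.
move=> H; have rf : regulated f by move=> e /H[s [bs fs _]]; exists s.
apply: subr0_eq; apply: (@nrm_le0 _ _ F^o); apply/ler_addgt0Pr => a a0; rewrite add0r.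
have W0 := bounded_additive_ge0 borelT.
have C1 : 0 < W setT + `|C| + 1 by rewrite ltr_wpDl// addr_ge0.
have b0 : 0 < a / (W setT + `|C| + 1) by rewrite divr_gt0.
have [s [bs fs ls]] := H _ b0.
have h := integral_vm_close rf bs (ltW b0) fs.
rewrite -[integral_vm m f](addrNK (simple_integral m s)) -addrA.
apply: le_trans (nrmD _ _) _; rewrite [X in _ + X]nrmB.
apply: le_trans (lerD h ls) _.
rewrite [C * _]mulrC -mulrDr -mulrA ler_piMr//; first exact: ltW.
by rewrite mulrC ler_pdivrMr// mul1r -addrA lerD2l ler_wpDr// ler_norm.
Qed.

Lemma integral_vm_simple s : borel_simple s ->
  integral_vm m (simple_function s) = simple_integral m s.
Proof.
move=> bs; apply: (@integral_vm_eq _ _ 0) => e e0; exists s; split => //.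
  by move=> t; rewrite subrr nrm0 ltW.
by rewrite subrr nrm0 mul0r.
Qed.

Lemma integral_vm_lin (c : F) f g : regulated f -> regulated g ->
  integral_vm m (fun t => c *: f t + g t) = c * integral_vm m f + integral_vm m g.
Proof.
move=> rf rg.
have c1 : 0 < nrm (c : F^o) + 1 by rewrite ltr_wpDl// nrm_ge0.
apply: (@integral_vm_eq _ _ (W setT)) => e e0.
have e1 : 0 < e / (nrm (c : F^o) + 1) by rewrite divr_gt0.
have [s bs fs] := rf _ e1; have [s' bs' gs] := rg _ e1.
have ec x y : x <= e / (nrm (c : F^o) + 1) -> y <= e / (nrm (c : F^o) + 1) ->
    nrm (c : F^o) * x + y <= e.
  move=> xe ye; apply: le_trans (lerD (ler_wpM2l (nrm_ge0 _) xe) ye) _.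
  by rewrite -{2}[e / _]mul1r -mulrDl mulrCA divff ?mulr1// gt_eqF.
exists (scale_simple c s ++ s'); split.
- by apply: borel_simple_cat => //; exact: scale_simpleP.
- move=> t; rewrite simple_function_cat simple_function_scale opprD addrACA -scalerBr.
  by apply: le_trans (nrmD _ _) _; rewrite nrmZ; exact: ec.
- rewrite simple_integral_cat (simple_integral_scale mW)// opprD addrACA -mulrBr.
  apply: le_trans (@nrmD _ _ F^o _ _) _; rewrite nrmM.
  have h1 := integral_vm_close rf bs (ltW e1) fs.
  have h2 := integral_vm_close rg bs' (ltW e1) gs.
  apply: le_trans (lerD (ler_wpM2l (nrm_ge0 _) h1) h2) _.
  by rewrite mulrA -mulrDl [leRHS]mulrC; apply: ler_wpM2r; [exact: bounded_additive_ge0 borelT|exact: ec].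
Qed.

(** Cutting the simple approximations off outside [D] does not worsen the error and makes [W D],
    rather than [W setT], the main term. *)
Lemma integral_vm_bound f D (c : R) : regulated f -> borel D -> 0 <= c ->
  (forall t, D t -> nrm (f t) <= c) -> (forall t, ~ D t -> f t = 0) ->
  nrm (integral_vm m f : F^o) <= c * W D.
Proof.
move=> rf bD c0 fD fDc; apply/ler_addgt0Pr => a a0.
have WT0 := bounded_additive_ge0 borelT; have W0 := bounded_additive_ge0 bD.
have C1 : 0 < W setT + W D + 1 by rewrite ltr_wpDl// addr_ge0.
pose e := a / (W setT + W D + 1).
have e0 : 0 < e by rewrite divr_gt0.
have [s bs fs] := rf _ e0.
have fE t : f t = (\1_D t : F) *: f t.
  rewrite indicE; have [tD|] := boolP (t \in D); first by rewrite scale1r.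
  by rewrite notin_setE => /fDc ->; rewrite scaler0.
have fs' t : nrm (f t - simple_function (restrict_simple D s) t) <= e.
  rewrite simple_function_restrict {1}fE -scalerBr nrmZ indicE.
  case: (t \in D) => /=; last by rewrite nrm0 mul0r ltW.
  by rewrite -real_scalar1 nrm_real_scalar normr1 mul1r.
have h1 := integral_vm_close rf (restrict_simpleP bD bs) (ltW e0) fs'.
have h2 : nrm (simple_integral m (restrict_simple D s) : F^o) <= (c + e) * W D.
  apply: (simple_integral_bound mW) => //.
  - exact: restrict_simpleP.
  - by rewrite addr_ge0// ltW.
  - move=> t Dt; rewrite -[simple_function _ t](subrK (f t)) addrC.
    by apply: le_trans (nrmD _ _) _; rewrite lerD ?fD// nrmB.
  - by move=> t nDt; rewrite simple_function_restrict indicE memNset// scale0r.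
rewrite -[integral_vm m f](addrNK (simple_integral m (restrict_simple D s))).
apply: le_trans (nrmD _ _) (le_trans (lerD h1 h2) _).
rewrite mulrDl addrCA lerD2l -mulrDr /e mulrAC ler_pdivrMr// ler_pM2l//.
by rewrite lerDl.
Qed.

End Integral.

(** * Variation and projection of measures *)

Lemma cvge0P (R : realType) (u : nat -> \bar R) : (forall n, (0 <= u n)%E) ->
  u @ \oo --> 0%E <->
  (forall e : R, 0 < e -> exists n0, forall n, (n0 <= n)%N -> (u n <= e%:E)%E).
Proof.
move=> u0; split=> [/fine_cvgP[[n1 _ H1] H2] e e0|H].
  have /cvgrPdist_le/(_ _ e0)[n2 _ {}H2] := H2.
  exists (maxn n1 n2) => n; rewrite geq_max => /andP[/H1/= un /H2/=].
  by rewrite sub0r normrN => h; rewrite -(fineK un) lee_fin; exact: le_trans (ler_norm _) h.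
apply/fine_cvgP; split.
  have [n0 H0] := H 1 ltr01; exists n0 => // n /= /H0 h.
  by rewrite ge0_fin_numE//; exact: le_lt_trans h (ltry _).
apply/cvgrPdist_le => e e0; have [n0 H0] := H _ e0; exists n0 => // n /= /H0 h.
rewrite sub0r normrN ger0_norm ?fine_ge0//.
by rewrite -lee_fin fineK// ge0_fin_numE//; exact: le_lt_trans h (ltry _).
Qed.

Section Variation.
Context {R : realType} {X : topologicalType} {U : zmodType}.
Variables (N : U -> \bar R) (m : set X -> U).
Implicit Types A B : set X.

Lemma variation_ge_family A n (P : 'I_n -> set X) :
  (forall i, borel (P i)) -> trivIset setT P -> (forall i, P i `<=` A) ->
  (\sum_(i < n) N (m (P i)) <= Defs.variation N m A)%E.
Proof. by move=> bP tP PA; apply: ereal_sup_ubound; exists n, P. Qed.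

Lemma variation_ge0 A : (0 <= Defs.variation N m A)%E.
Proof.
have -> : (0 = \sum_(i < 0) N (m ((fun=> set0) i)))%E by rewrite big_ord0.
by apply: variation_ge_family => -[].
Qed.

Lemma variation_mono A B : A `<=` B -> (Defs.variation N m A <= Defs.variation N m B)%E.
Proof.
move=> AB; apply: ge_ereal_sup => _ [n [P [bP tP PA ->]]].
by apply: variation_ge_family => // i; exact: subset_trans (PA i) AB.
Qed.

Lemma variation_ge A : borel A -> (N (m A) <= Defs.variation N m A)%E.
Proof.
move=> bA; have := @variation_ge_family A 1 (fun=> A) (fun=> bA).
rewrite big_ord1; apply; last by move=> _.
by apply/trivIsetP => i j _ _; rewrite !ord1 eqxx.
Qed.

Hypothesis N_ge0 : forall u, (0 <= N u)%E.
Hypothesis m_fin : (Defs.variation N m setT < +oo)%E.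

Lemma variation_fin A : Defs.variation N m A \is a fin_num.
Proof.
rewrite ge0_fin_numE ?variation_ge0//; apply: le_lt_trans m_fin.
exact: variation_mono.
Qed.

Lemma variation_superadditive A B : A `&` B = set0 ->
  (Defs.variation N m A + Defs.variation N m B <= Defs.variation N m (A `|` B))%E.
Proof.
move=> AB; rewrite -leeBrDr ?variation_fin//.
apply: ge_ereal_sup => _ [n [P [bP tP PA ->]]].
rewrite leeBrDr ?variation_fin// addeC -leeBrDr; last first.
  rewrite ge0_fin_numE ?sume_ge0//.
  by apply: le_lt_trans (variation_ge_family bP tP (fun i => subsetT _)) m_fin.
apply: ge_ereal_sup => _ [n' [Q [bQ tQ QB ->]]].
rewrite leeBrDr; last first.
  rewrite ge0_fin_numE ?sume_ge0//.
  by apply: le_lt_trans (variation_ge_family bP tP (fun i => subsetT _)) m_fin.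
pose S (i : 'I_(n + n')) := match fintype.split i with inl j => P j | inr j => Q j end.
have -> : (\sum_(i < n') N (m (Q i)) + \sum_(i < n) N (m (P i)) =
    \sum_(i < n + n') N (m (S i)))%E.
  rewrite big_split_ord /= addeC; congr (_ + _)%E; apply: eq_bigr => i _.
    by rewrite /S (unsplitK (inl i)).
  by rewrite /S (unsplitK (inr i)).
apply: variation_ge_family.
- by move=> i; rewrite /S; case: fintype.split.
- move=> i j _ _; rewrite /S => h; apply: (can_inj (@splitK n n')); move: h.
  case: (fintype.split i) => a; case: (fintype.split j) => b.
  + by move=> /tP ->.
  + by move=> [t [/PA At /QB Bt]]; exfalso; have : (A `&` B) t by []; rewrite AB.
  + by move=> [t [/QB Bt /PA At]]; exfalso; have : (A `&` B) t by []; rewrite AB.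
  + by move=> /tQ ->.
- move=> i; rewrite /S; case: fintype.split => j t; first by move=> /PA; left.
  by move=> /QB; right.
Qed.

Lemma variation_superadditive_sum (G : (set X)^nat) n : trivIset setT G ->
  (\sum_(i < n) Defs.variation N m (G i) <= Defs.variation N m (\bigcup_i G i))%E.
Proof.
move=> tG; apply: (@le_trans _ _ (Defs.variation N m (\big[setU/set0]_(i < n) G i))); last first.
  by apply: variation_mono; rewrite -bigcup_mkord => t [i _ Gi]; exists i.
elim: n => [|n IH]; first by rewrite [X in (X <= _)%E]big_ord0; exact: variation_ge0.
rewrite !big_ord_recr /=; apply: le_trans (leeD IH (le_refl _)) _.
apply: variation_superadditive; apply/seteqP; split=> // t [].
rewrite -bigcup_mkord => -[i /= iN Gi] Gn.
by have := tG i n I I (ex_intro _ t (conj Gi Gn)) => E; rewrite E ltnn in iN.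
Qed.

End Variation.

Section ScalarMeasure.
Context {R : realType} {k : scalar_kind}.
Local Notation F := (scalars R k).
Context {X : topologicalType}.
Variable nu : set X -> F.
Hypothesis nu_ca : countably_additive abs nu.

Lemma countably_additiveP (B : (set X)^nat) : (forall n, borel (B n)) -> trivIset setT B ->
  forall e : R, 0 < e -> exists n0, forall n, (n0 <= n)%N ->
    nrm (nu (\bigcup_n B n) - \sum_(0 <= i < n) nu (B i) : F^o) <= e.
Proof.
move=> bB tB e e0; have := nu_ca bB tB.
rewrite cvge0P => [/(_ _ e0)[n0 H]|n]; first by exists n0 => n /H; rewrite lee_fin.
by rewrite abs_nrm lee_fin nrm_ge0.
Qed.

(** For the constant sequence of empty sets, consecutive partial sums differ by [nu set0], and both
    are close to the value on the union. *)
Lemma scalar_measure0 : nu set0 = 0.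
Proof.
have /countably_additiveP H : forall n : nat, borel (@set0 X) by move=> _; exact: borel0.
have t0 : trivIset setT (fun _ : nat => @set0 X) by move=> i j _ _ [t []].
apply: (@nrm_le0 _ _ F^o); apply/ler_addgt0Pr => e e0; rewrite add0r.
have e2 : 0 < e / 2 by rewrite divr_gt0.
have [n0 H0] := H t0 _ e2.
have h1 := H0 n0 (leqnn _); have h2 := H0 n0.+1 (leqnSn _).
rewrite big_nat_recr//= in h2.
set c := nu (\bigcup_n _) in h1 h2; set s := \sum_(0 <= i < n0) _ in h1 h2.
have -> : nu set0 = (c - s) - (c - (s + nu set0)).
  by ring.
rewrite (splitr e); apply: le_trans (@nrmD _ _ F^o _ _) _.
by rewrite nrmN; exact: lerD.
Qed.

Lemma scalar_measureU (A B : set X) : borel A -> borel B -> A `&` B = set0 ->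
  nu (A `|` B) = nu A + nu B.
Proof.
move=> bA bB AB.
have b2 n : borel (bigcup2 A B n) by case: n => [|[|n]] //=; exact: borel0.
have t2 : trivIset setT (bigcup2 A B).
  apply/trivIsetP => -[|[|i]] [|[|j]] //= _ _ _; rewrite ?AB ?setI0 ?set0I//.
  by rewrite setIC.
apply: subr0_eq; apply: (@nrm_le0 _ _ F^o); apply/ler_addgt0Pr => e e0; rewrite add0r.
have [n0 H0] := countably_additiveP b2 t2 e0.
have := H0 n0.+2 (leqW (leqW (leqnn _))).
rewrite bigcup2E big_nat_recl// big_nat_recl//= big1 ?addr0// => i _.
exact: scalar_measure0.
Qed.

Lemma scalar_measure_le_series (P : set X) (B : (set X)^nat) : borel P ->
  (forall n, borel (B n)) -> trivIset setT B -> P `<=` \bigcup_n B n ->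
  (abs (nu P) <= \sum_(i <oo) abs (nu (P `&` B i)))%E.
Proof.
move=> bP bB tB PB.
have b2 n : borel (P `&` B n) by exact: borelI.
have t2 : trivIset setT (fun n => P `&` B n) by exact: trivIset_setIl.
have PE : P = \bigcup_n (P `&` B n) by rewrite -setI_bigcupr setIidl.
apply/lee_addgt0Pr => e e0.
have [n0 /(_ n0 (leqnn _)) H0] := countably_additiveP b2 t2 e0.
rewrite -PE in H0.
apply: (@le_trans _ _ (\sum_(0 <= i < n0) abs (nu (P `&` B i)) + e%:E)%E); last first.
  apply: leeD => //; apply: nneseries_lim_ge => i _.
  by rewrite abs_nrm lee_fin nrm_ge0.
rewrite (eq_bigr (fun i => (nrm (nu (P `&` B i) : F^o))%:E))//.
rewrite sumEFin -EFinD abs_nrm lee_fin.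
rewrite -[nu P](subrK (\sum_(0 <= i < n0) nu (P `&` B i))).
apply: le_trans (@nrmD _ _ F^o _ _) _; rewrite addrC lerD//.
exact: (@nrm_sum _ _ F^o).
Qed.

Hypothesis nu_fin : (Defs.variation abs nu setT < +oo)%E.

Let abs_ge0 (c : F) : (0 <= abs c)%E.
Proof. by rewrite abs_nrm lee_fin nrm_ge0. Qed.

(** One inequality is superadditivity over finitely many sets. For the other, each member of a
    disjoint family is cut along the [B i] and the two sums are interchanged. *)
Lemma variation_sigma_additive (B : (set X)^nat) : (forall n, borel (B n)) ->
  trivIset setT B ->
  (Defs.variation abs nu (\bigcup_n B n) = \sum_(i <oo) Defs.variation abs nu (B i))%E.
Proof.
move=> bB tB; apply/eqP; rewrite eq_le; apply/andP; split; last first.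
  apply: lime_le; first by apply: is_cvg_nneseries => n _ _; exact: variation_ge0.
  by apply: nearW => n; rewrite big_mkord; exact: variation_superadditive_sum.
apply: ge_ereal_sup => _ [n [P [bP tP PB ->]]].
apply: (@le_trans _ _ (\sum_(j < n) \sum_(i <oo) abs (nu (P j `&` B i)))%E).
  by apply: lee_sum => j _; exact: scalar_measure_le_series.
rewrite -nneseries_sum//.
apply: lee_nneseries => [i _|i _]; first by rewrite sume_ge0.
apply: variation_ge_family => [j||j].
- exact: borelI.
- exact: trivIset_setIr.
- exact: subIsetr.
Qed.

Lemma scalar_bounded_additive :
  bounded_additive (fun A (c : F^o) => nu A * c) (fun D => fine (Defs.variation abs nu D)).
Proof.
split.
- by move=> A x y _; rewrite mulrDr.
- by move=> A c x _; rewrite mulrCA.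
- by move=> A B x bA bB AB; rewrite scalar_measureU// mulrDl.
- move=> D n P y c bD bP tP PD c0 yc.
  apply: le_trans (@nrm_sum _ _ F^o _ _ _ _) _.
  apply: (@le_trans _ _ (\sum_(i < n) c * nrm (nu (P i) : F^o))).
    by apply: ler_sum => i _; rewrite nrmM mulrC ler_wpM2r ?nrm_ge0.
  have vf := variation_fin nu_fin D.
  rewrite -mulr_sumr ler_wpM2l// -lee_fin fineK// -sumEFin.
  exact: variation_ge_family.
Qed.

End ScalarMeasure.

Lemma borel_preimage (X Y : topologicalType) (f : X -> Y) (B : set Y) :
  continuous f -> borel B -> borel (f @^-1` B).
Proof.
move=> cf; have : @borel Y `<=` [set B | borel (f @^-1` B)]; last exact.
apply: smallest_sub; last first.
  by move=> U oU; apply: borel_open; apply: open_comp => // t _; exact: cf.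
split.
- by rewrite /= preimage_set0; exact: borel0.
- by move=> A /= bA; rewrite setTD preimage_setC; exact: borelC.
- by move=> A bA /=; rewrite preimage_bigcup; exact: borel_bigcup.
Qed.

Section Projection.
Context {R : realType} {k : scalar_kind}.
Local Notation F := (scalars R k).
Context {K : ptopologicalType} {L : topologicalType}.
Variable nu : set (K * L) -> F.

(** Convertible to [pi1_variation nu]; the proof is an argument so that the measure structure can be
    inferred from the term. *)
Definition pi1_measure (_ : scalar_measure nu) : set (borelType K) -> \bar R :=
  pi1_variation nu.

Lemma borel_cylinder (A : set K) : borel A -> borel (fst @^-1` A : set (K * L)).
Proof. by apply: borel_preimage => t; exact: cvg_fst. Qed.

Section Measure.
Variable nuM : scalar_measure nu.

Let sigma0 : pi1_measure nuM set0 = 0%E.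
Proof.
have [nuC nuF _] := nuM; rewrite /pi1_measure /pi1_variation preimage_set0.
apply/eqP; rewrite eq_le variation_ge0 andbT; apply: ge_ereal_sup => _ [n [P [_ _ P0 ->]]].
rewrite big1// => i _; have -> : P i = set0 by rewrite -subset0; exact: P0.
by rewrite scalar_measure0// abs_nrm nrm0.
Qed.

Let sigma_ge0 A : (0 <= pi1_measure nuM A)%E.
Proof. exact: variation_ge0. Qed.

Let sigma_additive : semi_sigma_additive (pi1_measure nuM).
Proof.
have [nuC nuF _] := nuM; move=> A mA tA mUA.
rewrite /pi1_measure /pi1_variation preimage_bigcup variation_sigma_additive//.
- apply: is_cvg_nneseries => n _ _; exact: variation_ge0.
- by move=> n; exact: (borel_cylinder (mA n)).
- by apply/trivIsetP => i j _ _ ij; rewrite -preimage_setI; move/trivIsetP: tA => ->.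
Qed.

HB.instance Definition _ := isMeasure.Build _ (borelType K) R (pi1_measure nuM)
  sigma0 sigma_ge0 sigma_additive.

Let sigma_fin : fin_num_fun (pi1_measure nuM).
Proof. by move=> A _; have [_ nuF _] := nuM; exact: variation_fin. Qed.

HB.instance Definition _ := @Measure_isFinite.Build _ (borelType K) R (pi1_measure nuM)
  sigma_fin.

End Measure.

(** Inside the cylinder over [A] regularity of [nu] gives a compact set; its projection is compact
    and the cylinder over the projection is larger still. The open set is the complement of the
    compact set found in this way for the complement of [A]. *)
Lemma pi1_regular (nuM : scalar_measure nu) (A : set K) (e : R) : hausdorff_space K ->
  borel A -> 0 < e -> exists C U : set K, [/\ compact C, open U, C `<=` A, A `<=` U
    & (pi1_measure nuM (U `\` C) <= e%:E)%E].
Proof.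
move=> hK bA e0; have [nuC nuF nuR] := nuM.
have inner (B : set K) : borel B -> exists C, [/\ compact C, C `<=` B &
    (pi1_measure nuM (B `\` C) <= (e / 2)%:E)%E].
  move=> bB; have [|C [U [cC _ CB BU UC]]] := nuR _ (borel_cylinder bB) (e / 2).
    by rewrite divr_gt0.
  exists (fst @` C); split.
  - apply: continuous_compact => //; apply: continuous_subspaceT => t; exact: cvg_fst.
  - by move=> _ [p Cp <-]; exact: CB.
  - apply: le_trans (ltW UC); apply: variation_mono => p [/BU Up nC]; split => // Cp.
    by apply: nC; exists p.
have [C [cC CA AC]] := inner A bA.
have [D [cD DA AD]] := inner (~` A) (borelC bA).
exists C, (~` D); split => //.
- by apply: closed_openC; exact: compact_closed.
- by move=> t At /DA.
- have -> : ~` D `\` C = (A `\` C) `|` (~` A `\` D).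
    apply/seteqP; split=> t.
      by move=> [nD nC]; have [At|At] := pselect (A t); [left|right].
    by move=> [[At nC]|[nA nD]]; split => //; [move=> /DA|move=> /CA].
  rewrite measureU.
  + by rewrite [e in X in (_ <= X)%E]splitr EFinD; exact: leeD.
  + by apply: borelD => //; apply: borel_closed; exact: compact_closed.
  + by apply: borelD; [exact: borelC|apply: borel_closed; exact: compact_closed].
  + by apply/seteqP; split=> // t [[At _] [nA _]]; exact: nA.
Qed.

End Projection.

(** * Functionals in the dual ball *)

Section DualBall.
Context {R : realType} {k : scalar_kind}.
Local Notation F := (scalars R k).
Context {E : normedModType F}.

Lemma dual_norm_ge0 (phi : E -> F) : (0 <= dual_norm phi)%E.
Proof.
apply: (@le_trans _ _ (abs (phi 0))); first by rewrite abs_nrm lee_fin nrm_ge0.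
by apply: ereal_sup_ubound; exists 0 => //=; rewrite normr0.
Qed.

Lemma dual_norm_le (phi : E -> F) (c : R) : 0 <= c ->
  (forall x, nrm (phi x : F^o) <= c * nrm x) -> (dual_norm phi <= c%:E)%E.
Proof.
move=> c0 H; apply: ge_ereal_sup => _ [x x1 <-]; rewrite abs_nrm lee_fin.
apply: le_trans (H x) _; rewrite ler_piMr//.
by have := x1 : (`|x| <= 1); rewrite nrmE -real_scalar1 ler_real_scalar.
Qed.

(** The dual norm may be infinite, hence the extended real form; at [x = 0] it relies on
    [0 * +oo = 0]. *)
Lemma linear_nrm_le (phi : E -> F) x : linear (phi : E -> F^o) ->
  ((nrm (phi x : F^o))%:E <= (nrm x)%:E * dual_norm phi)%E.
Proof.
move=> lphi; have phiZ (c : F) y : phi (c *: y) = c * phi y.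
  have phi0 : phi 0 = 0.
    by have := lphi 1 0 0; rewrite scaler0 addr0 scale1r => /eqP; rewrite -subr_eq subrr eq_sym => /eqP.
  by have := lphi c y 0; rewrite addr0 phi0 addr0.
have [->|x0] := eqVneq x 0.
  have -> : phi 0 = 0 by have := phiZ 0 0; rewrite scale0r mul0r.
  by rewrite nrm0 (@nrm0 _ _ F^o) mul0e.
have nx : 0 < nrm x.
  by rewrite lt_neqAle nrm_ge0 andbT eq_sym; apply: contra_neq x0 => h; apply: nrm_le0; rewrite h.
have := ereal_sup_ubound (S := [set abs (phi x) | x in [set x | `|x| <= 1]])
  (x := abs (phi (real_scalar (nrm x)^-1 *: x))).
move=> /(_ _)/wrap[].
  exists (real_scalar (nrm x)^-1 *: x) => //=.
  rewrite nrmE nrmZ nrm_real_scalar ger0_norm ?invr_ge0 ?nrm_ge0//.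
  by rewrite mulVf ?gt_eqF// -real_scalar1.
rewrite -/(dual_norm _) abs_nrm phiZ nrmM nrm_real_scalar ger0_norm ?invr_ge0 ?nrm_ge0//.
move=> h; have := lee_wpmul2l (_ : 0 <= (nrm x)%:E)%E h.
rewrite -EFinM mulrA mulfV ?gt_eqF// mul1r; apply.
by rewrite lee_fin nrm_ge0.
Qed.

Lemma ball_fun_linear (phi : dual_ball E) : linear (ball_fun phi : E -> F^o).
Proof. by have [[]] := set_mem (valP phi). Qed.

Lemma ball_funD (phi : dual_ball E) x y : ball_fun phi (x + y) = ball_fun phi x + ball_fun phi y.
Proof. by have := ball_fun_linear phi 1 x y; rewrite !scale1r. Qed.

Lemma ball_fun0 (phi : dual_ball E) : ball_fun phi 0 = 0.
Proof.
have := ball_funD phi 0 0; rewrite addr0 => /eqP.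
by rewrite -subr_eq subrr eq_sym => /eqP.
Qed.

Lemma ball_funZ (phi : dual_ball E) (c : F) x : ball_fun phi (c *: x) = c * ball_fun phi x.
Proof. by have := ball_fun_linear phi c x 0; rewrite !addr0 ball_fun0 addr0. Qed.

Lemma ball_funB (phi : dual_ball E) x y : ball_fun phi (x - y) = ball_fun phi x - ball_fun phi y.
Proof. by rewrite -scaleN1r ball_funD ball_funZ mulN1r. Qed.

Lemma ball_fun_le (phi : dual_ball E) x : nrm (ball_fun phi x : F^o) <= nrm x.
Proof.
have := linear_nrm_le x (ball_fun_linear phi).
rewrite -lee_fin => /le_trans; apply; rewrite -[leRHS]mule1.
apply: lee_wpmul2l; first by rewrite lee_fin nrm_ge0.
by have [] := set_mem (valP phi).
Qed.

Lemma dual_space_bounded (phi : E -> F) (c : R) : linear (phi : E -> F^o) ->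
  (forall x, nrm (phi x : F^o) <= c * nrm x) -> dual_space phi.
Proof.
move=> lphi H; split => // x; apply/cvgrPdist_le => e e0.
have phiB y z : phi (y - z) = phi y - phi z.
  by have := lphi (-1) z y; rewrite !scaleN1r ![- _ + _]addrC.
have d0 : (0 : F) < e / real_scalar (`|c| + 1).
  by rewrite divr_gt0// -real_scalar0 ltr_real_scalar ltr_wpDl.
near=> y; rewrite -phiB nrmE.
have : `|x - y| <= e / real_scalar (`|c| + 1).
  near: y; exact: cvgr_dist_le.
rewrite ler_pdivlMr -?real_scalar0 ?ltr_real_scalar ?ltr_wpDl// nrmE -real_scalarM.
apply: le_trans; rewrite ler_real_scalar; apply: le_trans (H _) _.
rewrite mulrC ler_wpM2l ?nrm_ge0//; apply: le_trans (ler_norm _) _.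
by rewrite lerDl.
Unshelve. all: by end_near. Qed.

Lemma dual_ball_bounded (phi : E -> F) : linear (phi : E -> F^o) ->
  (forall x, nrm (phi x : F^o) <= nrm x) -> exists b : dual_ball E, ball_fun b = phi.
Proof.
move=> lphi H; have H1 : dual_ball_set phi.
  split; first by apply: (dual_space_bounded (c := 1)) => // x; rewrite mul1r.
  by apply: dual_norm_le => // x; rewrite mul1r.
by exists (SigSub (mem_set H1)).
Qed.

Lemma continuous_ball_fun x : continuous (fun phi : dual_ball E => ball_fun phi x : F^o).
Proof.
move=> phi; apply: (@continuous_comp _ _ _ (set_val : dual_ball E -> {ptws E -> F})
  (fun f : {ptws E -> F} => f x)).
  exact: initial_continuous.
exact: (@proj_continuous E (fun=> F^o) x).
Qed.

(** Joint continuity rests on the norm bound: functionals in the ball are 1-Lipschitz, so replacing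
    [f t] by [f s] costs at most their distance, uniformly in the functional. *)
Lemma continuous_evalT (K : topologicalType) (f : K -> E) : continuous f ->
  continuous (evalT f : K * dual_ball E -> F^o).
Proof.
move=> cf [t phi]; apply/cvgrPdist_le => e e0.
have e2 : 0 < e / 2 by rewrite divr_gt0.
have H1 : \forall s \near t, `|f t - f s| <= e / 2.
  by have := cf t => /cvgrPdist_le/(_ _ e2).
have H2 : \forall psi \near phi, `|(ball_fun phi (f t) : F^o) - ball_fun psi (f t)| <= e / 2.
  by have := @continuous_ball_fun (f t) phi => /cvgrPdist_le/(_ _ e2).
have : \forall p \near (t, phi), `|f t - f p.1| <= e / 2 /\
    `|(ball_fun phi (f t) : F^o) - ball_fun p.2 (f t)| <= e / 2.
  by exists ([set s | `|f t - f s| <= e / 2],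
    [set psi | `|(ball_fun phi (f t) : F^o) - ball_fun psi (f t)| <= e / 2]).
apply: filterS => -[s psi] /= [h1 h2]; rewrite /evalT /=.
have -> : (ball_fun phi (f t) : F^o) - ball_fun psi (f s) =
   (ball_fun phi (f t) - ball_fun psi (f t)) + ball_fun psi (f t - f s).
  by rewrite ball_funB addrA subrK.
rewrite (splitr e); apply: le_trans (ler_normD _ _) (lerD h2 _).
apply: le_trans h1; rewrite (nrmE (_ : F^o)) nrmE ler_real_scalar; exact: ball_fun_le.
Qed.

End DualBall.

Section ContinuousScalar.
Context {R : realType} {k : scalar_kind}.
Local Notation F := (scalars R k).
Context {X : topologicalType}.

Lemma re_part_continuous (f : X -> F) : continuous (f : X -> F^o) ->
  continuous (fun t => re_part (f t)).
Proof.
move=> cf t; apply/cvgrPdist_le => e e0.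
have := cf t => /cvgrPdist_le/(_ (real_scalar e)).
rewrite -real_scalar0 ltr_real_scalar => /(_ e0); apply: filterS => s.
rewrite nrmE ler_real_scalar; apply: le_trans.
by rewrite -re_partB; exact: re_part_nrm.
Qed.

Lemma im_part_continuous (f : X -> F) : continuous (f : X -> F^o) ->
  continuous (fun t => im_part (f t)).
Proof.
move=> cf t; apply/cvgrPdist_le => e e0.
have := cf t => /cvgrPdist_le/(_ (real_scalar e)).
rewrite -real_scalar0 ltr_real_scalar => /(_ e0); apply: filterS => s.
rewrite nrmE ler_real_scalar; apply: le_trans.
by rewrite -im_partB; exact: im_part_nrm.
Qed.

Lemma continuous_lt_borel (g : X -> R) (a : R) : continuous g -> borel [set t | g t < a].
Proof.
move=> cg; apply: borel_open; have -> : [set t | g t < a] = g @^-1` [set x | x < a] by [].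
by apply: open_comp; [move=> t _; exact: cg|exact: open_lt].
Qed.

Lemma continuous_scalar_regulated (f : X -> F) (c : R) : continuous (f : X -> F^o) ->
  (forall t, nrm (f t : F^o) <= c) -> regulated (f : X -> F^o).
Proof.
move=> cf fc; apply: regulated_scalar fc => a; apply: continuous_lt_borel.
  exact: re_part_continuous.
exact: im_part_continuous.
Qed.

End ContinuousScalar.

(** * The adjoint measure *)

Section DualMeasure.
Context {R : realType} {k : scalar_kind}.
Local Notation F := (scalars R k).
Context {X : topologicalType} {E : normedModType F}.
Variable m : set X -> (E -> F).
Hypothesis mM : dual_measure m.

Let dual_lin A : borel A -> linear (m A : E -> F^o).
Proof. by case: mM => H _ /H[]. Qed.

Lemma dual_measure_countably_additive x : countably_additive abs (fun A => m A x).
Proof.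
have [_ [mC _ _]] := mM; move=> B bB tB.
apply/cvge0P => [n|e e0]; first by rewrite abs_nrm lee_fin nrm_ge0.
have /cvge0P H := mC B bB tB.
have nx1 : 0 < nrm x + 1 by rewrite ltr_wpDl// nrm_ge0.
have [n0 H0] := H (fun=> dual_norm_ge0 _) _ (divr_gt0 e0 nx1); exists n0 => n /H0 h.
rewrite abs_nrm lee_fin -lee_fin.
set phi := (m (\bigcup_n0 B n0) - \sum_(0 <= i < n) m (B i)) in h *.
have -> : m (\bigcup_n0 B n0) x - \sum_(0 <= i < n) m (B i) x = phi x.
  by rewrite /phi !fctE fct_sumE.
have lphi : linear (phi : E -> F^o).
  move=> c y z; rewrite /phi !fctE !fct_sumE (dual_lin (borel_bigcup bB)).
  rewrite (eq_bigr (fun i => c * m (B i) y + m (B i) z)) => [|i _].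
    by rewrite big_split/= -mulr_sumr scalerBr opprD addrACA.
  exact: dual_lin.
apply: le_trans (linear_nrm_le x lphi) _.
apply: (@le_trans _ _ ((nrm x)%:E * (e / (nrm x + 1))%:E)%E).
  by apply: lee_wpmul2l h; rewrite lee_fin nrm_ge0.
rewrite -EFinM lee_fin mulrC -[leRHS](divfK (lt0r_neq0 nx1)) ler_wpM2l ?lerDl//.
by rewrite divr_ge0// ltW.
Qed.

Lemma dual_bounded_additive :
  bounded_additive m (fun D => fine (Defs.variation (@dual_norm R k E) m D)).
Proof.
have [_ [_ mF _]] := mM.
have lin0 A : borel A -> m A 0 = 0.
  by move=> bA; have := dual_lin bA (-1) 0 0; rewrite scaler0 addr0 scaleN1r addNr.
split.
- by move=> A x y bA; have := dual_lin bA 1 x y; rewrite !scale1r.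
- by move=> A c x bA; have := dual_lin bA c x 0; rewrite !addr0 lin0// addr0.
- move=> A B x bA bB AB; have := dual_measure_countably_additive x.
  by move=> /scalar_measureU/(_ _ _ bA bB AB).
- move=> D n P y c bD bP tP PD c0 yc.
  have dge0 := @dual_norm_ge0 R k E.
  have dfin i : dual_norm (m (P i)) \is a fin_num.
    rewrite ge0_fin_numE//; apply: le_lt_trans mF; apply: le_trans (variation_ge _ _ (bP i)) _.
    exact: variation_mono.
  apply: le_trans (@nrm_sum _ _ F^o _ _ _ _) _.
  apply: (@le_trans _ _ (\sum_(i < n) c * fine (dual_norm (m (P i))))).
    apply: ler_sum => i _; apply: (@le_trans _ _ (nrm (y i) * fine (dual_norm (m (P i))))).
      rewrite -lee_fin EFinM fineK//; exact: linear_nrm_le (dual_lin (bP i)).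
    by rewrite ler_wpM2r// fine_ge0.
  have vf := variation_fin mF D.
  rewrite -mulr_sumr ler_wpM2l// -lee_fin fineK// -sumEFin.
  rewrite (eq_bigr (fun i => dual_norm (m (P i)))) => [|i _]; last by rewrite fineK.
  exact: variation_ge_family.
Qed.

End DualMeasure.

Section Adjoint.
Context {R : realType} {k : scalar_kind}.
Local Notation F := (scalars R k).
Context {K : ptopologicalType} {E : normedModType F}.
Variable nu : set (K * dual_ball E) -> F.
Hypothesis nuM : scalar_measure nu.
Local Notation sigma := (pi1_measure nuM).

Let nu_ba : bounded_additive (fun A (c : F^o) => nu A * c)
  (fun D => fine (Defs.variation abs nu D)).
Proof. by have [nuC nuF _] := nuM; exact: scalar_bounded_additive. Qed.

(** A concrete representing measure, by which the choice in [adjointT] is made from a nonempty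
    set. *)
Definition adjoint_measure (A : set K) (x : E) : F :=
  integral_sm nu (fun p => (\1_A p.1 : F) * ball_fun p.2 x).

Let integrand_regulated A x : borel A ->
  regulated ((fun p : K * dual_ball E => (\1_A p.1 : F) * ball_fun p.2 x) :
    K * dual_ball E -> F^o).
Proof.
move=> bA; apply: (@regulated_restrict _ _ _ F^o (fst @^-1` A) (fun p => ball_fun p.2 x)).
  exact: borel_cylinder.
apply: (continuous_scalar_regulated (c := nrm x)) => [|p]; last exact: ball_fun_le.
by apply: (@continuous_evalT R k E K (fun=> x)) => t; exact: cvg_cst.
Qed.

Lemma pi1_measure_fineK A : borel A -> ((fine (sigma A))%:E = sigma A)%E.
Proof. by move=> bA; rewrite fineK//; exact: fin_num_measure. Qed.

Lemma adjoint_measure_le A x : borel A ->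
  nrm (adjoint_measure A x : F^o) <= nrm x * fine (sigma A).
Proof.
move=> bA; apply: (integral_vm_bound nu_ba).
- exact: integrand_regulated.
- exact: borel_cylinder.
- exact: nrm_ge0.
- move=> p Ap; rewrite indicE mem_set// mul1r; exact: ball_fun_le.
- by move=> p Ap; rewrite indicE memNset// mul0r.
Qed.

Lemma adjoint_measure_lin A (c : F) x y : borel A ->
  adjoint_measure A (c *: x + y) = c * adjoint_measure A x + adjoint_measure A y.
Proof.
move=> bA; rewrite /adjoint_measure /integral_sm.
rewrite -(integral_vm_lin nu_ba)//; [|exact: integrand_regulated..].
by congr integral_vm; apply/funext => p; rewrite ball_funD ball_funZ mulrDr mulrCA.
Qed.

Lemma adjoint_measureU A B x : borel A -> borel B -> A `&` B = set0 ->
  adjoint_measure (A `|` B) x = adjoint_measure A x + adjoint_measure B x.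
Proof.
move=> bA bB AB; rewrite /adjoint_measure /integral_sm.
have := integral_vm_lin nu_ba (1 : F) (@integrand_regulated A x bA) (@integrand_regulated B x bB).
rewrite mul1r => <-; congr integral_vm; apply/funext => p.
rewrite scale1r -mulrDl; congr (_ * _); rewrite !indicE in_setU -natrD; congr (_%:R).
have [/set_mem pA|pA] := boolP (p.1 \in A); have [/set_mem pB|pB] := boolP (p.1 \in B) => //.
by exfalso; have : (A `&` B) p.1 by []; rewrite AB.
Qed.

Let adjoint_linear A : borel A -> linear (adjoint_measure A : E -> F^o).
Proof. by move=> bA c x y; exact: adjoint_measure_lin. Qed.

Let sigma_sum D n (P : 'I_n -> set K) : borel D -> (forall i, borel (P i)) ->
  trivIset setT P -> (forall i, P i `<=` D) ->
  (\sum_(i < n) sigma (P i) <= sigma D)%E.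
Proof.
move=> bD bP tP PD; rewrite -measure_bigsetU_ord//.
  apply: variation_mono; apply: preimage_subset.
  by apply: (big_ind (fun B => B `<=` D)) => // B C BD CD t [/BD|/CD].
Qed.

Lemma adjoint_bounded_additive :
  bounded_additive adjoint_measure (fun D => fine (sigma D)).
Proof.
split.
- by move=> A x y bA; have := adjoint_measure_lin 1 x y bA; rewrite scale1r mul1r.
- move=> A c x bA; have := adjoint_measure_lin c x 0 bA; rewrite !addr0 => ->.
  have -> : adjoint_measure A 0 = 0; last by rewrite addr0.
  apply: (@nrm_le0 _ _ F^o); apply: le_trans (adjoint_measure_le _ bA) _.
  by rewrite nrm0 mul0r.
- by move=> *; exact: adjoint_measureU.
- move=> D n P y c bD bP tP PD c0 yc.
  apply: le_trans (@nrm_sum _ _ F^o _ _ _ _) _.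
  apply: (@le_trans _ _ (\sum_(i < n) c * fine (sigma (P i)))).
    apply: ler_sum => i _; apply: le_trans (adjoint_measure_le _ (bP i)) _.
    by rewrite ler_wpM2r ?fine_ge0.
  rewrite -mulr_sumr ler_wpM2l// -lee_fin pi1_measure_fineK// -sumEFin.
  rewrite (eq_bigr (fun i => sigma (P i))) => [|i _]; last exact: pi1_measure_fineK.
  exact: sigma_sum.
Qed.

Let adjoint_dual_norm A : borel A -> (dual_norm (adjoint_measure A) <= sigma A)%E.
Proof.
move=> bA; rewrite -pi1_measure_fineK//; apply: dual_norm_le; first exact: fine_ge0.
by move=> x; rewrite mulrC; exact: adjoint_measure_le.
Qed.

Let adjoint_variation A : borel A ->
  (Defs.variation (@dual_norm R k E) adjoint_measure A <= sigma A)%E.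
Proof.
move=> bA; apply: ge_ereal_sup => _ [n [P [bP tP PA ->]]].
by apply: le_trans (sigma_sum bA bP tP PA); apply: lee_sum => i _; exact: adjoint_dual_norm.
Qed.

Let adjoint_tail (B : (set K)^nat) n : (forall n, borel (B n)) -> trivIset setT B ->
  adjoint_measure (\bigcup_n B n) - \sum_(0 <= i < n) adjoint_measure (B i) =
  adjoint_measure (\bigcup_n B n `\` \big[setU/set0]_(i < n) B i).
Proof.
move=> bB tB; apply/funext => x; rewrite !fctE fct_sumE.
have bU i : borel (\big[setU/set0]_(j < i) B j).
  by elim/big_ind : _ => //; [exact: borel0|move=> ? ?; exact: borelU].
have bUB := borel_bigcup bB.
have -> : \sum_(0 <= i < n) adjoint_measure (B i) x =
    adjoint_measure (\big[setU/set0]_(i < n) B i) x.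
  elim: n => [|n IH].
    by rewrite big_nil big_ord0 (bounded_additive0 adjoint_bounded_additive).
  rewrite big_nat_recr//= IH big_ord_recr/= adjoint_measureU//; first exact: bU.
  apply/seteqP; split=> // t []; rewrite -bigcup_mkord => -[i /= iN Gi] Gn.
  by have := tB i n I I (ex_intro _ t (conj Gi Gn)) => e; rewrite e ltnn in iN.
rewrite -[X in adjoint_measure X x - _](@setDUK _ (\big[setU/set0]_(i < n) B i)); last first.
  by rewrite -bigcup_mkord => t [i _ Bi]; exists i.
rewrite adjoint_measureU//; first by rewrite addrAC subrr add0r.
  exact: borelD.
by rewrite setDIK.
Qed.

Let adjoint_ca : countably_additive (@dual_norm R k E) adjoint_measure.
Proof.
move=> B bB tB; apply/cvge0P => [n|e e0]; first exact: dual_norm_ge0.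
have bU i : borel (\big[setU/set0]_(j < i) B j).
  by elim/big_ind : _ => //; [exact: borel0|move=> ? ?; exact: borelU].
have bUB := borel_bigcup bB.
have /= := @measure_semi_sigma_additive _ _ _ sigma B bB tB bUB.
rewrite -pi1_measure_fineK// => /fine_cvgP[_ /cvgrPdist_le/(_ _ e0)[n0 _ H]].
exists n0 => n /H/=; rewrite adjoint_tail// => h.
apply: le_trans (adjoint_dual_norm (borelD bUB (bU n))) _.
rewrite measureD//=; [|exact: bU|by rewrite -ge0_fin_numE ?fin_num_measure].
rewrite setIidr; last by rewrite -bigcup_mkord => t [i _ Bi]; exists i.
rewrite -(pi1_measure_fineK (bU n)) -(pi1_measure_fineK bUB) -EFinB lee_fin.
apply: le_trans (ler_norm _) _; apply: le_trans h.
by rewrite big_mkord measure_bigsetU//; exact: bU.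
Qed.

(** The dual norm and the variation on [A] are at most [sigma A], so finiteness, countable
    additivity and regularity are inherited from [sigma]. Regularity is asked with a strict
    inequality, hence [e / 2]. *)
Lemma adjoint_dual_measure : hausdorff_space K -> dual_measure adjoint_measure.
Proof.
move=> hK; split.
  move=> A bA; apply: (dual_space_bounded (c := fine (sigma A))); first exact: adjoint_linear.
  by move=> x; rewrite mulrC; exact: adjoint_measure_le.
split; first exact: adjoint_ca.
  apply: (le_lt_trans (adjoint_variation borelT)).
  by rewrite -pi1_measure_fineK ?ltry//; exact: borelT.
move=> A bA e e0; have e2 : 0 < e / 2 by rewrite divr_gt0.
have [C [U [cC oU CA AU UC]]] := pi1_regular nuM hK bA e2.
exists C, U; split => //.
apply: le_lt_trans (adjoint_variation _) _.
  by apply: borelD; [exact: borel_open|apply: borel_closed; exact: compact_closed].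
by apply: le_lt_trans UC _; rewrite lte_fin ltr_pdivrMr// ltr_pMr// ltr1n.
Qed.

Let simple_evalT s : borel_simple s ->
  regulated (evalT (simple_function s) : K * dual_ball E -> F^o) /\
  simple_integral adjoint_measure s = integral_sm nu (evalT (simple_function s)).
Proof.
elim: s => [_|[A x] s IH /borel_simple_cons[/= bA /IH[rs sE]]].
  have -> : evalT (simple_function [::]) = simple_function [::] :> (K * dual_ball E -> F^o).
    by apply/funext => p; rewrite /evalT /simple_function !big_nil ball_fun0.
  split; first exact: regulated_simple.
  by rewrite /integral_sm (integral_vm_simple nu_ba)// /simple_integral !big_nil.
have ri := @integrand_regulated A x bA.
have -> : evalT (simple_function ((A, x) :: s)) =
   (fun p => (1 : F) *: ((\1_A p.1 : F) * ball_fun p.2 x : F^o) + evalT (simple_function s) p).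
  apply/funext => p; rewrite /evalT simple_function_cons ball_funD ball_funZ.
  by rewrite scale1r.
split; first exact: regulated_lin.
by rewrite simple_integral_cons sE /integral_sm (integral_vm_lin nu_ba)// mul1r.
Qed.

Lemma continuous_evalT_regulated (f : K -> E) : compact [set: K] -> continuous f ->
  regulated (evalT f : K * dual_ball E -> F^o).
Proof.
move=> cK cf; have [c fc] := regulated_bounded (continuous_regulated cK cf).
apply: (continuous_scalar_regulated (c := c)); first exact: continuous_evalT.
by move=> p; exact: le_trans (ball_fun_le _ _) (fc _).
Qed.

(** Both sides agree on simple functions, and passing from [f] to [evalT f] does not increase sup
    distances; the remaining error is [e] times the total variation of [nu]. *)
Lemma integral_adjoint_measure (f : K -> E) : compact [set: K] -> continuous f ->
  integral_vm adjoint_measure f = integral_sm nu (evalT f).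
Proof.
move=> cK cf; have rf := continuous_evalT_regulated cK cf.
apply: (integral_vm_eq adjoint_bounded_additive (C := fine (Defs.variation abs nu setT))).
move=> e e0; have [s bs fs] := continuous_regulated cK cf e0.
exists s; split => //; have [rs ->] := simple_evalT bs.
have := integral_vm_lin nu_ba (-1 : F) rs rf.
rewrite mulN1r addrC => <-; rewrite mulrC.
apply: (integral_vm_bound nu_ba) => //.
- exact: regulated_lin.
- exact: borelT.
- exact: ltW.
- move=> p _; rewrite scaleN1r addrC /evalT -ball_funB.
  exact: le_trans (ball_fun_le _ _) (fs _).
- by move=> p /(_ I).
Qed.

Lemma adjointTP : compact [set: K] -> hausdorff_space K -> is_adjointT nu (adjointT nu).
Proof.
move=> cK hK; rewrite /adjointT; case: xgetP => [m _ //|/(_ adjoint_measure)[]].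
split; first exact: adjoint_dual_measure.
by move=> f cf; exact: integral_adjoint_measure.
Qed.

End Adjoint.

(** * Integrals over the completion *)

Section IntegralPm.
Context {R : realType} {k : scalar_kind}.
Local Notation F := (scalars R k).
Context {X : ptopologicalType}.
Variable sigma : {finite_measure set (borelType X) -> \bar R}.
Implicit Types (A : set (borelType X)) (f g : borelType X -> F).

Lemma completion_measurableP A g : completion_measurable sigma A g <->
  exists (N : set (borelType X)) (a b : borelType X -> R),
    [/\ measurable N, sigma N = 0%E, measurable_fun setT a, measurable_fun setT b &
    forall t, A t -> ~ N t -> g t = scalar_mk (a t) (b t)].
Proof.
split=> [[g' [mre mim [N [mN N0 NE]]]]|[N [a [b [mN N0 ma mb gE]]]]].
  exists N, (re_part \o g'), (im_part \o g'); split => // t At Nt.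
  by rewrite /= scalar_mkK; apply: contrapT => h; apply: Nt; apply: NE.
exists (fun t => scalar_mk (a t) (b t)); split.
- by rewrite (_ : _ \o _ = a)//; apply/funext => t /=; rewrite re_part_mk.
- rewrite (_ : _ \o _ = fun t => im_part (scalar_i : F) * b t).
    by apply: measurable_funM => //; exact: measurable_cst.
  by apply/funext => t /=; exact: im_part_mkE.
- by exists N; split => // t /= [At gt]; apply: contrapT => /(gE _ At).
Qed.

Lemma completion_measurable_sub A B g : A `<=` B ->
  completion_measurable sigma B g -> completion_measurable sigma A g.
Proof.
move=> AB /completion_measurableP[N [a [b [mN N0 ma mb gE]]]].
apply/completion_measurableP; exists N, a, b; split => // t /AB; exact: gE.
Qed.

Lemma completion_measurable_lin A (c : F) f g : completion_measurable sigma A f ->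
  completion_measurable sigma A g -> completion_measurable sigma A (fun t => c * f t + g t).
Proof.
move=> /completion_measurableP[N [a [b [mN N0 ma mb fE]]]].
move=> /completion_measurableP[N' [a' [b' [mN' N'0 ma' mb' gE]]]].
apply/completion_measurableP; exists (N `|` N').
exists (fun t => re_part c * a t - im_part c * b t + a' t).
exists (fun t => re_part c * b t + im_part c * a t + b' t); split.
- exact: measurableU.
- by rewrite measureU0.
- apply: measurable_funD => //; apply: measurable_funB => //;
  by apply: measurable_funM => //; exact: measurable_cst.
- apply: measurable_funD => //; apply: measurable_funD => //;
  by apply: measurable_funM => //; exact: measurable_cst.
- move=> t At /not_orP[Nt N't]; rewrite fE// gE//.
  apply: scalar_eq; rewrite ?re_partD ?im_partD ?re_partM ?im_partM ?re_part_mk//.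
    congr (_ - _ + _); rewrite im_part_mk; move: c; case: k => //= _.
    by rewrite !mul0r.
  rewrite !im_part_mk; move: c; case: k => //= c.
  by rewrite mulr0 mul0r !addr0.
Qed.

Lemma completion_measurable_restrict A g : measurable A ->
  completion_measurable sigma setT g ->
  completion_measurable sigma setT (fun t => (\1_A t : F) * g t).
Proof.
move=> mA /completion_measurableP[N [a [b [mN N0 ma mb gE]]]].
apply/completion_measurableP.
exists N, (fun t => \1_A t * a t), (fun t => \1_A t * b t); split => //.
- by apply: measurable_funM => //; exact: measurable_indic.
- by apply: measurable_funM => //; exact: measurable_indic.
- move=> t _ Nt; rewrite gE// !indicE; case: (t \in A); rewrite ?mul1r// !mul0r.
  by rewrite -/(real_scalar 0) real_scalar0.
Qed.

Lemma completion_measurable0 A : completion_measurable sigma A (fun=> 0 : F).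
Proof.
apply/completion_measurableP; exists set0, (cst 0), (cst 0); split => //.
by move=> t _ _; rewrite -/(real_scalar 0) real_scalar0.
Qed.

Lemma completion_measurable_lim A (u : nat -> borelType X -> F) g :
  (forall n, completion_measurable sigma A (u n)) ->
  (forall n t, nrm (g t - u n t : F^o) <= n.+1%:R^-1) ->
  completion_measurable sigma A g.
Proof.
move=> /choice[u' u'E] ug.
(* The upper limit is defined and measurable everywhere, also where the Borel versions [u' n] fail
   to converge. *)
pose l (p : F -> R) t := fine (limn_esup (fun n => (p (u' n t))%:E)).
have ml (p : F -> R) : (forall n, measurable_fun setT (p \o u' n)) -> measurable_fun setT (l p).
  move=> mp; apply: (measurableT_comp (fine_measurable measurableT)).
  by apply: measurable_fun_limn_esup => n; apply/measurable_EFinP; exact: mp.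
have lE (p : F -> R) t : (forall c d, p (c - d) = p c - p d) ->
    (forall c, `|p c| <= nrm (c : F^o)) -> (forall n, u' n t = u n t) -> l p t = p (g t).
  move=> pB pn u'u; rewrite /l.
  have cv : (fun n => (p (u' n t))%:E) @ \oo --> (p (g t))%:E.
    apply: cvg_EFin; first exact: nearW.
    apply/cvgrPdist_le => e e0; near=> n; rewrite /= u'u -pB.
    apply: le_trans (pn _) _; apply: le_trans (ug n t) _; apply: ltW.
    near: n; exact: near_infty_natSinv_lt (PosNum e0).
  rewrite is_cvg_limn_esupE; last by apply/cvg_ex; exists (p (g t))%:E.
  by rewrite (cvg_lim _ cv).
exists (fun t => scalar_mk (l re_part t) (l im_part t)); split.
- rewrite (_ : _ \o _ = l re_part); last by apply/funext => t /=; rewrite re_part_mk.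
  by apply: ml => n; case: (u'E n).
- rewrite (_ : _ \o _ = fun t => im_part (scalar_i : F) * l im_part t).
    apply: measurable_funM; first exact: measurable_cst.
    by apply: ml => n; case: (u'E n).
  by apply/funext => t /=; exact: im_part_mkE.
- apply: (@negligibleS _ _ _ _ (\bigcup_n [set t | A t /\ u n t <> u' n t])); last first.
    by apply: negligible_bigcup => n; case: (u'E n).
  move=> t [At gt]; apply: contrapT => Ut; apply: gt.
  have u'u n : u' n t = u n t.
    by apply: contrapT => h; apply: Ut; exists n => //; split => // /esym.
  rewrite (lE re_part) ?(lE im_part) ?scalar_mkK//.
  + exact: im_partB.
  + exact: im_part_nrm.
  + exact: re_partB.
  + exact: re_part_nrm.
Unshelve. all: by end_near. Qed.

(** A Borel version bounded at every point makes the integration lemmas available for functions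
    measurable only for the completion. *)
Definition ae_bounded A (c : R) (u : borelType X -> R) :=
  exists (N : set (borelType X)) (a : borelType X -> R),
    [/\ measurable N, sigma N = 0%E, measurable_fun setT a, (forall t, `|a t| <= c)
      & forall t, A t -> ~ N t -> u t = a t].

Lemma ae_bounded_sub A B c u : A `<=` B -> ae_bounded B c u -> ae_bounded A c u.
Proof.
by move=> AB [N [a [mN N0 ma ac ua]]]; exists N, a; split => // t /AB; exact: ua.
Qed.

Let bounded_part A c g (p : F -> R) : (forall t, A t -> nrm (g t : F^o) <= c) -> 0 <= c ->
  (forall z, `|p z| <= nrm (z : F^o)) ->
  (exists g' : borelType X -> F, measurable_fun setT (p \o g') /\
     sigma.-negligible [set t | A t /\ g t <> g' t]) ->
  ae_bounded A c (p \o g).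
Proof.
move=> gc c0 pn [g' [mp [N [mN N0 NE]]]].
exists N, (fun t => Num.max (- c) (Num.min c (p (g' t)))); split => //.
- by apply: measurable_maxr => //; apply: measurable_minr.
- move=> t; rewrite ler_norml le_max lexx /= ge_max ge_min lexx /= andbT.
  by rewrite (le_trans _ c0)// oppr_le0.
- move=> t At Nt /=; have <- : g t = g' t by apply: contrapT => h; apply: Nt; exact: NE.
  have := le_trans (pn (g t)) (gc _ At); rewrite ler_norml => /andP[h1 h2].
  by rewrite (min_idPr h2) (max_idPr h1).
Qed.

Lemma ae_bounded_re A c g : completion_measurable sigma A g ->
  (forall t, A t -> nrm (g t : F^o) <= c) -> 0 <= c -> ae_bounded A c (re_part \o g).
Proof.
move=> [g' [mre _ N]] gc c0; apply: bounded_part => //; first exact: re_part_nrm.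
by exists g'.
Qed.

Lemma ae_bounded_im A c g : completion_measurable sigma A g ->
  (forall t, A t -> nrm (g t : F^o) <= c) -> 0 <= c -> ae_bounded A c (im_part \o g).
Proof.
move=> [g' [_ mim N]] gc c0; apply: bounded_part => //; first exact: im_part_nrm.
by exists g'.
Qed.

Let ae_bounded_integral A (N : set (borelType X)) (u a : borelType X -> R) :
  measurable N -> sigma N = 0%E -> (forall t, A t -> ~ N t -> u t = a t) ->
  \int[sigma]_(t in A) u t = \int[sigma]_(t in A) a t.
Proof.
move=> mN N0 ua; congr fine; apply: (integral_eq_off_null mN N0) => t At Nt.
by congr EFin; exact: ua.
Qed.

Lemma ae_bounded_lin A c c' (r : R) (u v : borelType X -> R) : measurable A ->
  ae_bounded A c u -> ae_bounded A c' v ->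
  \int[sigma]_(t in A) (r * u t + v t) =
  r * \int[sigma]_(t in A) u t + \int[sigma]_(t in A) v t.
Proof.
move=> mA [N [a [mN N0 ma ac ua]]] [N' [b [mN' N'0 mb bc vb]]].
rewrite (ae_bounded_integral mN N0 ua) (ae_bounded_integral mN' N'0 vb).
rewrite (@ae_bounded_integral _ (N `|` N') _ (fun t => r * a t + b t)).
- have Ia := @bounded_integrable _ _ _ sigma _ _ _ mA ma ac.
  have Ib := @bounded_integrable _ _ _ sigma _ _ _ mA mb bc.
  rewrite RintegralD//; first by rewrite RintegralZl.
  by apply: eq_integrable (integrableZl mA r Ia) => // t _ /=; rewrite EFinM.
- exact: measurableU.
- by rewrite measureU0.
- by move=> t At /not_orP[Nt N't]; rewrite ua// vb.
Qed.

Lemma ae_bounded_le A c (u : borelType X -> R) : measurable A -> ae_bounded A c u ->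
  `|\int[sigma]_(t in A) u t| <= c * fine (sigma A).
Proof.
move=> mA [N [a [mN N0 ma ac ua]]]; rewrite (ae_bounded_integral mN N0 ua).
have Ia := @bounded_integrable _ _ _ sigma _ _ _ mA ma ac.
apply: le_trans (le_normr_Rintegral mA Ia) _.
rewrite -Rintegral_cst//; apply: le_Rintegral => //.
- exact: integrable_norm.
- exact: finite_measure_integrable_cst.
Qed.

Lemma re_integral_pm A g :
  re_part (integral_pm sigma A g) = \int[sigma]_(t in A) re_part (g t).
Proof. exact: re_part_mk. Qed.

Lemma im_integral_pm A g :
  im_part (integral_pm sigma A g) = \int[sigma]_(t in A) im_part (g t).
Proof.
rewrite /integral_pm im_part_mk; move: g; case: k => //= g.
by rewrite /Rintegral integral0_eq.
Qed.

Lemma integral_pm_lin A (c : F) f g (M M' : R) : measurable A ->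
  completion_measurable sigma A f -> completion_measurable sigma A g ->
  (forall t, A t -> nrm (f t : F^o) <= M) -> (forall t, A t -> nrm (g t : F^o) <= M') ->
  0 <= M -> 0 <= M' ->
  integral_pm sigma A (fun t => c * f t + g t) =
  c * integral_pm sigma A f + integral_pm sigma A g.
Proof.
move=> mA mf mg fM gM M0 M'0.
have fr := ae_bounded_re mf fM M0; have fi := ae_bounded_im mf fM M0.
have gr := ae_bounded_re mg gM M'0; have gi := ae_bounded_im mg gM M'0.
have comb (r s : R) (u v w : borelType X -> R) : ae_bounded A M u -> ae_bounded A M v ->
    ae_bounded A M' w -> \int[sigma]_(t in A) (r * u t + s * v t + w t) =
    r * \int[sigma]_(t in A) u t + s * \int[sigma]_(t in A) v t + \int[sigma]_(t in A) w t.
  move=> bu bv bw; rewrite -addrA -(ae_bounded_lin s mA bv bw).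
  rewrite -(@ae_bounded_lin _ M (`|s| * M + M'))//.
    by congr Rintegral; apply/funext => t; rewrite addrA.
  move: bv bw => [N [a [mN N0 ma ac ua]]] [N' [b [mN' N'0 mb bc vb]]].
  exists (N `|` N'), (fun t => s * a t + b t); split.
  - exact: measurableU.
  - by rewrite measureU0.
  - by apply: measurable_funD => //; apply: measurable_funM => //; exact: measurable_cst.
  - move=> t; apply: le_trans (ler_normD _ _) (lerD _ (bc t)).
    by rewrite normrM ler_wpM2l.
  - by move=> t At /not_orP[Nt N't]; rewrite ua// vb.
apply: scalar_eq.
  rewrite re_partD re_partM !re_integral_pm im_integral_pm -mulNr -(comb _ _ _ _ _ fr fi gr).
  by congr Rintegral; apply/funext => t; rewrite /= re_partD re_partM mulNr.
rewrite im_partD im_partM re_integral_pm !im_integral_pm -(comb _ _ _ _ _ fi fr gi).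
by congr Rintegral; apply/funext => t; rewrite /= im_partD im_partM.
Qed.

(** The factor 2 comes from estimating the real and the imaginary part separately; it is harmless
    where the bound is made arbitrarily small. *)
Lemma integral_pm_le A g (M : R) : measurable A -> completion_measurable sigma A g ->
  (forall t, A t -> nrm (g t : F^o) <= M) -> 0 <= M ->
  nrm (integral_pm sigma A g : F^o) <= M * fine (sigma A) *+ 2.
Proof.
move=> mA mg gM M0; apply: le_trans (nrm_le_parts _) _.
rewrite re_integral_pm im_integral_pm mulr2n.
by apply: lerD; apply: ae_bounded_le => //; [exact: ae_bounded_re|exact: ae_bounded_im].
Qed.

Lemma integral_pm_restrict A g :
  integral_pm sigma A g = integral_pm sigma setT (fun t => (\1_A t : F) * g t).
Proof.
have H (p : F -> R) : p 0 = 0 -> \int[sigma]_(t in A) p (g t) =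
    \int[sigma]_(t in setT) p ((\1_A t : F) * g t).
  move=> p0; rewrite /Rintegral integral_mkcond; congr fine.
  apply: eq_integral => t _; rewrite /patch indicE; case: (t \in A).
    by rewrite mul1r.
  by rewrite mul0r p0.
apply: scalar_eq; rewrite ?re_integral_pm ?im_integral_pm; apply: H.
  exact: re_part0.
exact: im_part0.
Qed.

Lemma integral_pm_le_support A g (M : R) : measurable A ->
  completion_measurable sigma setT g -> (forall t, A t -> nrm (g t : F^o) <= M) ->
  (forall t, ~ A t -> g t = 0) -> 0 <= M ->
  nrm (integral_pm sigma setT g : F^o) <= M * fine (sigma A) *+ 2.
Proof.
move=> mA mg gM g0 M0.
have <- : integral_pm sigma A g = integral_pm sigma setT g.
  rewrite integral_pm_restrict; congr integral_pm; apply/funext => t; rewrite indicE.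
  have [/set_mem At|/negP At] := boolP (t \in A); rewrite ?mul1r// g0 ?mulr0//.
  by move=> /mem_set.
apply: integral_pm_le => //; exact: completion_measurable_sub mg.
Qed.

Lemma bounded_integrable_pm A g (M : R) : measurable A ->
  completion_measurable sigma A g -> (forall t, A t -> nrm (g t : F^o) <= M) ->
  integrable_pm sigma A g.
Proof.
move=> mA mg gM; split => //.
apply: (@le_lt_trans _ _ (\int[sigma]_(t in A) (`|M|)%:E)%E).
  apply: (@ge0_integral_le_off_null _ _ _ _ _ set0) => //.
  - by move=> t _; rewrite abs_nrm lee_fin nrm_ge0.
  - by move=> t At _; rewrite abs_nrm lee_fin; apply: le_trans (gM _ At) (ler_norm _).
rewrite integral_cst// -ge0_fin_numE ?mule_ge0//.
by rewrite fin_numM// fin_num_measure.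
Qed.

End IntegralPm.

(** * Densities of the adjoint measure *)

Section Representation.
Context {R : realType} {k : scalar_kind}.
Local Notation F := (scalars R k).
Context {K : ptopologicalType} {E : normedModType F}.
Variable sigma : {finite_measure set (borelType K) -> \bar R}.
Hypothesis compactK : compact [set: K].
Variables (m : set K -> E -> F) (W : set K -> R) (h : K -> dual_ball E).
Hypothesis mW : bounded_additive m W.
Hypothesis h_measurable : forall x,
  completion_measurable sigma setT (fun t => ball_fun (h t) x).
Hypothesis h_density : forall A x, borel A ->
  m A x = integral_pm sigma A (fun t => ball_fun (h t) x).

Let simple_bounded (s : seq (set K * E)) : exists2 M : R, 0 <= M &
  forall t, nrm (ball_fun (h t) (simple_function s t) : F^o) <= M.
Proof.
exists (\sum_(p <- s) nrm p.2); first by apply: sumr_ge0 => p _; exact: nrm_ge0.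
move=> t; apply: le_trans (ball_fun_le _ _) _; apply: le_trans (nrm_sum _ _ _) _.
apply: ler_sum => p _; rewrite nrmZ indicE; case: (_ \in _).
  by rewrite -real_scalar1 nrm_real_scalar normr1 mul1r.
by rewrite (@nrm0 _ _ F^o) mul0r nrm_ge0.
Qed.

Let indic_bounded (A : set K) x t : nrm ((\1_A t : F) * ball_fun (h t) x : F^o) <= nrm x.
Proof.
rewrite indicE; case: (_ \in _); rewrite ?mul1r ?ball_fun_le//.
by rewrite mul0r (@nrm0 _ _ F^o) nrm_ge0.
Qed.

Let simple_density (s : seq (set K * E)) : borel_simple s ->
  completion_measurable sigma setT (fun t => ball_fun (h t) (simple_function s t)) /\
  simple_integral m s = integral_pm sigma setT (fun t => ball_fun (h t) (simple_function s t)).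
Proof.
elim: s => [_|[A x] s IH /borel_simple_cons[/= bA /[dup] bs /IH[ms sE]]].
  have -> : (fun t => ball_fun (h t) (simple_function [::] t)) = (fun=> 0).
    by apply/funext => t; rewrite /simple_function big_nil ball_fun0.
  split; first exact: completion_measurable0.
  rewrite /simple_integral big_nil; apply/esym; apply: (@nrm_le0 _ _ F^o).
  have := @integral_pm_le_support _ _ _ sigma setT (fun=> 0 : F) 0 measurableT.
  rewrite mul0r mul0rn; apply => //; first exact: completion_measurable0.
  by move=> t _; rewrite (@nrm0 _ _ F^o).
have -> : (fun t => ball_fun (h t) (simple_function ((A, x) :: s) t)) =
   (fun t => 1 * ((\1_A t : F) * ball_fun (h t) x) + ball_fun (h t) (simple_function s t)).
  by apply/funext => t; rewrite simple_function_cons ball_funD ball_funZ mul1r.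
have mA : completion_measurable sigma setT (fun t => (\1_A t : F) * ball_fun (h t) x).
  exact: completion_measurable_restrict.
split; first exact: completion_measurable_lin.
have [M M0 sM] := simple_bounded s.
rewrite simple_integral_cons sE (integral_pm_lin 1 measurableT mA ms
  (fun t _ => indic_bounded A x t) (fun t _ => sM t) (nrm_ge0 _) M0).
by rewrite mul1r h_density// integral_pm_restrict.
Qed.

(** Each [h t] has norm at most one, so a uniform approximation of [f] by simple functions gives one
    of [t |-> h t (f t)]; this yields its measurability as well as its integral. *)
Lemma density_represents (f : K -> E) : continuous f ->
  integrable_pm sigma setT (fun t => ball_fun (h t) (f t)) /\
  integral_vm m f = integral_pm sigma setT (fun t => ball_fun (h t) (f t)).
Proof.
move=> cf; have rf := continuous_regulated compactK cf.
have [c fc] := regulated_bounded rf.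
have hc t : nrm (ball_fun (h t) (f t) : F^o) <= c by exact: le_trans (ball_fun_le _ _) (fc t).
have close s e t : nrm (f t - simple_function s t) <= e ->
    nrm (ball_fun (h t) (f t) - ball_fun (h t) (simple_function s t) : F^o) <= e.
  by move=> fs; rewrite -ball_funB; exact: le_trans (ball_fun_le _ _) fs.
have mf : completion_measurable sigma setT (fun t => ball_fun (h t) (f t)).
  have /choice[s sE] : forall n : nat, exists s, borel_simple s /\
      forall t, nrm (f t - simple_function s t) <= n.+1%:R^-1.
    by move=> n; have [|s bs fs] := rf n.+1%:R^-1; [rewrite invr_gt0|exists s].
  apply: (@completion_measurable_lim _ _ _ _ _ (fun n t => ball_fun (h t) (simple_function (s n) t))).
    by move=> n; exact: (simple_density (sE n).1).1.
  by move=> n t; apply: close; exact: (sE n).2.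
have c0 : 0 <= c by exact: le_trans (nrm_ge0 _) (fc point).
split; first exact: bounded_integrable_pm.
apply: (integral_vm_eq mW (C := fine (sigma setT) *+ 2)) => e e0.
have [s bs fs] := rf _ e0; exists s; split => //.
have [ms ->] := simple_density bs; have [M M0 sM] := simple_bounded s.
have := integral_pm_lin (-1) measurableT ms mf (fun t _ => sM t) (fun t _ => hc t) M0 c0.
rewrite mulN1r addrC => <-; rewrite mulrC mulrnAr.
apply: integral_pm_le => //.
- exact: completion_measurable_lin.
- by move=> t _; rewrite mulN1r addrC; exact: close.
- exact: ltW.
Qed.

End Representation.

Section AdjointDensity.
Context {R : realType} {k : scalar_kind}.
Local Notation F := (scalars R k).
Context {K : ptopologicalType} {E : normedModType F}.
Hypothesis compactK : compact [set: K].
Hypothesis hausdorffK : hausdorff_space K.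
Variable nu : set (K * dual_ball E) -> F.
Hypothesis nuM : scalar_measure nu.
Local Notation sigma := (pi1_measure nuM).

Let represents (h : K -> dual_ball E) := forall f : K -> E, continuous f ->
  integrable_pm sigma setT (fun t => ball_fun (h t) (f t)) /\
  integral_vm (adjointT nu) f = integral_pm sigma setT (fun t => ball_fun (h t) (f t)).

(* The linearity of the lifting makes the densities linear in [x] at every point. *)
Lemma exists_real_density : exists w : K -> E -> R, [/\
  forall t x y, w t (x + y) = w t x + w t y,
  forall t (a : R) x, w t (real_scalar a *: x) = a * w t x,
  forall t x, `|w t x| <= nrm x,
  forall x, ae_bounded sigma setT (nrm x) (w^~ x) &
  forall A x, borel A -> re_part (adjoint_measure nu A x) = \int[sigma]_(t in A) w t x].
Proof.
have ba := adjoint_bounded_additive nuM.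
have /choice[g gE] : forall x : E, exists g : borelType K -> R,
    [/\ measurable_fun setT g, forall t, `|g t| <= nrm x &
    forall A, borel A -> re_part (adjoint_measure nu A x) = \int[sigma]_(t in A) g t].
  move=> x; apply: dominated_density.
  - move=> A mA; apply: le_trans (re_part_nrm _) _; exact: adjoint_measure_le.
  - by move=> A B mA mB AB; rewrite -re_partD -(adjoint_measureU nuM).
  - exact: nrm_ge0.
have [rho rhoL] := lifting_exists sigma.
have bg x : bounded_measurable measurable (g x).
  by have [mg gc _] := gE x; exact: bounded_measurable_measurable mg gc.
(* An identity between the set functions passes to their densities a.e. and then to the lifted
   densities at every point. *)
have lin (a : R) x y z : (forall A, borel A -> re_part (adjoint_measure nu A z) =
    a * re_part (adjoint_measure nu A x) + re_part (adjoint_measure nu A y)) ->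
    forall t, rho (g z) t = a * rho (g x) t + rho (g y) t.
  move=> zE t; have [_ rlin _] := rhoL; rewrite -rlin//.
  have bxy := bounded_measurable_lin a (bg x) (bg y).
  apply: (lifting_ae_eq rhoL) => //.
  apply: (bounded_measurable_ae_eq (G := measurable)) => // A mA.
  have mA' : measurable A by exact: (@g_sigma_measurable _ _ measurable).
  rewrite RintegralD//; last 2 first.
  - exact: (bounded_measurable_integrable _ _ (bounded_measurableZ a (bg x))).
  - exact: (bounded_measurable_integrable _ _ (bg y)).
  rewrite RintegralZl//; last exact: (bounded_measurable_integrable _ _ (bg x)).
  have [_ _ <-] := gE x; last exact: mA'.
  have [_ _ <-] := gE y; last exact: mA'.
  have [_ _ <-] := gE z; last exact: mA'.
  exact: zE.
have rho_le t x : `|rho (g x) t| <= nrm x.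
  have [_ _ rb] := rhoL; have [_ gc _] := gE x.
  apply: rb => //; first exact: nrm_ge0.
  by apply: filterS filterT.
exists (fun t x => rho (g x) t); split => //.
- move=> t x y; rewrite (lin 1 x y) ?mul1r// => A bA; rewrite mul1r -re_partD.
  by case: ba => -> .
- move=> t a x; rewrite (lin a x 0) => [|A bA].
    have /eqP -> : rho (g 0) t == 0 by rewrite -normr_le0 -(@nrm0 R k E).
    by rewrite addr0.
  case: (ba) => _ -> // _ _.
  by rewrite (bounded_additiver0 ba)// re_part0 addr0 re_partM re_real_scalar im_real_scalar mul0r subr0.
- move=> x; have [rae _ _] := rhoL; have [mg gc _] := gE x.
  have [N [mN N0 NE]] := rae _ (bg x).
  exists N, (g x); split => // t _ Nt; apply: contrapT => h; exact: Nt (NE _ h).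
- move=> A x bA; have [rae _ _] := rhoL; have [mg gc gint] := gE x.
  have [N [mN N0 NE]] := rae _ (bg x).
  rewrite gint//; congr fine; apply: (integral_eq_off_null mN N0) => t _ Nt.
  by congr EFin; apply: contrapT => h; apply: Nt; apply: NE => e; exact: h.
Qed.

Lemma exists_density : exists h : K -> dual_ball E,
  (forall x, completion_measurable sigma setT (fun t => ball_fun (h t) x)) /\
  forall A x, borel A ->
    adjoint_measure nu A x = integral_pm sigma A (fun t => ball_fun (h t) x).
Proof.
have [w [wD wZ w_le w_ae wE]] := exists_real_density.
have ba := adjoint_bounded_additive nuM.
(* [j] is [1] for complex scalars and [0] for real ones, where [scalar_i] is [0]; the identity [jj]
   lets one computation cover both. *)
pose j := im_part (scalar_i : F).
have jj (c : F) : j * im_part c = im_part c.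
  by rewrite -[c in RHS]scalar_mkK im_part_mkE.
have rei : re_part (scalar_i : F) = 0 by exact: re_part_mk.
have wc t (c : F) x : w t (c *: x) = re_part c * w t x + im_part c * w t (scalar_i *: x).
  by rewrite [c in LHS]scalarE scalerDl wD wZ [scalar_i * _]mulrC -scalerA wZ.
(* A functional is determined by its real part: [phi(x) = w(x) - i w(i x)]. *)
pose phi t x : F := scalar_mk (w t x) (- w t (scalar_i *: x)).
have phi_re t x : re_part (phi t x) = w t x by exact: re_part_mk.
have phi_im t x : im_part (phi t x) = - (j * w t (scalar_i *: x)).
  by rewrite im_part_mkE mulrN.
have phiZ t (c : F) x : phi t (c *: x) = c * phi t x.
  apply: scalar_eq; rewrite ?re_partM ?im_partM !phi_re !phi_im.
    by rewrite wc mulrN opprK mulrCA mulrA jj.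
  have iE : w t (scalar_i *: (c *: x)) =
      - im_part c * w t x + j * re_part c * w t (scalar_i *: x).
    by rewrite scalerA wc re_partM im_partM rei !mul0r sub0r add0r -/j jj.
  have -> : - (j * w t (scalar_i *: (c *: x))) =
      (j * im_part c) * w t x - (j * j) * re_part c * w t (scalar_i *: x).
    by rewrite iE; ring.
  by rewrite jj [j * j]jj -/j; ring.
have phi_lin t : linear (phi t : E -> F^o).
  move=> c x y; have -> : phi t (c *: x + y) = phi t (c *: x) + phi t y.
    by rewrite /phi scalar_mkD scalerDr !wD opprD.
  by rewrite phiZ.
(* Rotating [x] makes [phi t x] real, where it is bounded through [w]. *)
have phi_le t x : nrm (phi t x : F^o) <= nrm x.
  have [->|c0] := eqVneq (phi t x) 0; first by rewrite (@nrm0 _ _ F^o) nrm_ge0.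
  pose theta : F := real_scalar (nrm (phi t x : F^o)) / phi t x.
  have thetaE : theta * phi t x = real_scalar (nrm (phi t x : F^o)) by rewrite divfK.
  have n0 : 0 < nrm (phi t x : F^o).
    rewrite lt_neqAle nrm_ge0 andbT eq_sym; apply: contra_neq c0 => h.
    by apply: (@nrm_le0 _ _ F^o); rewrite h.
  have theta1 : nrm (theta : F^o) = 1.
    apply: (mulIf (lt0r_neq0 n0)); rewrite -nrmM thetaE nrm_real_scalar mul1r.
    by rewrite ger0_norm// ltW.
  have <- : re_part (phi t (theta *: x)) = nrm (phi t x : F^o).
    by rewrite phiZ thetaE re_real_scalar.
  rewrite phi_re; apply: le_trans (ler_norm _) _; apply: le_trans (w_le _ _) _.
  by rewrite nrmZ theta1 mul1r.
have /choice[h hE] : forall t, exists b : dual_ball E, ball_fun b = phi t.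
  by move=> t; exact: dual_ball_bounded.
have hphi x : (fun t => ball_fun (h t) x) = phi^~ x by apply/funext => t; rewrite hE.
exists h; split => [x|A x bA]; rewrite hphi.
  have [N [g [mN N0 mg _ wg]]] := w_ae x.
  have [N' [g' [mN' N'0 mg' _ wg']]] := w_ae (scalar_i *: x).
  apply/completion_measurableP; exists (N `|` N'), g, (fun t => - g' t); split => //.
  - exact: measurableU.
  - by rewrite measureU0.
  - exact: measurable_funN.
  - by move=> t _ /not_orP[Nt N't]; rewrite /phi wg// wg'.
apply: scalar_eq.
  rewrite re_integral_pm wE//; congr Rintegral; apply/funext => t; exact/esym/phi_re.
have wA := ae_bounded_sub (@subsetT _ A) (w_ae (scalar_i *: x)).
rewrite im_integral_pm.
(* The integrand [-j w] is written in the shape [r * u + v] of [ae_bounded_lin]. *)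
have -> : (fun t => im_part (phi t x)) =
    (fun t => (- j - 1) * w t (scalar_i *: x) + w t (scalar_i *: x)).
  by apply/funext => t; rewrite phi_im; ring.
rewrite (ae_bounded_lin _ _ wA wA)// -wE//.
have -> : adjoint_measure nu A (scalar_i *: x) = scalar_i * adjoint_measure nu A x.
  by case: ba => _ ->.
rewrite re_partM rei mul0r sub0r -/j jj.
by rewrite -[LHS]jj; ring.
Qed.

Lemma integral_adjointT (f : K -> E) : continuous f ->
  integral_vm (adjointT nu) f = integral_sm nu (evalT f).
Proof. by have [_] := adjointTP nuM compactK hausdorffK; apply. Qed.

Lemma exists_represents : exists h, represents h.
Proof.
have [h [hm hd]] := exists_density; exists h => f cf.
have := density_represents compactK (adjoint_bounded_additive nuM) hm hd cf.
by rewrite (integral_adjoint_measure nuM compactK cf) -integral_adjointT.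
Qed.

Lemma barycenter_represents (nut : K -> set (dual_ball E) -> F) :
  disintegration_kernel nu nut ->
  exists h : K -> dual_ball E,
    (forall t, ball_fun (h t) = barycenter (nut t)) /\ represents h.
Proof.
move=> [nut_prob nut_int _ _].
have ba t : bounded_additive (fun A (c : F^o) => nut t A * c)
    (fun D => fine (Defs.variation abs (nut t) D)).
  by have [[nuC nuF _] _] := nut_prob t; exact: scalar_bounded_additive.
have reg x : regulated ((fun phi : dual_ball E => ball_fun phi x) : dual_ball E -> F^o).
  apply: (continuous_scalar_regulated (c := nrm x)); first exact: continuous_ball_fun.
  by move=> phi; exact: ball_fun_le.
have /choice[h hE] : forall t, exists b : dual_ball E, ball_fun b = barycenter (nut t).
  move=> t; apply: dual_ball_bounded.
    move=> c x y; rewrite /barycenter /integral_sm -(integral_vm_lin (ba t))//.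
    by congr integral_vm; apply/funext => phi; rewrite ball_funD ball_funZ.
  move=> x; have [_ v1] := nut_prob t.
  (* The total variation [1] of [nut t] enters as the mass in the integral bound and so puts the
     barycenter into the dual ball. *)
  rewrite -[leRHS]mulr1 -[1]/(fine 1%E) -v1.
  apply: (integral_vm_bound (ba t)) => //.
  - exact: borelT.
  - exact: nrm_ge0.
  - by move=> phi _; exact: ball_fun_le.
  - by move=> phi /(_ I).
exists h; split => // f cf.
have [mf fE] := nut_int _ (@continuous_evalT _ _ _ _ _ cf).
have hf : (fun t => ball_fun (h t) (f t)) =
    (fun t => integral_sm (nut t) (fun z => evalT f (t, z))).
  by apply/funext => t; rewrite hE.
have [c fc] := regulated_bounded (continuous_regulated compactK cf).
rewrite integral_adjointT// fE hf; split => //.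
apply: (bounded_integrable_pm (M := c)) => // t _.
have -> : integral_sm (nut t) (fun z => evalT f (t, z)) = ball_fun (h t) (f t) by rewrite hE.
exact: le_trans (ball_fun_le _ _) (fc _).
Qed.

(** [h] and [adjointT nu] are known to match on continuous functions only. The test function [f] is
    [x] times a Urysohn function and differs from [x] times the indicator of [A] only on [U] minus
    [C], so its common integral is close to both sides. *)
Lemma represents_adjointT (h : K -> dual_ball E) : represents h ->
  forall (A : set K) (x : E), borel A ->
    integrable_pm sigma A (fun t => ball_fun (h t) x) /\
    adjointT nu A x = integral_pm sigma A (fun t => ball_fun (h t) x).
Proof.
move=> hR A x bA.
have [dm _] := adjointTP nuM compactK hausdorffK.
have ba := dual_bounded_additive dm.
set m := adjointT nu in dm ba *.
set W := (fun D => fine (Defs.variation (@dual_norm R k E) m D)) in ba.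
(* Measurability of [t |-> h t x] comes from the constant function [x], which is continuous. *)
have [[mx _] _] := hR (fun=> x) (fun t => cvg_cst _).
have mAx := completion_measurable_sub (@subsetT _ A) mx.
have hx t : nrm (ball_fun (h t) x : F^o) <= nrm x by exact: ball_fun_le.
split; first exact: (bounded_integrable_pm (M := nrm x)).
apply: subr0_eq; apply: (@nrm_le0 _ _ F^o); apply/ler_addgt0Pr => e e0; rewrite add0r.
(* [est1] costs [nrm x * e'] and [est2] twice as much, which makes three; the added [1] keeps the
   divisor positive for [x = 0]. *)
pose e' := e / (nrm x * 3%:R + 1).
have nx3 : 0 < nrm x * 3%:R + 1 by rewrite ltr_wpDl// mulr_ge0// nrm_ge0.
have e'0 : 0 < e' by rewrite divr_gt0.
have [C1 [U1 [cC1 oU1 CA1 AU1 UC1]]] := pi1_regular nuM hausdorffK bA e'0.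
have [_ [_ mfin mreg]] := dm.
have [C2 [U2 [cC2 oU2 CA2 AU2 UC2]]] := mreg _ bA _ e'0.
(* The first pair is adapted to [sigma], the second to the variation of [m]. The difference of [U]
   and [C] lies in the differences of both pairs, so one test function serves both measures. *)
pose C := C1 `|` C2; pose U := U1 `&` U2.
have clC : closed C by apply: closedU; exact: compact_closed.
have oU : open U by exact: openI.
have CA : C `<=` A by move=> t [/CA1|/CA2].
have AU : A `<=` U by move=> t At; split; [exact: AU1|exact: AU2].
have bD : borel (U `\` C) by apply: borelD; [exact: borel_open|exact: borel_closed].
have [phi [cphi phi0 phi1 phi01]] : exists phi : K -> R, [/\ continuous phi,
    phi @` (~` U) `<=` [set 0], phi @` C `<=` [set 1] & range phi `<=` `[0, 1]].
  apply: urysohn_ext_itv => //.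
  - exact: compact_normal.
  - exact: open_closedC.
  - by apply/seteqP; split => // t [nU /CA/AU].
have phiC t : C t -> phi t = 1 by move=> Ct; apply: phi1; exists t.
have phiU t : ~ U t -> phi t = 0 by move=> Ut; apply: phi0; exists t.
have phi_itv t : 0 <= phi t <= 1.
  by have /phi01 : range phi (phi t) by exists t.
pose f t : E := (real_scalar (phi t) : F) *: x.
have cf : continuous f.
  move=> t; apply: cvgZl.
  apply/cvgrPdist_le => a a0.
  have aE := ge0_real_scalar (ltW a0).
  have r0 : 0 < re_part a by rewrite -(@ltr_real_scalar R k) -aE real_scalar0.
  have := cphi t => /cvgrPdist_le/(_ _ r0); apply: filterS => s ts.
  by rewrite [leRHS]aE -real_scalarB (nrmE (_ : F^o)) nrm_real_scalar ler_real_scalar.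
have [[mf _] fE] := hR f cf.
have phi_indic t : `|\1_A t - phi t| <= 1.
  have /andP[p0 p1] := phi_itv t; rewrite ler_norml indicE; case: (t \in A) => /=.
    by apply/andP; split; lra.
  by apply/andP; split; lra.
have phi_out t : ~ (U `\` C) t -> phi t = \1_A t.
  move=> nD; rewrite indicE; have [Ut|Ut] := pselect (U t); last first.
    by rewrite phiU// memNset// => /AU.
  have Ct : C t by apply: contrapT => nC; apply: nD.
  by rewrite phiC// mem_set//; exact: CA.
have indic_real t : (\1_A t : F) = real_scalar (\1_A t).
  by rewrite !indicE; case: (t \in A); rewrite ?real_scalar1 ?real_scalar0.
have est1 : nrm (integral_vm m f - m A x : F^o) <= nrm x * e'.
  have bs : borel_simple [:: (A, x)] by move=> p; rewrite inE => /eqP ->.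
  have sE : simple_integral m [:: (A, x)] = m A x by rewrite /simple_integral big_seq1.
  rewrite -sE -(integral_vm_simple ba bs).
  have diffE t : -1 *: simple_function [:: (A, x)] t + f t =
      (real_scalar (phi t - \1_A t) : F) *: x.
    rewrite /simple_function big_seq1 /= indic_real /f real_scalarB scalerBl scaleN1r.
    exact: addrC.
  have := integral_vm_lin ba (-1) (regulated_simple bs) (continuous_regulated compactK cf).
  rewrite mulN1r addrC => <-.
  apply: (@le_trans _ _ (nrm x * W (U `\` C))).
    apply: (integral_vm_bound ba) => //.
    + by apply: regulated_lin; [exact: regulated_simple|exact: continuous_regulated].
    + exact: nrm_ge0.
    + move=> t _; rewrite diffE nrmZ nrm_real_scalar distrC ler_piMl//; exact: nrm_ge0.
    + by move=> t /phi_out e1; rewrite diffE e1 subrr real_scalar0 scale0r.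
  rewrite ler_wpM2l ?nrm_ge0//.
  rewrite -lee_fin /W fineK; last exact: variation_fin mfin _.
  apply: le_trans (ltW UC2); apply: variation_mono => t [[_ U2t] nC]; split => // C2t.
  by apply: nC; right.
have est2 : nrm (integral_vm m f - integral_pm sigma A (fun t => ball_fun (h t) x) : F^o) <=
    nrm x * e' *+ 2.
  rewrite fE (integral_pm_restrict _ A).
  have indic_le t : nrm ((\1_A t : F) * ball_fun (h t) x : F^o) <= nrm x.
    rewrite indicE; case: (_ \in _); rewrite ?mul1r ?ball_fun_le//.
    by rewrite mul0r (@nrm0 _ _ F^o) nrm_ge0.
  have f_le t : nrm (ball_fun (h t) (f t) : F^o) <= nrm x.
    apply: le_trans (ball_fun_le _ _) _; rewrite /f nrmZ nrm_real_scalar.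
    have /andP[p0 p1] := phi_itv t.
    by rewrite ger0_norm// ler_piMl// nrm_ge0.
  have mAx' := completion_measurable_restrict bA mx.
  have diffE t : -1 * ((\1_A t : F) * ball_fun (h t) x) + ball_fun (h t) (f t) =
      real_scalar (phi t - \1_A t) * ball_fun (h t) x.
    by rewrite /f ball_funZ indic_real real_scalarB; ring.
  suff : nrm (integral_pm sigma setT (fun t =>
      -1 * ((\1_A t : F) * ball_fun (h t) x) + ball_fun (h t) (f t)) : F^o) <= nrm x * e' *+ 2.
    rewrite (integral_pm_lin (-1) measurableT mAx' mf (fun t _ => indic_le t)
      (fun t _ => f_le t) (nrm_ge0 _) (nrm_ge0 _)) mulN1r addrC; exact.
  apply: (@le_trans _ _ (nrm x * fine (sigma (U `\` C)) *+ 2)).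
    apply: integral_pm_le_support => //.
    + exact: completion_measurable_lin.
    + move=> t _; rewrite diffE nrmM nrm_real_scalar distrC.
      by apply: le_trans (hx t); rewrite ler_piMl// nrm_ge0.
    + by move=> t /phi_out e1; rewrite diffE e1 subrr real_scalar0 mul0r.
    + exact: nrm_ge0.
  rewrite lerMn2r/= ler_wpM2l ?nrm_ge0// -lee_fin pi1_measure_fineK//.
  apply: le_trans UC1; apply: variation_mono => p [[U1t _] nC]; split => // C1t.
  by apply: nC; left.
rewrite -[m A x](subrK (integral_vm m f)) -addrA.
apply: le_trans (@nrmD _ _ F^o _ _) _; rewrite (@nrmB _ _ F^o).
apply: le_trans (lerD est1 est2) _.
have -> : nrm x * e' + nrm x * e' *+ 2 = e' * (nrm x * 3%:R) by ring.
by rewrite -[leRHS](divfK (lt0r_neq0 nx3)) ler_wpM2l ?lerDl// ltW.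
Qed.

End AdjointDensity.

(** Integrability belongs to each formula because [integral_pm] assigns a value to every function,
    with the intended meaning for integrable ones. *)
Theorem proposition3p3 (R : realType) (k : scalar_kind)
    (K : ptopologicalType) (E : completeNormedModType (scalars R k))
    (compactK : compact [set: K]) (hausdorffK : hausdorff_space K)
    (nu : set (K * dual_ball E) -> scalars R k) (nuM : scalar_measure nu) :
  let sigma := pi1_variation nu in
  let represents (h : K -> dual_ball E) :=
    forall f : K -> E, continuous f ->
      integrable_pm sigma setT (fun t => ball_fun (h t) (f t)) /\
      integral_vm (adjointT nu) f =
        integral_pm sigma setT (fun t => ball_fun (h t) (f t)) in
  [/\ exists h : K -> dual_ball E, represents h,
      forall h : K -> dual_ball E, represents h ->
        forall (A : set K) (x : E), borel A ->
          integrable_pm sigma A (fun t => ball_fun (h t) x) /\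
          adjointT nu A x = integral_pm sigma A (fun t => ball_fun (h t) x)
    & forall nut : K -> set (dual_ball E) -> scalars R k,
        disintegration_kernel nu nut ->
        exists h : K -> dual_ball E,
          (forall t, ball_fun (h t) = barycenter (nut t)) /\ represents h].
Proof.
(* [pi1_measure nuM] unfolds to [pi1_variation nu], so the results proved for the measure structure
   apply by conversion. *)
move=> sigma represents; split.
- exact: (exists_represents compactK hausdorffK nuM).
- by move=> h hR A x bA; exact: (represents_adjointT compactK hausdorffK (nuM := nuM)).
- by move=> nut nutK; exact: (barycenter_represents compactK hausdorffK nuM nutK).
Qed.
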